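(* There exists a constant $C$ (independent of $h$ and of how $\Gamma$ cuts the mesh $\mathcal T_h$) such that $$|a_h(u_h,v_h)|\le C\|u_h\|_{\mathrm{DG}}\|v_h\|_{\mathrm{DG}},\qquad\forall u_h,v_h\in V_{h,0},$$ and, with a sufficiently large $\mu$, there exists a constant $C$ (independent of $h$ and of how $\Gamma$ cuts the mesh $\mathcal T_h$) such that $$a_h(v_h,v_h)\ge C\|v_h\|_{\mathrm{DG}}^2,\qquad\forall v_h\in V_{h,0}^m.$$
   Context: **Domain and mesh.** $d\in\{2,3\}$; $\Omega\subset\mathbb R^d$ is a convex polygonal (polyhedral) domain; $\Omega_0\Subset\Omega$ is an open subdomain with $C^2$-smooth or convex polygonal (polyhedral) boundary $\Gamma:=\partial\Omega_0$. $\mathcal T_h$ is a quasi-uniform triangulation of $\Omega$ into simplices: with $h_K=\operatorname{diam}K$, $h=\max_{K\in\mathcal T_h}h_K$ and $\rho_K$ the radius of the largest ball inscribed in $K$, there is a constant $C$ (independent of $h$) with $h\le C\rho_K$ for all $K\in\mathcal T_h$. Elements are understood as open simplices ($\overline K$ is the closure), faces as relatively open. $\mathcal E_h$ is the set of all $(d-1)$-dimensional faces, $h_e=\operatorname{diam}e$. **Sub-meshes.** $\mathcal T_h^0=\{K\in\mathcal T_h: K\cap\Omega_0\ne\varnothing\}$, $\mathcal T_h^{0,\circ}=\{K\in\mathcal T_h^0: K\subset\Omega_0\}$, $\mathcal E_h^0=\{e\in\mathcal E_h: e\cap\Omega_0\ne\varnothing\}$, $\mathcal E_h^{0,\circ}=\{e\in\mathcal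 E_h^0: e\subset\Omega_0\}$, $\mathcal T_h^\Gamma=\{K\in\mathcal T_h: K\cap\Gamma\ne\varnothing\}$, $\mathcal E_h^\Gamma=\{e\in\mathcal E_h: e\cap\Gamma\ne\varnothing\}$. As part of the setting, $\mathcal T_h^\Gamma=\mathcal T_h^0\setminus\mathcal T_h^{0,\circ}$ and $\mathcal E_h^\Gamma=\mathcal E_h^0\setminus\mathcal E_h^{0,\circ}$. For $K\in\mathcal T_h^\Gamma$, $\Gamma_K:=K\cap\Gamma$. **Mesh assumptions.** (i) For every $e\in\mathcal E_h^\Gamma$, $e\cap\Gamma$ is simply connected ($\Gamma$ does not cross a face multiple times). (ii) For every $K\in\mathcal T_h^\Gamma$ there is an element $K^\circ\in\Delta(K)\cap\mathcal T_h^{0,\circ}$, where $\Delta(K)=\{K'\in\mathcal T_h:\overline{K'}\cap\overline K\ne\varnothing\}$; one such $K^\circ$ is assigned to each $K$. **Approximation space.** Let $m\ge1$. $V_{h,0}^{m,\circ}$ is either the $C^0$ finite element space or the discontinuous space of functions on $\mathcal T_h^{0,\circ}$ whose restriction to each $K\in\mathcal T_h^{0,\circ}$ lies in $\mathbb P_m(K)$ (polynomials of degree $m$, i.e. at most $m$). For $v_h\in V_{h,0}^{m,\circ}$ the extension $E_{h,0}v_h$ is the piecewise polynomial on $\mathcal T_h^0$ with $(E_{h,0}v_h)|_K=v_h|_K$ for $K\in\mathcal T_h^{0,\circ}$, and, for $K\in\mathcal T_h^\Gamma$, $(E_{h,0}v_h)|_K$ equal to the restriction to $K$ of the polynomial (on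 all of $\mathbb R^d$) having the same expression as $v_h|_{K^\circ}$. Set $V_{h,0}^m=\{E_{h,0}v_h: v_h\in V_{h,0}^{m,\circ}\}$ and $V_{h,0}=V_{h,0}^m+H^2(\Omega_0)$. **Jumps and averages.** On an interior face $e$ shared by $K^\pm$ with unit outward normals $\mathbf n^\pm$: $[\![v]\!]=v|_{K^+}\mathbf n^++v|_{K^-}\mathbf n^-$, and $\{\mathbf q\}$ is the arithmetic mean of the two traces of $\mathbf q$. On $\Gamma_K$, with $\mathbf n$ the unit outward normal on $\Gamma$: $[\![v]\!]=v\,\mathbf n$, $\{\mathbf q\}=\mathbf q$. **Bilinear form.** With penalty parameter $\mu>0$, $$\begin{aligned}a_h(u_h,v_h)=&\sum_{K\in\mathcal T_h^0}\int_{K\cap\Omega_0}\nabla u_h\cdot\nabla v_h\,dx-\sum_{e\in\mathcal E_h^0}\int_{e\cap\Omega_0}\Big(\{\nabla u_h\}\cdot[\![v_h]\!]+\{\nabla v_h\}\cdot[\![u_h]\!]-\tfrac{\mu}{h_e}[\![u_h]\!]\cdot[\![v_h]\!]\Big)ds\\&-\sum_{K\in\mathcal T_h^\Gamma}\int_{\Gamma_K}\Big(\{\nabla u_h\}\cdot[\![v_h]\!]+\{\nabla v_h\}\cdot[\![u_h]\!]-\tfrac{\mu}{h_K}[\![u_h]\!]\cdot[\![v_h]\!]\Big)ds.\end{aligned}$$ **Energy norm.** For $v\in V_{h,0}$, $$\begin{aligned}\|v\|_{\mathrm{DG}}^2=&\sum_{K\in\mathcal T_h^0}\|\nabla v\|_{L^2(K\cap\Omega_0)}^2+\sum_{e\in\mathcal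 E_h^0}h_e\|\{\nabla v\}\|_{L^2(e\cap\Omega_0)}^2+\sum_{e\in\mathcal E_h^0}h_e^{-1}\|[\![v]\!]\|_{L^2(e\cap\Omega_0)}^2\\&+\sum_{K\in\mathcal T_h^\Gamma}h_K\|\{\nabla v\}\|_{L^2(\Gamma_K)}^2+\sum_{K\in\mathcal T_h^\Gamma}h_K^{-1}\|[\![v]\!]\|_{L^2(\Gamma_K)}^2.\end{aligned}$$ *)

(* Defs.v *)
From HB Require Import structures.
From mathcomp Require Import all_boot all_order all_algebra.
From mathcomp Require Import all_classical all_reals all_analysis.
From mathcomp Require Import zify.

Set Implicit Arguments.
Unset Strict Implicit.
Unset Printing Implicit Defensive.

Import Order.TTheory GRing.Theory Num.Theory.
Import numFieldNormedType.Exports.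

Local Open Scope classical_set_scope.
Local Open Scope ring_scope.

Definition rV_display : measure_display. Proof. exact: default_measure_display. Qed.

Section measurable_rV.
Context {R : realType} {n : nat}.

Definition rV_coord (i : 'I_n) (x : 'rV[R]_n) : R := x 0 i.

HB.instance Definition _ := @isMeasurable.Build rV_display 'rV[R]_n
  (g_sigma_preimage rV_coord) (@sigma_algebra0 _ setT _)
  (@sigma_algebraC _ _) (@sigma_algebra_bigcup _ setT _).

Lemma measurable_coord (i : 'I_n) :
  measurable_fun [set: 'rV[R]_n] (fun x : 'rV[R]_n => x 0 i).
Proof.
move=> _ Y mY; rewrite setTI; apply: sub_sigma_algebra => /=.
rewrite -bigcup_seq/=; exists i => /=; first by rewrite mem_index_enum.
by exists Y => //; rewrite setTI.
Qed.

Lemma measurable_fun_rV d (T : measurableType d) (f : T -> 'rV[R]_n) :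
  (forall i, measurable_fun [set: T] (fun t => f t 0 i)) ->
  measurable_fun [set: T] f.
Proof.
move=> mf _ A mA; rewrite setTI.
suff : g_sigma_preimage rV_coord `<=` [set B | measurable (f @^-1` B)].
  exact.
apply: smallest_sub.
  split => /=.
  - by rewrite preimage_set0.
  - by move=> B mB; rewrite setTD preimage_setC; exact: measurableC.
  - by move=> F mF; rewrite preimage_bigcup; exact: bigcup_measurable.
rewrite -bigcup_seq => B [i _ [Y mY <-]] /=; rewrite setTI.
by have := mf i measurableT Y mY; rewrite setTI.
Qed.

End measurable_rV.

Section lebesgue_rV.
Context {R : realType}.
Local Notation leb := (@lebesgue_measure R).

Definition consrV n (p : R * 'rV[R]_n) : 'rV[R]_n.+1 :=
  @row_mx R 1 1 n p.1%:M p.2.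

Lemma consrV0 n (p : R * 'rV[R]_n) : consrV p 0 ord0 = p.1.
Proof.
have p1E : (p.1%:M : 'M[R]_1) 0 0 = p.1 by rewrite mxE eqxx.
rewrite -[RHS]p1E -(@row_mxEl R 1 1 n p.1%:M p.2).
by congr (row_mx _ _ _ _); exact: val_inj.
Qed.

Lemma consrVS n (p : R * 'rV[R]_n) j : consrV p 0 (lift ord0 j) = p.2 0 j.
Proof.
by rewrite -(@row_mxEr R 1 1 n p.1%:M p.2); congr (row_mx _ _ _ _); exact: val_inj.
Qed.

Lemma measurable_consrV n : measurable_fun [set: R * 'rV[R]_n] (@consrV n).
Proof.
apply: measurable_fun_rV => i.
case: (unliftP ord0 i) => [j ->|->].
  under eq_fun do rewrite consrVS.
  by apply: (measurableT_comp (measurable_coord j)) => //.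
under eq_fun do rewrite consrV0; exact: measurable_fst.
Qed.

Lemma consrV_sigma_finite n (m : {sigma_finite_measure set 'rV[R]_n -> \bar R}) :
  sigma_finite setT (pushforward (leb \x m)%E (@consrV n)).
Proof.
have /sigma_finiteP[F [TF ndF Foo]] := sigma_finiteT leb.
have /sigma_finiteP[G [TG ndG Goo]] := sigma_finiteT m.
pose u (x : 'rV[R]_n.+1) : R * 'rV[R]_n :=
  (x 0 ord0, \row_j x 0 (lift ord0 j)).
have mu : measurable_fun setT u.
  apply/measurable_fun_pairP; split; first exact: measurable_coord.
  apply: measurable_fun_rV => i /=.
  by under eq_fun do rewrite mxE; exact: measurable_coord.
have uK p : u (consrV p) = p.
  rewrite /u consrV0; case: p => a v /=; congr pair.
  by apply/rowP => j; rewrite mxE consrVS.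
exists (fun k => u @^-1` (F k `*` G k)).
  rewrite -preimage_bigcup -[LHS](preimage_setT u); congr (_ @^-1` _).
  apply/seteqP; split=> // -[a v] _ /=.
  have [i _ Fi] : (\bigcup_i F i) a by rewrite -TF.
  have [j _ Gj] : (\bigcup_j G j) v by rewrite -TG.
  exists (maxn i j) => //; split => /=.
  - by apply: (subsetPset _ _ (ndF _ _ (leq_maxl i j))).
  - by apply: (subsetPset _ _ (ndG _ _ (leq_maxr i j))).
move=> k; have [mF Fk] := Foo k; have [mG Gk] := Goo k; split.
  by rewrite -[X in measurable X]setTI; apply: mu => //; exact: measurableX.
rewrite /pushforward -comp_preimage.
rewrite (_ : u \o _ = id) /=; last by apply/funext => p /=; rewrite uK.
by rewrite preimage_id product_measure1E// lte_mul_pinfty// ge0_fin_numE.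
Qed.

Section step.
Context (n : nat) (m : {sigma_finite_measure set 'rV[R]_n -> \bar R}).
Definition consrV_measure : set 'rV[R]_n.+1 -> \bar R :=
  pushforward (leb \x m)%E (@consrV n).
HB.instance Definition _ :=
  Measure.copy consrV_measure (measure_function_pushforward__canonical__measure_function_Measure (leb \x m)%E (@measurable_consrV n)).
HB.instance Definition _ := Measure_isSigmaFinite.Build _ _ _ consrV_measure
  (consrV_sigma_finite m).
End step.

Fixpoint lebesgue_rV n : {sigma_finite_measure set 'rV[R]_n -> \bar R} :=
  if n is n'.+1 then consrV_measure (lebesgue_rV n') else dirac (0 : 'rV[R]_0).

End lebesgue_rV.

Section euclidean.
Context {R : realType} {n : nat}.
Implicit Types (x y : 'rV[R]_n) (A : set 'rV[R]_n).

Definition dotr x y : R := \sum_i x 0 i * y 0 i.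
Definition enorm x : R := Num.sqrt (dotr x x).
Definition eball x (r : R) : set 'rV[R]_n := [set y | enorm (y - x) < r].
Definition ediam A : \bar R :=
  ereal_sup [set (enorm (x - y))%:E | x in A & y in A].

Lemma coord_le_enorm x i : `|x 0 i| <= enorm x.
Proof.
rewrite -sqrtr_sqr /enorm ler_sqrt ?sumr_ge0// => [|j _]; last first.
  by rewrite -expr2 sqr_ge0.
rewrite /dotr (bigD1 i)//= expr2 lerDl sumr_ge0// => j _.
by rewrite -expr2 sqr_ge0.
Qed.

Lemma ediam_ge0 A : A !=set0 -> (0 <= ediam A)%E.
Proof.
move=> [x Ax]; apply: ereal_sup_ubound; exists x => //; exists x => //.
rewrite subrr /enorm /dotr big1 ?sqrtr0// => i _.
by rewrite mxE mul0r.
Qed.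

Lemma le_enorm_ediam A x y : A x -> A y -> ((enorm (x - y))%:E <= ediam A)%E.
Proof. by move=> Ax Ay; apply: ereal_sup_ubound; exists x => //; exists y. Qed.

End euclidean.

Section hausdorff.
Context {R : realType}.
Local Open Scope ereal_scope.

Fixpoint unit_ball_volume (s : nat) : R :=
  match s with
  | 0 => 1
  | 1 => 2
  | s'.+2 => (2 * pi / s%:R * unit_ball_volume s')%R
  end.

Lemma unit_ball_volume_ge0 s : (0 <= unit_ball_volume s)%R.
Proof.
elim/ltn_ind: s => -[|[|s]] IH //=.
by rewrite mulr_ge0 ?IH// divr_ge0// mulr_ge0// pi_ge0.
Qed.

Context {n : nat} (s : nat).
Implicit Types A B F X : set 'rV[R]_n.

(* mu_ext takes the infimum over countable measurable covers, and every set has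
   a closed cover of the same diameter. The infinite value excludes the covers
   with a set of diameter larger than dlt; the constant makes the s-dimensional
   measure agree with Lebesgue measure on s-planes. *)
Definition hausdorff_gauge (dlt : R) A : \bar R :=
  if `[< A = set0 >] then 0
  else if ediam A <= dlt%:E then
    (unit_ball_volume s / 2 ^+ s)%:E * ediam A ^+ s
  else +oo.

Definition hausdorff A : \bar R :=
  ereal_sup [set mu_ext (hausdorff_gauge dlt) A | dlt in [set r : R | (0 < r)%R]].

Lemma hausdorff_gauge0 dlt : hausdorff_gauge dlt set0 = 0.
Proof. by rewrite /hausdorff_gauge; case: asboolP. Qed.

Lemma hausdorff_gauge_ge0 dlt A : 0 <= hausdorff_gauge dlt A.
Proof.
rewrite /hausdorff_gauge; case: asboolP => // /eqP/set0P A0.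
case: ifP => // _; rewrite mule_ge0 ?expe_ge0 ?ediam_ge0// lee_fin.
by rewrite divr_ge0 ?exprn_ge0 ?unit_ball_volume_ge0.
Qed.
Hint Resolve hausdorff_gauge0 hausdorff_gauge_ge0 : core.

Lemma le_hausdorff_gauge dlt dlt' A : (dlt <= dlt')%R ->
  hausdorff_gauge dlt' A <= hausdorff_gauge dlt A.
Proof.
move=> dd; rewrite /hausdorff_gauge; case: asboolP => // _.
case: ifPn => Ad'; case: ifPn => Ad //; first by rewrite leey.
by rewrite (le_trans Ad) ?lee_fin in Ad'.
Qed.

Lemma mu_gauge_ge0 dlt A : 0 <= mu_ext (hausdorff_gauge dlt) A.
Proof. exact: (mu_ext_ge0 (hausdorff_gauge_ge0 dlt)). Qed.
Hint Resolve mu_gauge_ge0 : core.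

Lemma hausdorff_ge (dlt : R) A : (0 < dlt)%R ->
  mu_ext (hausdorff_gauge dlt) A <= hausdorff A.
Proof. by move=> d0; apply: ereal_sup_ubound; exists dlt. Qed.

Lemma hausdorff0 : hausdorff set0 = 0.
Proof.
apply/eqP; rewrite eq_le; apply/andP; split.
  by apply: ge_ereal_sup => _ [dlt _ <-]; rewrite mu_ext0.
by rewrite (le_trans _ (hausdorff_ge set0 (@ltr01 R)))// mu_ext_ge0.
Qed.

Lemma hausdorff_ge0 A : 0 <= hausdorff A.
Proof.
exact: le_trans (hausdorff_ge A (@ltr01 R)).
Qed.

Lemma le_hausdorff : {homo hausdorff : A B / A `<=` B >-> A <= B}.
Proof.
move=> A B AB; apply: ge_ereal_sup => _ [dlt d0 <-].
by rewrite (le_trans _ (hausdorff_ge B d0))// le_mu_ext.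
Qed.

Lemma hausdorff_sigma_subadditive : sigma_subadditive hausdorff.
Proof.
move=> F; apply: ge_ereal_sup => _ [dlt d0 <-].
apply: le_trans (mu_ext_sigma_subadditive (hausdorff_gauge_ge0 dlt) F) _.
by apply: lee_nneseries => // k _; exact: hausdorff_ge.
Qed.

HB.instance Definition _ := isOuterMeasure.Build R _ hausdorff
  hausdorff0 hausdorff_ge0 le_hausdorff hausdorff_sigma_subadditive.

Lemma mu_ext_gauge_separated (i : 'I_n) (a b dlt : R) A B : (a < b)%R ->
  (dlt < b - a)%R -> (forall x, A x -> x 0 i <= a)%R ->
  (forall x, B x -> b <= x 0 i)%R ->
  mu_ext (hausdorff_gauge dlt) A + mu_ext (hausdorff_gauge dlt) B <=
  mu_ext (hausdorff_gauge dlt) (A `|` B).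
Proof.
move=> ab dab Aa Bb; apply: le_ereal_inf_tmp => _ [F [mF FAB] <-].
pose HA := [set x : 'rV[R]_n | x 0 i <= a]%R.
pose HB := [set x : 'rV[R]_n | b <= x 0 i]%R.
pose FA k := if `[< F k `&` HA !=set0 >] then F k else set0.
pose FB k := if `[< F k `&` HB !=set0 >] then F k else set0.
have cA : measurable_cover A FA.
  split=> [k|x Ax]; first by rewrite /FA; case: asboolP.
  have [k _ Fx] : (\bigcup_k F k) x by apply: FAB; left.
  exists k => //; rewrite /FA; case: asboolP => //; case; exists x; split => //.
  exact: Aa.
have cB : measurable_cover B FB.
  split=> [k|x Bx]; first by rewrite /FB; case: asboolP.
  have [k _ Fx] : (\bigcup_k F k) x by apply: FAB; right.
  exists k => //; rewrite /FB; case: asboolP => //; case; exists x; split => //.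
  exact: Bb.
apply: (@le_trans _ _ (\sum_(k <oo) hausdorff_gauge dlt (FA k) +
                       \sum_(k <oo) hausdorff_gauge dlt (FB k))).
  by apply: leeD; apply: ereal_inf_lbound; [exists FA|exists FB].
rewrite -nneseriesD//; apply: lee_nneseries => [k _ _|k _].
  by rewrite adde_ge0.
rewrite /FA /FB; case: asboolP => [[x [Fx xa]]|_]; last first.
  by case: ifP => _; rewrite hausdorff_gauge0 add0e.
case: asboolP => [[y [Fy yb]]|_]; last by rewrite hausdorff_gauge0 adde0.
suff -> : hausdorff_gauge dlt (F k) = +oo by rewrite addye.
rewrite /hausdorff_gauge; case: asboolP => [F0|_]; first by rewrite F0 in Fx.
rewrite ifF//; apply/negbTE; rewrite -ltNge.
apply: lt_le_trans (le_enorm_ediam Fy Fx); rewrite lte_fin.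
apply: lt_le_trans dab _; apply: le_trans (coord_le_enorm _ i).
by rewrite !mxE (le_trans _ (ler_norm _))// lerB.
Qed.

Lemma hausdorff_separated (i : 'I_n) (a b : R) A B : (a < b)%R ->
  (forall x, A x -> x 0 i <= a)%R -> (forall x, B x -> b <= x 0 i)%R ->
  hausdorff A + hausdorff B <= hausdorff (A `|` B).
Proof.
move=> ab Aa Bb.
have [->|ABoo] := eqVneq (hausdorff (A `|` B)) +oo; first by rewrite leey.
have fAB : hausdorff (A `|` B) \is a fin_num.
  by rewrite ge0_fin_numE ?hausdorff_ge0// ltey.
have fA : hausdorff A \is a fin_num.
  rewrite ge0_fin_numE ?hausdorff_ge0//; apply: le_lt_trans (_ : _ < +oo).
    exact: (le_hausdorff (@subsetUl _ A B)).
  by rewrite ltey.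
have fB dlt : (0 < dlt)%R -> mu_ext (hausdorff_gauge dlt) B \is a fin_num.
  move=> d0; rewrite ge0_fin_numE//.
  apply: le_lt_trans (_ : hausdorff (A `|` B) < +oo); last by rewrite ltey.
  by apply: le_trans (hausdorff_ge B d0) _; exact: (le_hausdorff (@subsetUr _ A B)).
rewrite addeC -leeBrDr//; apply: ge_ereal_sup => _ [d1 d10 <-].
rewrite leeBrDr// addeC -leeBrDr ?fB//; apply: ge_ereal_sup => _ [d2 d20 <-].
rewrite leeBrDr ?fB//.
pose dlt := Num.min (Num.min d1 d2) ((b - a) / 2)%R.
have d0 : (0 < dlt)%R by rewrite !lt_min d10 d20/= divr_gt0// subr_gt0.
apply: (@le_trans _ _ (mu_ext (hausdorff_gauge dlt) A + mu_ext (hausdorff_gauge dlt) B)).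
  apply: leeD; apply: le_ereal_inf_tmp => _ [F cF <-].
    apply: le_trans (_ : \sum_(k <oo) hausdorff_gauge d2 (F k) <= _).
      by apply: ereal_inf_lbound; exists F.
    by apply: lee_nneseries => // k _; apply: le_hausdorff_gauge; rewrite !ge_min lexx orbT.
  apply: le_trans (_ : \sum_(k <oo) hausdorff_gauge d1 (F k) <= _).
    by apply: ereal_inf_lbound; exists F.
  by apply: lee_nneseries => // k _; apply: le_hausdorff_gauge; rewrite !ge_min lexx.
apply: le_trans (hausdorff_ge (A `|` B) d0).
apply: (mu_ext_gauge_separated (i := i) (a := a) (b := b)) => //.
by rewrite !gt_min ltr_pdivrMr// ltr_pMr ?subr_gt0// ltr1n orbT.
Qed.

Lemma hausdorff_layers (i : 'I_n) (t : R^nat) X b :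
  (forall k, t k < t k.+1)%R ->
  \sum_(k <oo) hausdorff
    (X `&` [set x : 'rV[R]_n | t (k.*2 + b)%N < x 0 i <= t (k.*2 + b).+1]%R) <= hausdorff X.
Proof.
move=> tS; have ndt : {homo t : x y / (x <= y)%N >-> (x <= y)%R}.
  by apply: homo_leq => [x|x y z|k]; [exact: lexx|exact: le_trans|exact/ltW].
pose L k := X `&` [set x : 'rV[R]_n | t (k.*2 + b)%N < x 0 i <= t (k.*2 + b).+1]%R.
rewrite -/(L _).
apply: lime_le; first by apply: is_cvg_nneseries => k _ _; exact: hausdorff_ge0.
apply: nearW => m.
apply: (@le_trans _ _ (hausdorff (\bigcup_(k < m) L k))); last first.
  by apply: le_hausdorff => x [k _ []].
elim: m => [|m IH]; first by rewrite big_geq// hausdorff_ge0.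
rewrite big_nat_recr//= bigcup_mkord big_ord_recr/= -bigcup_mkord.
apply: le_trans (leeD IH (lexx _)) _.
apply: (hausdorff_separated (i := i)
  (a := if m is m'.+1 then t (m'.*2 + b).+1 else t b - 1) (b := t (m.*2 + b)%N)).
- by case: m {IH} => [|m]; [rewrite ltrBlDr ltrDl | rewrite doubleS !addSn].
- move=> x [k /= km [_ /andP[_ xk]]]; case: m km {IH} => // m km.
  by rewrite (le_trans xk)// ndt// ltnS leq_add2r leq_double -ltnS.
- by move=> x [_ /andP[/ltW]].
Qed.

Lemma hausdorff_halfspace (i : 'I_n) (c : R) :
  hausdorff.-caratheodory [set x : 'rV[R]_n | x 0 i < c]%R.
Proof.
apply: le_caratheodory_measurable => X /=; set S := [set x | _].
have [->|Xoo] := eqVneq (hausdorff X) +oo; first by rewrite leey.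
have fX : hausdorff X < +oo by rewrite ltey.
pose t (k : nat) : R := (c - k.+1%:R^-1)%R.
have tS k : (t k < t k.+1)%R by rewrite ltrD2l ltrN2 ltf_pV2 ?posrE// ltr_nat.
have tc k : (t k < c)%R by rewrite ltrBlDr ltrDl.
have ndt : {homo t : x y / (x <= y)%N >-> (x <= y)%R}.
  by apply: homo_leq => [x|x y z|k]; [exact: lexx|exact: le_trans|exact/ltW].
pose L b k := X `&` [set x : 'rV[R]_n | t (k.*2 + b)%N < x 0 i <= t (k.*2 + b).+1]%R.
have tail0 b : \sum_(N <= k <oo) hausdorff (L b k) @[N --> \oo] --> 0.
  apply: nneseries_tail_cvg => [|k _]; last exact: hausdorff_ge0.
  exact: le_lt_trans (hausdorff_layers i X b tS) fX.
suff main N : hausdorff (X `&` S) + hausdorff (X `&` ~` S) <= hausdorff X +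
    (\sum_(N <= k <oo) hausdorff (L 0%N k) + \sum_(N <= k <oo) hausdorff (L 1%N k)).
  have cv : hausdorff X + (\sum_(N <= k <oo) hausdorff (L 0%N k) +
      \sum_(N <= k <oo) hausdorff (L 1%N k)) @[N --> \oo] --> hausdorff X + (0 + 0).
    apply: cvgeD; first by rewrite addr0 fin_num_adde_defl.
      exact: cvg_cst.
    by apply: cvgeD => //.
  rewrite !adde0 in cv; rewrite -(cvg_lim _ cv)//.
  by apply: lime_ge; [apply/cvg_ex; exists (hausdorff X)|exact: nearW].
pose A := X `&` [set x : 'rV[R]_n | x 0 i <= t N.*2]%R.
have cov : X `&` S `<=` A `|` (\bigcup_(k in ~` `I_N) L 0%N k `|`
                               \bigcup_(k in ~` `I_N) L 1%N k).
  move=> x [Xx xc].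
  have [xN|Nx] := leP (x 0%R i) (t N.*2); first by left.
  right.
  have [p xp] : exists p, (x 0 i <= t p)%R.
    have [p pP] := ltr_add_invr xc; exists p.
    by rewrite /t lerBrDr ltW.
  pose P p := (x 0 i <= t p)%R.
  have exP : exists p, P p by exists p.
  case: (ex_minnP exP) => -[|q] Pq minq.
    have := lt_le_trans Nx (le_trans Pq (ndt _ _ (leq0n N.*2))).
    by rewrite ltxx.
  have tq : (t q < x 0 i)%R by rewrite ltNge; apply/negP => /minq; rewrite ltnn.
  have Nq : (N.*2 <= q)%N.
    rewrite leqNgt; apply/negP => qN.
    by have := lt_le_trans Nx (le_trans Pq (ndt _ _ qN)); rewrite ltxx.
  have qE := odd_double_half q.
  case oq : (odd q) qE => qE; [right|left]; exists q./2 => /=.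
  - by apply/negP; rewrite -leqNgt -leq_double; move: Nq; rewrite -qE; lia.
  - by split=> //=; rewrite addnC qE tq.
  - by apply/negP; rewrite -leqNgt -leq_double; move: Nq; rewrite -qE; lia.
  - by split=> //=; rewrite addnC qE tq.
apply: (@le_trans _ _ (hausdorff A + (\sum_(N <= k <oo) hausdorff (L 0%N k) +
    \sum_(N <= k <oo) hausdorff (L 1%N k)) + hausdorff (X `&` ~` S))).
  apply: leeD => //; apply: le_trans (le_hausdorff cov) _.
  apply: le_trans (outer_measureU2 _ _ _) _; apply: leeD => //.
  apply: le_trans (outer_measureU2 _ _ _) _.
  by apply: leeD; exact: outer_measure_sigma_subadditive_tail.
rewrite addeAC; apply: leeD => //.
apply: le_trans (hausdorff_separated (i := i) (a := t N.*2) (b := c) _ _ _) _ => //.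
- by move=> x [].
- by move=> x [_ /negP]; rewrite -leNgt.
- by apply: le_hausdorff => x [[]|[]].
Qed.

Lemma measurable_hausdorff A : measurable A -> hausdorff.-caratheodory A.
Proof.
have sc : sigma_algebra setT hausdorff.-caratheodory.
  split.
  - exact: caratheodory_measurable_set0.
  - by move=> B cB; rewrite setTD; exact: caratheodory_measurable_setC.
  - by move=> F cF; exact: caratheodory_measurable_bigcup.
apply: smallest_sub => //.
rewrite -bigcup_seq => B [i _ [Y mY <-]] /=; rewrite setTI.
suff h : (@ocitv R).-sigma.-measurable `<=` [set C : set R | hausdorff.-caratheodory (rV_coord i @^-1` C)].
  exact: (h Y mY).
rewrite measurable_realfun.RGenInftyO.measurableE; apply: smallest_sub.
  case: sc => s0 sC sU; split => /=.
  - by rewrite preimage_set0.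
  - by move=> C cC; rewrite setTD -preimage_setC -setTD; exact: sC.
  - by move=> F cF; rewrite preimage_bigcup; exact: sU.
move=> _ [c ->]; have := hausdorff_halfspace i c.
by rewrite (_ : [set x | _] = rV_coord i @^-1` `]-oo, c[%classic).
Qed.

Lemma hausdorff_sigma_additive : semi_sigma_additive hausdorff.
Proof.
move=> F mF tF mUF.
exact: (caratheodory_measure_sigma_additive (mu := hausdorff)
  (fun k => measurable_hausdorff (mF k)) tF (measurable_hausdorff mUF)).
Qed.

HB.instance Definition _ := isMeasure.Build _ _ _ hausdorff
  hausdorff0 hausdorff_ge0 hausdorff_sigma_additive.

End hausdorff.


Section function_spaces.
Context {R : realType} {d : nat}.
Implicit Types (D : set 'rV[R]_d) (f g phi : 'rV[R]_d -> R).
Local Notation leb := (lebesgue_rV d).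
Local Notation "''e_' i" := (delta_mx 0 i : 'rV[R]_d) (at level 8, i at level 2).

Fixpoint class_C (k : nat) f : Prop :=
  if k is k'.+1 then
    continuous f /\
    forall i : 'I_d, (forall x, derivable f x 'e_i) /\ class_C k' ('D_('e_i) f)
  else continuous f.

Definition test_function D phi : Prop :=
  [/\ forall k, class_C k phi, compact (closure [set x | phi x != 0]) &
      closure [set x | phi x != 0] `<=` D].

Definition loc_integrable D f : Prop :=
  measurable_fun D f /\
  forall A, compact A -> A `<=` D -> leb.-integrable A (EFin \o f).

Definition weak_partial D (i : 'I_d) f g : Prop :=
  [/\ loc_integrable D f, loc_integrable D g &
      forall phi, test_function D phi ->
        \int[leb]_(x in D) (f x * 'D_('e_i) phi x) =
        - \int[leb]_(x in D) (g x * phi x)].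

(* Determined up to a Lebesgue-negligible set; 0 if f has no weak gradient. *)
Definition weak_gradient D f : 'rV[R]_d -> 'rV[R]_d :=
  xget (fun=> 0 : 'rV[R]_d)
    [set G : 'rV[R]_d -> 'rV[R]_d | forall i, weak_partial D i f (fun x => G x 0 i)].

Definition L2_fun D f : Prop :=
  measurable_fun D f /\ leb.-integrable D (fun x => (f x ^+ 2)%:E).

Definition H2_fun D f : Prop :=
  L2_fun D f /\
  exists (g : 'I_d -> 'rV[R]_d -> R) (h : 'I_d -> 'I_d -> 'rV[R]_d -> R),
    forall i, [/\ weak_partial D i f (g i), L2_fun D (g i) &
      forall j, weak_partial D j (g i) (h i j) /\ L2_fun D (h i j)].

(* For f in W^{1,1}(D), this limit of means exists and equals the trace of f at
   almost every point, for the surface measure, of any Lipschitz part of the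
   boundary of D (Evans and Gariepy, Measure theory and fine properties of
   functions, Section 5.3). *)
Definition trace D f (x : 'rV[R]_d) : R :=
  limn (fun k : nat =>
    let B := eball x k.+1%:R^-1 `&` D in
    (\int[leb]_(y in B) f y) / fine (leb B)).

Definition poly_fun (m : nat) f : Prop :=
  exists c : {ffun 'I_d -> 'I_m.+1} -> R,
    f = fun x => \sum_(a : {ffun 'I_d -> 'I_m.+1} | (\sum_i a i <= m)%N)
                   c a * \prod_i x 0 i ^+ a i.

End function_spaces.

Section domains.
Context {R : realType} {d : nat}.
Implicit Types (D : set 'rV[R]_d) (x n : 'rV[R]_d).

Definition frontier D : set 'rV[R]_d := closure D `\` interior D.

Definition convex_polytope D : Prop :=
  [/\ D !=set0, exists r, D `<=` eball 0 r &
      exists (N : nat) (a : 'I_N -> 'rV[R]_d) (b : 'I_N -> R),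
        D = [set x | forall i, dotr (a i) x < b i]].

(* Near each boundary point, D is the epigraph over the hyperplane orthogonal
   to some unit vector nu of a function of class C^2. *)
Definition C2_boundary D : Prop :=
  forall x, frontier D x -> exists (r : R) (nu : 'rV[R]_d) (gam : 'rV[R]_d -> R),
    [/\ 0 < r, enorm nu = 1, class_C 2 gam &
        forall y, eball x r y ->
          D y <-> gam (y - dotr y nu *: nu) < dotr y nu].

(* n is the outward unit normal: the blow-up of D at x is a half-space. On a
   C^1 boundary this is the usual normal; on a polytope it exists exactly in
   the relative interior of the facets. *)
Definition is_outward_normal D x n : Prop :=
  enorm n = 1 /\
  forall eps : R, 0 < eps -> exists2 r : R, 0 < r &
    forall y, eball x r y ->
      (dotr (y - x) n < - eps * enorm (y - x) -> D y) /\
      (eps * enorm (y - x) < dotr (y - x) n -> ~ D y).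

Definition outward_normal D x : 'rV[R]_d := xget 0 (is_outward_normal D x).

Definition path_connected (A : set 'rV[R]_d) : Prop :=
  forall x y, A x -> A y -> exists g : R -> 'rV[R]_d,
    [/\ {within `[0, 1], continuous g}, g 0 = x, g 1 = y &
        forall t : R, t \in `[0, 1] -> A (g t)].

Definition simply_connected (A : set 'rV[R]_d) : Prop :=
  path_connected A /\
  forall g : R -> 'rV[R]_d,
    {within `[0, 1], continuous g} -> g 0 = g 1 ->
    (forall t : R, t \in `[0, 1] -> A (g t)) ->
    exists H : R * R -> 'rV[R]_d,
      [/\ {within `[0, 1] `*` `[0, 1], continuous H},
          forall t : R, t \in `[0, 1] -> H (0, t) = g t /\ H (1, t) = g 0,
          forall s : R, s \in `[0, 1] -> H (s, 0) = g 0 /\ H (s, 1) = g 0 &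
          forall s t : R, s \in `[0, 1] -> t \in `[0, 1] -> A (H (s, t))].

End domains.

(* Elements and faces are given by their sets of vertices. *)
Record mesh (R : realType) (d : nat) := Mesh {
  nnodes : nat;
  node : 'I_nnodes -> 'rV[R]_d;
  elements : {set {set 'I_nnodes}} }.

Section meshes.
Context {R : realType} {d : nat} (T : mesh R d).
Implicit Types (V K e : {set 'I_(nnodes T)}) (Om : set 'rV[R]_d).

Definition simplex V : set 'rV[R]_d :=
  [set x | exists l : 'I_(nnodes T) -> R,
    [/\ forall i, i \in V -> 0 < l i, \sum_(i in V) l i = 1 &
        x = \sum_(i in V) l i *: node i]].

Definition affinely_independent V : Prop :=
  forall l : 'I_(nnodes T) -> R, \sum_(i in V) l i = 0 ->
    \sum_(i in V) l i *: node i = 0 -> forall i, i \in V -> l i = 0.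

Definition triangulation Om : Prop :=
  [/\ forall K, K \in elements T -> #|K| = d.+1 /\ affinely_independent K,
      \bigcup_(K in [set` elements T]) closure (simplex K) = closure Om &
      forall K K', K \in elements T -> K' \in elements T ->
        closure (simplex K) `&` closure (simplex K') =
        closure (simplex (K :&: K'))].

Definition faces : {set {set 'I_(nnodes T)}} :=
  [set e : {set 'I_(nnodes T)} | (#|e| == d) &&
    [exists K in elements T, e \subset K]]%SET.

Definition diam V : R := fine (ediam (simplex V)).

Definition mesh_size : R := \big[Num.max/0]_(K in elements T) diam K.

Definition inradius K : R :=
  sup [set r : R | 0 <= r /\ exists x, eball x r `<=` simplex K].

Definition quasi_uniform (sigma : R) : Prop :=
  forall K, K \in elements T -> mesh_size <= sigma * inradius K.

Definition adjacent K : {set {set 'I_(nnodes T)}} :=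
  [set K' in elements T |
    `[< closure (simplex K') `&` closure (simplex K) !=set0 >]]%SET.

Definition face_normal K e : 'rV[R]_d :=
  xget 0 [set n | [/\ enorm n = 1,
    forall i j, i \in e -> j \in e -> dotr n (node i - node j) = 0 &
    forall i j, i \in K :\: e -> j \in e -> dotr n (node i - node j) < 0]].

Variable Om0 : set 'rV[R]_d.

Definition cells0 : {set {set 'I_(nnodes T)}} :=
  [set K in elements T | `[< simplex K `&` Om0 !=set0 >]]%SET.
Definition cells0_int : {set {set 'I_(nnodes T)}} :=
  [set K in cells0 | `[< simplex K `<=` Om0 >]]%SET.
Definition cells_cut : {set {set 'I_(nnodes T)}} :=
  [set K in elements T | `[< simplex K `&` frontier Om0 !=set0 >]]%SET.
Definition faces0 : {set {set 'I_(nnodes T)}} :=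
  [set e in faces | `[< simplex e `&` Om0 !=set0 >]]%SET.
Definition faces0_int : {set {set 'I_(nnodes T)}} :=
  [set e in faces0 | `[< simplex e `<=` Om0 >]]%SET.
Definition faces_cut : {set {set 'I_(nnodes T)}} :=
  [set e in faces | `[< simplex e `&` frontier Om0 !=set0 >]]%SET.

(* intK K is the interior element assigned to the cut element K. *)
Definition admissible_mesh (Om : set 'rV[R]_d) (sigma : R)
    (intK : {set 'I_(nnodes T)} -> {set 'I_(nnodes T)}) : Prop :=
  [/\ triangulation Om /\ quasi_uniform sigma,
      cells_cut = cells0 :\: cells0_int,
      faces_cut = faces0 :\: faces0_int,
      forall e, e \in faces_cut -> simply_connected (simplex e `&` frontier Om0) &
      forall K, K \in cells_cut -> intK K \in adjacent K :&: cells0_int].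

Section approximation_space.
(* continuous_space selects the C^0 finite element space; otherwise the
   discontinuous space is used. *)
Variables (intK : {set 'I_(nnodes T)} -> {set 'I_(nnodes T)})
  (m : nat) (continuous_space : bool).
Implicit Types v w u : 'rV[R]_d -> R.

Definition Vh_int v : Prop :=
  (forall K, K \in cells0_int ->
    exists2 p, poly_fun m p & forall x, simplex K x -> v x = p x) /\
  (continuous_space ->
    {within \bigcup_(K in [set` cells0_int]) closure (simplex K), continuous v}).

(* Only the values of w on the open elements of cells0 matter. *)
Definition is_extension v w : Prop :=
  (forall K x, K \in cells0_int -> simplex K x -> w x = v x) /\
  (forall K, K \in cells_cut -> exists2 p, poly_fun m p &
    (forall x, simplex (intK K) x -> v x = p x) /\
    (forall x, simplex K x -> w x = p x)).

Definition Vh : set ('rV[R]_d -> R) :=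
  [set w | exists2 v, Vh_int v & is_extension v w].

Definition Vh_plus_H2 : set ('rV[R]_d -> R) :=
  [set u | exists w f, [/\ Vh w, H2_fun Om0 f & u = w \+ f]].

End approximation_space.

Section bilinear_form.
Implicit Types (u v : 'rV[R]_d -> R) (q : 'rV[R]_d -> 'rV[R]_d).
Local Notation leb := (lebesgue_rV d).
Local Notation surf := (hausdorff d.-1).

Definition grad K u : 'rV[R]_d -> 'rV[R]_d :=
  weak_gradient (simplex K `&` Om0) u.

Definition cell_trace K u : 'rV[R]_d -> R := trace (simplex K `&` Om0) u.

Definition grad_trace K u x : 'rV[R]_d :=
  \row_i cell_trace K (fun y => grad K u y 0 i) x.

(* A face meeting Om0 is interior, so exactly two elements contain it. *)
Definition jump e u x : 'rV[R]_d :=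
  \sum_(K in elements T | e \subset K) cell_trace K u x *: face_normal K e.

Definition average_grad e u x : 'rV[R]_d :=
  2^-1 *: \sum_(K in elements T | e \subset K) grad_trace K u x.

Definition bnd_jump K u x : 'rV[R]_d :=
  cell_trace K u x *: outward_normal Om0 x.

Definition a_h (mu : R) u v : R :=
  \sum_(K in cells0)
    \int[leb]_(x in simplex K `&` Om0) dotr (grad K u x) (grad K v x)
  - \sum_(e in faces0)
    \int[surf]_(x in simplex e `&` Om0)
      (dotr (average_grad e u x) (jump e v x)
       + dotr (average_grad e v x) (jump e u x)
       - mu / diam e * dotr (jump e u x) (jump e v x))
  - \sum_(K in cells_cut)
    \int[surf]_(x in simplex K `&` frontier Om0)
      (dotr (grad_trace K u x) (bnd_jump K v x)
       + dotr (grad_trace K v x) (bnd_jump K u x)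
       - mu / diam K * dotr (bnd_jump K u x) (bnd_jump K v x)).

Local Open Scope ereal_scope.

Definition L2_norm_sq (mu : set 'rV[R]_d -> \bar R) (D : set 'rV[R]_d) q
    : \bar R :=
  \int[mu]_(x in D) ((enorm (q x) ^+ 2)%R)%:E.

(* Takes values in [0, +oo]; it is finite on Vh_plus_H2 by the trace theorem. *)
Definition dg_norm u : \bar R := sqrte
  (\sum_(K in cells0) L2_norm_sq leb (simplex K `&` Om0) (grad K u)
   + \sum_(e in faces0)
       (diam e)%:E * L2_norm_sq surf (simplex e `&` Om0) (average_grad e u)
   + \sum_(e in faces0)
       (diam e)^-1%:E * L2_norm_sq surf (simplex e `&` Om0) (jump e u)
   + \sum_(K in cells_cut)
       (diam K)%:E * L2_norm_sq surf (simplex K `&` frontier Om0) (grad_trace K u)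
   + \sum_(K in cells_cut)
       (diam K)^-1%:E * L2_norm_sq surf (simplex K `&` frontier Om0) (bnd_jump K u)).

End bilinear_form.
End meshes.

(* Main.v *)
Require Import Defs.
From HB Require Import structures.
From mathcomp Require Import all_boot all_order all_algebra.
From mathcomp Require Import all_classical all_reals all_analysis.
From mathcomp Require qpoly.
From mathcomp Require Import measurable_realfun ring lra zify.

(** The energy norm contains, with the weights [h] and [1 / h], each factor that
    occurs in the integrals of the bilinear form. Continuity is therefore the
    Cauchy-Schwarz inequality, first in every integral ([face_form_le]) and then
    for the sums over elements and faces ([sum_face_form_le]). The form involves
    traces, which are limits of means, and normals, which are chosen among the
    vectors with a given property, so the point to settle is that these are
    measurable functions ([measurable_trace], [measurable_outward_normal]).

    For coercivity, Young's inequality ([face_form_young]) absorbs the products of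
    fluxes and jumps. The jumps go into the penalty. The fluxes must be bounded by
    the gradient energy, with a constant that depends neither on [h] nor on the
    position of the interface ([flux_le]). Such a bound holds on a discrete
    function because its restriction to a cut element [K] is the same polynomial as
    on a nearby uncut element [source K]. A quasi-uniform mesh has a cube of side
    comparable to [h] inside [source K], hence inside the physical domain, and [K]
    lies within distance [2 * h] of it. A polynomial of bounded degree is bounded at
    such points by its L2 norm over the cube ([coord_poly_sqr_le]), whatever the
    shape of the part of [K] inside the domain. In dimension [n.+1] the square of
    the gradient on [K] is thus at most a constant times [h ^- n.+1] times the
    energy on [source K] ([grad_trace_le]). Faces and pieces of the interface
    inside an element have surface measure at most a constant times [h ^+ n]
    ([hausdorff_face], [surface_bounded_frontier]). With the weight [h] of the
    norm the powers of [h] cancel, and a volume count ([packing]) shows that every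
    element is the source of, and every face belongs to, boundedly many elements.

    Two facts link the weak notions of the definitions to polynomials. The weak
    gradient of a function that agrees with a polynomial on an open set is almost
    everywhere the classical gradient ([weak_gradient_classical]); this rests on
    the fundamental lemma of the calculus of variations, hence on smooth bump
    functions. A limit of means over small balls is bounded by an almost
    everywhere bound ([trace_le]), so bounds inside an element pass to its
    boundary. *)

Set Implicit Arguments.
Unset Strict Implicit.
Unset Printing Implicit Defensive.

Import Order.TTheory GRing.Theory Num.Theory.
Import numFieldNormedType.Exports.

Local Open Scope classical_set_scope.
Local Open Scope ring_scope.


(** * Euclidean geometry and Borel sets of row vectors *)

Section continuous_functions.
Context {R : realType} {T : topologicalType}.
Implicit Types f g : T -> R.

Lemma continuous_add f g : continuous f -> continuous g -> continuous (fun x => f x + g x).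
Proof. by move=> cf cg y; apply: cvgD; [exact: cf|exact: cg]. Qed.

Lemma continuous_mul f g : continuous f -> continuous g -> continuous (fun x => f x * g x).
Proof. by move=> cf cg y; apply: cvgM; [exact: cf|exact: cg]. Qed.

Lemma continuous_opp f : continuous f -> continuous (fun x => - f x).
Proof. by move=> cf y; apply: cvgN; exact: cf. Qed.

Lemma continuous_sum (I : Type) (r : seq I) (P : pred I) (F : I -> T -> R) :
  (forall i, P i -> continuous (F i)) ->
  continuous (fun y => \sum_(i <- r | P i) F i y).
Proof.
move=> cF; elim: r => [|i r IH].
  by under eq_fun do rewrite big_nil; exact: cst_continuous.
under eq_fun do rewrite big_cons.
case Pi: (P i) => //; apply: continuous_add => //; exact: cF.
Qed.

Lemma continuous_prod (I : Type) (r : seq I) (P : pred I) (F : I -> T -> R) :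
  (forall i, P i -> continuous (F i)) ->
  continuous (fun y => \prod_(i <- r | P i) F i y).
Proof.
move=> cF; elim: r => [|i r IH].
  by under eq_fun do rewrite big_nil; exact: cst_continuous.
under eq_fun do rewrite big_cons.
case Pi: (P i) => //; apply: continuous_mul => //; exact: cF.
Qed.

End continuous_functions.

Section euclidean_norm.
Context {R : realType} {n : nat}.
Implicit Types (x y z : 'rV[R]_n) (a : R).

Lemma dotrC x y : dotr x y = dotr y x.
Proof. by apply: eq_bigr => i _; rewrite mulrC. Qed.

Lemma dotrDl x y z : dotr (x + y) z = dotr x z + dotr y z.
Proof. by rewrite /dotr -big_split; apply: eq_bigr => i _; rewrite mxE mulrDl. Qed.

Lemma dotrZl a x y : dotr (a *: x) y = a * dotr x y.
Proof. by rewrite /dotr mulr_sumr; apply: eq_bigr => i _; rewrite mxE mulrA. Qed.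

Lemma dotrNl x y : dotr (- x) y = - dotr x y.
Proof. by rewrite -scaleN1r dotrZl mulN1r. Qed.

Lemma dotrBl x y z : dotr (x - y) z = dotr x z - dotr y z.
Proof. by rewrite dotrDl dotrNl. Qed.

Lemma dotrDr x y z : dotr x (y + z) = dotr x y + dotr x z.
Proof. by rewrite !(dotrC x) dotrDl. Qed.

Lemma dotrZr a x y : dotr x (a *: y) = a * dotr x y.
Proof. by rewrite !(dotrC x) dotrZl. Qed.

Lemma dotrBr x y z : dotr x (y - z) = dotr x y - dotr x z.
Proof. by rewrite !(dotrC x) dotrBl. Qed.

Lemma dotrr_ge0 x : 0 <= dotr x x.
Proof. by apply: sumr_ge0 => i _; rewrite -expr2 sqr_ge0. Qed.

Lemma sqr_enorm x : enorm x ^+ 2 = dotr x x.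
Proof. by rewrite sqr_sqrtr// dotrr_ge0. Qed.

Lemma enorm_ge0 x : 0 <= enorm x.
Proof. exact: sqrtr_ge0. Qed.

Lemma enorm0 : enorm (0 : 'rV[R]_n) = 0.
Proof. by rewrite /enorm /dotr big1 ?sqrtr0// => i _; rewrite mxE mul0r. Qed.

Lemma enorm_eq0 x : enorm x = 0 -> x = 0.
Proof.
move=> x0; apply/rowP => i; rewrite mxE; apply/eqP.
by rewrite -normr_eq0 eq_le normr_ge0 -x0 coord_le_enorm.
Qed.

Lemma enormZ a x : enorm (a *: x) = `|a| * enorm x.
Proof.
by rewrite /enorm dotrZl dotrZr mulrA -expr2 sqrtrM ?sqr_ge0// sqrtr_sqr.
Qed.

Lemma enormN x : enorm (- x) = enorm x.
Proof. by rewrite -scaleN1r enormZ normrN1 mul1r. Qed.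

Lemma enormC x y : enorm (x - y) = enorm (y - x).
Proof. by rewrite -opprB enormN. Qed.

Lemma ler_abs_dotr x y : `|dotr x y| <= enorm x * enorm y.
Proof.
suff h : dotr x y ^+ 2 <= (enorm x * enorm y) ^+ 2.
  by rewrite -ler_sqr ?nnegrE ?mulr_ge0 ?enorm_ge0// real_normK ?num_real.
rewrite exprMn !sqr_enorm.
set a := dotr x x; set b := dotr x y; set c := dotr y y.
have [c0|c0] := eqVneq c 0.
  have y0 : y = 0 by apply: enorm_eq0; rewrite /enorm -/c c0 sqrtr0.
  by rewrite c0 mulr0 /b y0 /dotr big1 ?expr0n// => i _; rewrite mxE mulr0.
have cp : 0 < c by rewrite lt_def c0 dotrr_ge0.
(* The squared norm of a multiple of the component of [x] orthogonal to [y]. *)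
have := dotrr_ge0 (c *: x - b *: y).
rewrite !(dotrBl, dotrBr, dotrZl, dotrZr) (dotrC y x) -/a -/b -/c => h.
rewrite -subr_ge0 -(pmulr_rge0 _ cp); lra.
Qed.

Lemma ler_dotr x y : dotr x y <= enorm x * enorm y.
Proof. exact: le_trans (ler_norm _) (ler_abs_dotr x y). Qed.

Lemma ler_enormD x y : enorm (x + y) <= enorm x + enorm y.
Proof.
rewrite -ler_sqr ?nnegrE ?addr_ge0 ?enorm_ge0// sqr_enorm !(dotrDl, dotrDr).
rewrite sqrrD !sqr_enorm (dotrC y x); have := ler_dotr x y; lra.
Qed.

Lemma ler_enorm_dist z x y : enorm (x - y) <= enorm (x - z) + enorm (z - y).
Proof. by apply: le_trans (ler_enormD _ _); rewrite addrA subrK. Qed.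

Lemma enorm_le_sum x : enorm x <= \sum_i `|x 0 i|.
Proof.
rewrite -ler_sqr ?nnegrE ?enorm_ge0 ?sumr_ge0// sqr_enorm expr2 mulr_suml.
apply: ler_sum => i _; rewrite (le_trans (ler_norm _))// normrM ler_wpM2l//.
by rewrite (bigD1 i)//= lerDl sumr_ge0.
Qed.

Lemma enorm_le_coord x a : (forall i, `|x 0 i| <= a) -> enorm x <= n%:R * a.
Proof.
move=> xa; apply: le_trans (enorm_le_sum x) _.
apply: (@le_trans _ _ (\sum_(i < n) a)); first by apply: ler_sum => i _.
by rewrite sumr_const card_ord mulr_natl.
Qed.

End euclidean_norm.

Section borel.
Context {R : realType} {n : nat}.
Implicit Types (x y : 'rV[R]_n) (U : set 'rV[R]_n).

Lemma countType_bigcup_measurable d (T : measurableType d) (I : countType)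
    (P : set I) (F : I -> set T) :
  (forall i, P i -> measurable (F i)) -> measurable (\bigcup_(i in P) F i).
Proof.
move=> mF.
pose G (k : nat) : set T := if unpickle k is Some i then
  (if `[< P i >] then F i else set0) else set0.
rewrite (_ : \bigcup_(i in P) F i = \bigcup_k G k).
  apply: bigcup_measurable => k _; rewrite /G.
  by case: unpickle => // i; case: asboolP => // Pi; exact: mF.
apply/seteqP; split => [t [i Pi Ft]|t [k _]].
  by exists (pickle i) => //; rewrite /G pickleK; case: asboolP.
by rewrite /G; case: unpickle => // i; case: asboolP => // Pi Ft; exists i.
Qed.

Lemma near_box_rV x (A : set 'rV[R]_n) : nbhs x A <->
  exists2 r : R, 0 < r & forall y, (forall i, `|x 0 i - y 0 i| < r) -> A y.
Proof.
split.
  move=> /nbhs_ballP[r r0 rA]; exists r => // y xy; apply: rA.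
  by split => // i j; rewrite (ord1 i); exact: xy.
move=> [r r0 rA]; apply/nbhs_ballP; exists r => // y [_ xy]; apply: rA => i.
exact: xy.
Qed.

Lemma near_eball_rV x (A : set 'rV[R]_n) : nbhs x A <->
  exists2 r : R, 0 < r & eball x r `<=` A.
Proof.
split.
  move=> /near_box_rV[r r0 rA]; exists r => // y xy; apply: rA => i.
  have := coord_le_enorm (y - x) i; rewrite !mxE distrC => h.
  exact: le_lt_trans h xy.
move=> [r r0 rA]; apply/near_box_rV; exists (r / n.+1%:R).
  by rewrite divr_gt0.
move=> y xy; apply: rA; rewrite /eball/=.
have h i : `|(y - x) 0 i| <= r / n.+1%:R by rewrite !mxE distrC ltW.
apply: le_lt_trans (enorm_le_coord h) _.
rewrite mulrCA gtr_pMr// ltr_pdivrMr// mul1r ltr_nat; exact: ltnSn.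
Qed.

Lemma rat_near_rV x (r : R) : 0 < r ->
  exists q : 'rV[rat]_n, forall i, `|ratr (q 0 i) - x 0 i| < r.
Proof.
move=> r0; have q_ i : exists q : rat, `|ratr q - x 0 i| < r.
  have [|q qx] := @rat_in_itvoo R (x 0 i - r) (x 0 i + r).
    by rewrite ltrD2l gtrN.
  by exists q; rewrite ltr_distl; move: qx; rewrite in_itv.
by have [q qP] := choice q_; exists (\row_i q i) => i; rewrite mxE.
Qed.

(** Measurable sets are generated by coordinate preimages, so an open set has to
    be exhibited as a countable union of boxes; rational centres and radii [1 /
    k.+1] suffice. *)
Lemma open_measurable_rV U : open U -> measurable U.
Proof.
move=> oU.
pose box (p : 'rV[rat]_n * nat) : set 'rV[R]_n :=
  [set x | forall i, `|ratr (p.1 0 i) - x 0 i| < p.2.+1%:R^-1].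
have -> : U = \bigcup_(p in [set p | box p `<=` U]) box p.
  apply/seteqP; split=> [x Ux|x [p pU /pU]//].
  have /near_box_rV[r r0 rU] : nbhs x U by exact: open_nbhs_nbhs.
  have r20 : 0 < r / 2 by rewrite divr_gt0.
  have [k kr] := ltr_add_invr r20; rewrite add0r in kr.
  have k0 : 0 < k.+1%:R^-1 :> R by rewrite invr_gt0.
  have [q qP] := rat_near_rV x k0.
  exists (q, k) => // y /= yq.
  apply: rU => i; rewrite (le_lt_trans (ler_distD (ratr (q 0 i)) _ _))//.
  by rewrite (splitr r) ltrD// (lt_trans _ kr)// distrC.
apply: countType_bigcup_measurable => p _.
have -> : box p = \bigcap_(i in [set: 'I_n])
    ((fun x : 'rV[R]_n => x 0 i) @^-1` (ball (ratr (p.1 0 i) : R) p.2.+1%:R^-1)).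
  by apply/seteqP; split => [x xp i _|x xp i]; [exact: xp|exact: xp].
apply: fin_bigcap_measurable => // i _.
rewrite -[X in measurable X]setTI; apply: measurable_coord => //.
by rewrite ball_itv; exact: measurable_itv.
Qed.

Lemma closed_measurable_rV U : closed U -> measurable U.
Proof.
by move=> cU; rewrite -(setCK U); apply: measurableC; apply: open_measurable_rV; exact: closed_openC.
Qed.

Lemma continuous_measurable_rV (f : 'rV[R]_n -> R) : continuous f ->
  measurable_fun setT f.
Proof.
move=> cf; apply: (measurability _ (@measurable_realfun.RGenOpens.measurableE R)) => //.
move=> _ [_ [a [b ->]] <-]; rewrite setTI; apply: open_measurable_rV.
by apply: open_comp => // x _; exact: cf.
Qed.

Lemma eball_open x r : open (eball x r).
Proof.
rewrite openE => y /= xy; apply/near_eball_rV.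
exists (r - enorm (y - x)); first by rewrite subr_gt0.
rewrite /eball => z /= yz; rewrite (le_lt_trans (ler_enorm_dist y _ _))//.
by rewrite -ltrBrDr.
Qed.

Lemma continuous_enormB x : continuous (fun y : 'rV[R]_n => enorm (y - x)).
Proof.
move=> y; have fy : Filter (nbhs y) by exact: nbhs_filter.
apply/cvgrPdist_lt => e e0; apply/near_eball_rV; exists e => // z.
rewrite /eball/= => yz; rewrite ltr_distl.
have := ler_enorm_dist y z x; have := ler_enorm_dist z y x.
by rewrite [enorm (y - z)]enormC => ? ?; apply/andP; split; lra.
Qed.

Lemma continuous_dotr x : continuous (fun y : 'rV[R]_n => dotr y x).
Proof.
apply: continuous_sum => i _; apply: continuous_mul.
  exact: coord_continuous.
exact: cst_continuous.
Qed.

End borel.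

Section level_sets.
Context {R : realType} {n : nat}.
Implicit Type f : 'rV[R]_n -> R.

Lemma open_gt_rV f (c : R) : continuous f -> open [set x | c < f x].
Proof.
move=> cf; rewrite (_ : [set x | _] = f @^-1` [set t | c < t])//.
by apply: open_comp; [move=> x _; exact: cf|exact: open_gt].
Qed.

Lemma open_lt_rV f (c : R) : continuous f -> open [set x | f x < c].
Proof.
move=> cf; rewrite (_ : [set x | _] = f @^-1` [set t | t < c])//.
by apply: open_comp; [move=> x _; exact: cf|exact: open_lt].
Qed.

End level_sets.

(** * Iterated integration and cubes *)

Section lebesgue_rV_theory.
Context {R : realType}.
Local Notation leb := (@lebesgue_measure R).

(** Together with the first coordinate, the inverse of [consrV]: the Lebesgue
    measure is defined by adding one coordinate at a time. *)
Definition tailrV n (x : 'rV[R]_n.+1) : 'rV[R]_n := \row_j x 0 (lift ord0 j).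

Definition cube n (a : 'rV[R]_n) (l : R) : set 'rV[R]_n :=
  [set x | forall i, a 0 i <= x 0 i <= a 0 i + l].

Lemma consrV_tail n (x : 'rV[R]_n.+1) : consrV (x 0 ord0, tailrV x) = x.
Proof.
apply/rowP => i; case: (unliftP ord0 i) => [j ->|->]; last by rewrite consrV0.
by rewrite consrVS mxE.
Qed.

Lemma forall_ord_consrV n (P : 'I_n.+1 -> Prop) :
  (forall i, P i) <-> P ord0 /\ forall j, P (lift ord0 j).
Proof.
split=> [h|[P0 PS] i]; first by split.
by case: (unliftP ord0 i) => [j ->|->].
Qed.

Lemma cube_consrV n (a : 'rV[R]_n.+1) l t v : cube a l (consrV (t, v)) <->
  t \in `[a 0 ord0, a 0 ord0 + l] /\ cube (tailrV a) l v.
Proof.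
rewrite in_itv/= /cube/= forall_ord_consrV consrV0/=.
by split=> -[? h]; split => // j; have := h j; rewrite consrVS !mxE.
Qed.

Lemma cube_preimage_consrV n (a : 'rV[R]_n.+1) l : @consrV R n @^-1` cube a l =
  `[a 0 ord0, a 0 ord0 + l]%classic `*` cube (tailrV a) l.
Proof. by apply/seteqP; split => -[t v] /=; rewrite cube_consrV. Qed.

Lemma measurable_cube n (a : 'rV[R]_n) l : measurable (cube a l).
Proof.
have -> : cube a l = \bigcap_(i in [set: 'I_n])
    ((fun x : 'rV[R]_n => x 0 i) @^-1` `[a 0 i, a 0 i + l]).
  apply/seteqP; split => [x xp i _|x xp i] /=; first by rewrite in_itv/= xp.
  by have := xp i I; rewrite /= in_itv.
apply: fin_bigcap_measurable => // i _.
by rewrite -[X in measurable X]setTI; apply: measurable_coord.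
Qed.

Lemma lebesgue_cube n (a : 'rV[R]_n) l : 0 <= l ->
  lebesgue_rV n (cube a l) = (l ^+ n)%:E.
Proof.
move=> l0; elim: n a => [|n IH] a.
  by rewrite /= diracE mem_set// => -[].
rewrite /= /consrV_measure /pushforward cube_preimage_consrV.
rewrite product_measure1E//; last exact: measurable_cube.
rewrite IH [X in (X * _)%E](_ : _ = l%:E); first by rewrite -EFinM exprS.
rewrite [LHS]lebesgue_measure_itv/= lte_fin ltrDl.
have [->|ln0] := eqVneq l 0; first by rewrite ltxx.
by rewrite lt_def ln0 l0/= -EFinB addrAC subrr add0r.
Qed.

Lemma measurable_consrVl n (t : R) :
  measurable_fun setT (fun v : 'rV[R]_n => consrV (t, v)).
Proof.
apply: measurable_fun_rV => i; case: (unliftP ord0 i) => [j ->|->].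
  by under eq_fun do rewrite consrVS; exact: measurable_coord.
by under eq_fun do rewrite consrV0; exact: measurable_cst.
Qed.

Lemma ge0_integral_lebesgue_rVS n (f : 'rV[R]_n.+1 -> \bar R) :
  measurable_fun setT f -> (forall x, 0 <= f x)%E ->
  (\int[lebesgue_rV n.+1]_x f x =
   \int[leb]_t \int[lebesgue_rV n]_v f (consrV (t, v)))%E.
Proof.
move=> mf f0; rewrite ge0_integral_pushforward//; last exact: measurable_consrV.
rewrite fubini_tonelli1//; last by move=> x; exact: f0.
by apply: (measurableT_comp mf); exact: measurable_consrV.
Qed.

Lemma integral_lebesgue_rVS n (f : 'rV[R]_n.+1 -> \bar R) :
  (lebesgue_rV n.+1).-integrable setT f ->
  (\int[lebesgue_rV n.+1]_x f x =
   \int[leb]_t \int[lebesgue_rV n]_v f (consrV (t, v)))%E /\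
  (\int[lebesgue_rV n.+1]_x f x =
   \int[lebesgue_rV n]_v \int[leb]_t f (consrV (t, v)))%E.
Proof.
move=> intf.
have mf := measurable_int _ intf.
have mfc : measurable_fun setT (f \o @consrV R n).
  by apply: (measurableT_comp mf); exact: measurable_consrV.
have intfc : (leb \x lebesgue_rV n)%E.-integrable setT (f \o @consrV R n).
  apply/integrableP; split => //.
  case/integrableP: intf => _; rewrite ge0_integral_pushforward//.
    exact: measurable_consrV.
  exact: measurableT_comp.
rewrite integral_pushforward//; last exact: measurable_consrV.
rewrite preimage_setT.
have e1 := integral12_prod_meas1 intfc; have e2 := integral21_prod_meas1 intfc.
by split; [exact: esym e1|exact: esym e2].
Qed.

End lebesgue_rV_theory.

(** * Pointwise bounds of polynomials by integrals over cubes *)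

Section polynomial_bound.
Context {R : realType}.
Local Notation leb := (@lebesgue_measure R).

(** Lagrange interpolation at [m.+1] points: the basis polynomials are products
    of quotients of distances, at most [D / dl] each. *)
Lemma poly_bound_samples (m : nat) (p : {poly R}) (s : nat -> R) (dl D E t : R) :
  (size p <= m.+1)%N -> 0 < dl -> 0 <= D ->
  (forall j k, j != k -> dl <= `|s j - s k|) ->
  (forall j, (j <= m)%N -> `|t - s j| <= D) ->
  (forall j, (j <= m)%N -> `|p.[s j]| <= E) ->
  `|p.[t]| <= m.+1%:R * ((D / dl) ^+ m * E).
Proof.
move=> sp dl0 D0 sep tD pE.
have sinj : injective s.
  move=> j k sjk; apply/eqP/negPn/negP => /sep.
  by rewrite sjk subrr normr0 leNgt dl0.
rewrite [in leLHS](qpoly.lagrange_gen _ sinj sp)// horner_sum.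
apply: le_trans (ler_norm_sum _ _ _) _.
rewrite mulr_natl -[m.+1 in leRHS]card_ord -sumr_const.
apply: ler_sum => i _.
rewrite qpoly.lagrangeE// !(hornerM, hornerC) mulrC normrM.
apply: ler_pM => //; last by apply: pE; rewrite -ltnS.
rewrite !horner_prod mulrC normrM normfV !normr_prod -prodf_div.
have -> : (D / dl) ^+ m = \prod_(j < m.+1 | j != i) (D / dl).
  by rewrite prodr_const (cardC1 i) card_ord.
apply: ler_prod => j ji.
rewrite !hornerXsubC divr_ge0//= ler_pM ?invr_ge0//.
  by apply: tD; rewrite -ltnS.
by rewrite lef_pV2 ?posrE ?(lt_le_trans dl0)// sep// eq_sym.
Qed.

Lemma integral_itv_ge (f : R -> R) (a b c d e : R) :
  c <= d -> a <= c -> d <= b -> measurable_fun setT f ->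
  (forall x, x \in `[a, b] -> 0 <= f x) -> 0 <= e ->
  (forall x, x \in `[c, d] -> e <= f x) ->
  ((e * (d - c))%:E <= \int[leb]_(x in `[a, b]) (f x)%:E)%E.
Proof.
move=> cd ac db mf f0 e0 ef.
have sub : `[c, d] `<=` `[a, b].
  by apply: subset_itv; rewrite bnd_simp.
have mfE A : measurable_fun A (EFin \o f).
  by apply/measurable_EFinP; exact: measurable_funTS.
apply: (@le_trans _ _ (\int[leb]_(x in `[c, d]) (f x)%:E)%E); last first.
  by apply: ge0_subset_integral => //=; exact: mfE.
apply: (@le_trans _ _ (\int[leb]_(x in `[c, d]) (cst e%:E) x)%E).
  rewrite integral_cst//= lebesgue_measure_itv/= lte_fin.
  case: ltP => cd'; first by rewrite -EFinB -EFinM.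
  by rewrite mule0 lee_fin (_ : d - c = 0) ?mulr0//; lra.
by apply: ge0_le_integral => //=; exact: mfE.
Qed.

(** The value that comes out of [poly_bound_samples] when the interval of length
    [l] is cut into [2 * m.+1] equal parts and the samples are taken in every
    second part: then [dl = l / (2 * m.+1)] and [D = (M + 1) * l]. *)
Definition poly_const (m : nat) (M : R) : R :=
  (m.+1%:R * ((M + 1) * (2 * m.+1%:R)) ^+ m) ^+ 2 * (2 * m.+1%:R).

Lemma poly_const_gt0 m M : 0 <= M -> 0 < poly_const m M.
Proof.
move=> M0; have M1 : 0 < M + 1 by rewrite ltr_wpDl.
by rewrite /poly_const !(mulr_gt0, exprn_gt0).
Qed.

(** An inverse estimate with an explicit constant, at a point which may lie
    outside the interval. In each of [m.+1] disjoint parts, the minimum of the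
    square of [p] is at most its mean, so it is bounded by the integral;
    interpolation at the points of minimum then bounds [p] everywhere. *)
Lemma poly_sqr_le_integral (m : nat) (p : {poly R}) (a l M t : R) :
  (size p <= m.+1)%N -> 0 < l -> 0 <= M -> `|t - a| <= M * l ->
  ((p.[t] ^+ 2)%:E <=
   (poly_const m M / l)%:E *
   \int[leb]_(x in `[a, (a + l)%R]) (p.[x] ^+ 2)%:E)%E.
Proof.
move=> sp l0 M0 ta; rewrite /poly_const; set k2 := 2 * m.+1%:R; have k20 : 0 < k2 by rewrite mulr_gt0.
have [dl dl0 kl] : exists2 dl, 0 < dl & dl * k2 = l.
  by exists (l / k2); rewrite ?divr_gt0// divfK ?gt_eqF.
set I := (\int[_]_(_ in _) _)%E.
have mp : measurable_fun setT (fun x : R => p.[x] ^+ 2).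
  apply: continuous_measurable_fun => x; apply: cvgM; exact: continuous_horner.
(* [s j] minimizes the square of [p] on the part of index [j.*2], so two samples
   are separated by a part of odd index. *)
have s_ (j : nat) : exists s : R, s \in `[a + dl * j.*2%:R, a + dl * j.*2.+1%:R] /\
    forall x, x \in `[a + dl * j.*2%:R, a + dl * j.*2.+1%:R] -> p.[s] ^+ 2 <= p.[x] ^+ 2.
  have [||s ss sm] := @EVT_min R (fun x => p.[x] ^+ 2)
      (a + dl * j.*2%:R) (a + dl * j.*2.+1%:R).
  - by rewrite lerD2l ler_pM2l// ler_nat.
  - apply: continuous_subspaceT => x; apply: cvgM; exact: continuous_horner.
  - by exists s.
have [s sP] := choice s_.
have [I0|I0] : I = +oo%E \/ exists2 r : R, 0 <= r & I = r%:E.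
  have : (0 <= I)%E by apply: integral_ge0 => x _; rewrite lee_fin sqr_ge0.
  by case: I => [r||]//; rewrite ?lee_fin => ?; [right; exists r|left].
  rewrite I0 mulry gtr0_sg ?mul1e ?leey// divr_gt0// mulr_gt0// exprn_gt0// mulr_gt0//.
  by rewrite exprn_gt0// mulr_gt0//; lra.
case: I0 => r r0 Ir; rewrite Ir -EFinM lee_fin.
have ps j : (j <= m)%N -> `|p.[s j]| <= Num.sqrt (r / dl).
  move=> jm; rewrite -ler_sqr ?nnegrE ?sqrtr_ge0// sqr_sqrtr ?divr_ge0 ?(ltW dl0)//.
  rewrite real_normK ?num_real// ler_pdivlMr// -lee_fin -Ir.
  have [_ sm] := sP j.
  have -> : dl = (a + dl * j.*2.+1%:R) - (a + dl * j.*2%:R).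
    rewrite -natr1; ring.
  apply: integral_itv_ge => //.
  - by rewrite lerD2l ler_pM2l// ler_nat.
  - by rewrite lerDl mulr_ge0// ltW.
  - rewrite lerD2l -[leRHS]kl ler_pM2l// /k2 -natrM ler_nat; lia.
  - by move=> x _; rewrite sqr_ge0.
  - exact: sqr_ge0.
have sep j k : j != k -> dl <= `|s j - s k|.
  wlog jk : j k / (j < k)%N.
    move=> h jk; have [jk'|jk'] := ltnP j k; first exact: h.
    by rewrite distrC; apply: h; rewrite 1?eq_sym// ltn_neqAle eq_sym jk jk'.
  move=> _; have [+ _] := sP j; have [+ _] := sP k.
  rewrite !in_itv/= => /andP[h1 h2] /andP[h3 h4].
  rewrite distrC ler_normr; apply/orP; left.
  apply: (@le_trans _ _ ((a + dl * k.*2%:R) - (a + dl * j.*2.+1%:R))); last first.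
    by rewrite lerB.
  rewrite [leLHS](_ : dl = (a + dl * (j.*2.+2)%:R) - (a + dl * j.*2.+1%:R)).
    2: by rewrite -[j.*2.+2%:R]natr1; ring.
  rewrite lerB// lerD2l ler_pM2l// ler_nat -doubleS leq_double.
  exact: jk.
have tD j : (j <= m)%N -> `|t - s j| <= (M + 1) * l.
  move=> jm; have [+ _] := sP j; rewrite in_itv/= => /andP[h1 h2].
  rewrite (le_trans (ler_distD a _ _))// mulrDl mul1r lerD// distrC ger0_norm.
    rewrite lerBlDl; apply: le_trans h2 _; rewrite lerD2l -[leRHS]kl ler_pM2l//.
    by rewrite /k2 -natrM ler_nat; lia.
  by rewrite subr_ge0; apply: le_trans h1; rewrite lerDl mulr_ge0// ltW.
have Ml0 : 0 <= (M + 1) * l by rewrite mulr_ge0 ?(ltW l0)// addr_ge0.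
have h := poly_bound_samples sp dl0 Ml0 sep tD ps.
rewrite -(@real_normK _ p.[t]) ?num_real//.
have {h} : `|p.[t]| ^+ 2 <= (m.+1%:R * (((M + 1) * l / dl) ^+ m * Num.sqrt (r / dl))) ^+ 2.
  by rewrite ler_sqr ?nnegrE// (le_trans _ h).
move=> /le_trans; apply.
have -> : (M + 1) * l / dl = (M + 1) * k2.
  by rewrite -kl -mulrA [dl * k2]mulrC mulfK ?gt_eqF.
rewrite mulrA exprMn sqr_sqrtr ?divr_ge0 ?(ltW dl0)// -kl.
rewrite le_eqVlt; apply/orP; left; apply/eqP; field.
by rewrite !gt_eqF.
Qed.

Definition upd_rV n (x : 'rV[R]_n) (i : 'I_n) (t : R) : 'rV[R]_n :=
  \row_j (if j == i then t else x 0 j).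

(** A bound on the degree in each coordinate separately survives the freezing of
    a coordinate, with no account of coefficients; this is what iterated
    integration needs. *)
Definition coord_poly (m n : nat) (f : 'rV[R]_n -> R) : Prop :=
  forall i x, exists2 p : {poly R}, (size p <= m.+1)%N &
    forall t, f (upd_rV x i t) = p.[t].

Lemma upd_consrV0 n (v : 'rV[R]_n) (s t : R) :
  upd_rV (consrV (s, v)) ord0 t = consrV (t, v).
Proof.
apply/rowP => i; rewrite mxE; case: (unliftP ord0 i) => [j ->|->].
  by rewrite eq_sym (negbTE (neq_lift _ _)) !consrVS.
by rewrite eqxx consrV0.
Qed.

Lemma upd_consrVS n (v : 'rV[R]_n) (s t : R) j :
  upd_rV (consrV (s, v)) (lift ord0 j) t = consrV (s, upd_rV v j t).
Proof.
apply/rowP => i; rewrite mxE; case: (unliftP ord0 i) => [k ->|->].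
  by rewrite (inj_eq lift_inj) !consrVS mxE.
by rewrite (negbTE (neq_lift _ _)) !consrV0.
Qed.

Lemma ge0_integral_cubeS n (f : 'rV[R]_n.+1 -> \bar R) (a : 'rV[R]_n.+1) l :
  measurable_fun setT f -> (forall x, 0 <= f x)%E ->
  (\int[lebesgue_rV n.+1]_(x in cube a l) f x =
   \int[leb]_(t in `[a 0%R ord0, (a 0 ord0 + l)%R])
     \int[lebesgue_rV n]_(v in cube (tailrV a) l) f (consrV (t, v)))%E /\
  measurable_fun setT
    (fun t => \int[lebesgue_rV n]_(v in cube (tailrV a) l) f (consrV (t, v)))%E.
Proof.
move=> mf f0.
have mfc : measurable_fun setT (f \o @consrV R n).
  by apply: (measurableT_comp mf); exact: measurable_consrV.
split; last first.
  under eq_fun do rewrite integral_mkcond.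
  pose h (p : R * 'rV[R]_n) : \bar R :=
    ((f \o @consrV R n) \_ (setT `*` cube (tailrV a) l)) p.
  have mh : measurable_fun setT h.
    apply/(measurable_restrictT (f \o @consrV R n)).
      by apply: measurableX => //; exact: measurable_cube.
    exact: measurable_funTS.
  have h0 p : (0 <= h p)%E by rewrite /h patchE; case: ifP => // _; exact: f0.
  have := @measurable_fun_fubini_tonelli_F _ _ _ _ _ (lebesgue_rV n) h mh h0.
  congr measurable_fun; apply/funext => t; apply: eq_integral => v _.
  rewrite /h !patchE/=; congr (if _ then _ else _).
  by apply/idP/idP => /set_mem h1; apply/mem_set => //; case: h1.
rewrite integral_mkcond ge0_integral_lebesgue_rVS; last 2 first.
- apply/(measurable_restrictT f); first exact: measurable_cube.
  exact: measurable_funTS.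
- by move=> x; rewrite patchE; case: ifP => // _; exact: f0.
rewrite [RHS]integral_mkcond; apply: eq_integral => t _.
rewrite patchE; case: ifPn => tI.
  rewrite [RHS]integral_mkcond; apply: eq_integral => v _.
  rewrite !patchE/=; congr (if _ then _ else _).
  apply/idP/idP => /set_mem h1; apply/mem_set.
    by case/cube_consrV : h1.
  by apply/cube_consrV; split => //; move/set_mem: tI.
apply: integral0_eq => v _; rewrite patchE/= memNset// => /cube_consrV[h _].
by move/negP : tI; apply; apply/mem_set.
Qed.

(** The one-dimensional bound, applied to one coordinate after the other. *)
Lemma coord_poly_sqr_le (m : nat) (M : R) n (f : 'rV[R]_n -> R) (a x : 'rV[R]_n)
    (l : R) :
  measurable_fun setT f -> coord_poly m f -> 0 < l -> 0 <= M ->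
  (forall i, `|x 0 i - a 0 i| <= M * l) ->
  ((f x ^+ 2)%:E <= ((poly_const m M / l) ^+ n)%:E *
    \int[lebesgue_rV n]_(y in cube a l) (f y ^+ 2)%:E)%E.
Proof.
move=> + + l0 M0; elim: n f a x => [|n IH] f a x mf pf xa.
  have cT : cube a l = setT by apply/seteqP; split => // y _ [].
  rewrite expr0 mul1e cT /= integral_dirac//=; last first.
    by apply/measurable_EFinP; exact: measurable_funX.
  by rewrite diracE mem_set// mul1e (_ : x = 0)//; apply/rowP => -[].
have mf2 : measurable_fun setT (fun y => (f y ^+ 2)%:E).
  by apply/measurable_EFinP; exact: measurable_funX.
have f20 y : (0 <= (f y ^+ 2)%:E)%E by rewrite lee_fin sqr_ge0.
have [-> mF] := ge0_integral_cubeS a l mf2 f20.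
have [p sp pE] := pf ord0 x.
have fE t : f (consrV (t, tailrV x)) = p.[t].
  by rewrite -pE -{2}(consrV_tail x) upd_consrV0.
have Kl : 0 <= poly_const m M / l by rewrite divr_ge0 ?(ltW l0)// ltW// poly_const_gt0.
rewrite -{1}(consrV_tail x) fE.
apply: le_trans (poly_sqr_le_integral sp l0 M0 (xa ord0)) _.
have -> : ((poly_const m M / l) ^+ n.+1)%:E =
    ((poly_const m M / l)%:E * ((poly_const m M / l) ^+ n)%:E)%E.
  by rewrite -EFinM -exprS.
rewrite -muleA; apply: lee_wpmul2l; first by rewrite lee_fin.
rewrite -ge0_integralZl//=; last 3 first.
- exact: measurable_funTS.
- by move=> t _; apply: integral_ge0 => v _; exact: f20.
- by rewrite lee_fin exprn_ge0.
apply: ge0_le_integral => //=.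
- by move=> t _; rewrite lee_fin sqr_ge0.
- apply/measurable_EFinP; apply: measurable_funTS.
  by apply: continuous_measurable_fun => y; apply: cvgM; exact: continuous_horner.
- by apply: measurable_funTS; apply: measurable_funeM.
- move=> t _; rewrite -fE.
  apply: (IH (fun v => f (consrV (t, v))) (tailrV a) (tailrV x)).
  + by apply: (measurableT_comp mf); exact: measurable_consrVl.
  + move=> i v; have [q sq qE] := pf (lift ord0 i) (consrV (t, v)).
    by exists q => // s; rewrite -qE upd_consrVS.
  + by move=> i; rewrite !mxE.
Qed.

End polynomial_bound.

(** * Flat exponentials and smooth bumps *)

Section smooth_one_variable.
Context {R : realType}.
Implicit Types (f g : R -> R) (p : {poly R}).

(** A form of the class C^k that can be unfolded without knowing the
    derivatives: they are witnesses instead of values of a derivation operator. *)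
Fixpoint smooth (k : nat) g : Prop :=
  if k is k'.+1 then
    exists2 g' : R -> R, (forall x, is_derive x (1 : R) g (g' x)) & smooth k' g'
  else continuous g.

Lemma is_derive_continuous f f' :
  (forall x, is_derive x (1 : R) f (f' x)) -> continuous f.
Proof.
move=> df x; apply: differentiable_continuous; apply/derivable1_diffP.
by case: (df x).
Qed.

Lemma smooth_continuous k g : smooth k g -> continuous g.
Proof. by case: k => [//|k] /= [g' dg _]; exact: is_derive_continuous dg. Qed.

Lemma smooth_pred k g : smooth k.+1 g -> smooth k g.
Proof.
elim: k g => [|k IH] g /=.
  by move=> [g' dg _]; exact: is_derive_continuous dg.
by move=> [g' dg g'S]; exists g' => //; exact: IH.
Qed.

Lemma smooth_add k f g : smooth k f -> smooth k g -> smooth k (fun x => f x + g x).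
Proof.
elim: k f g => [|k IH] f g /=; first exact: continuous_add.
move=> [f' df f'S] [g' dg g'S]; exists (fun x => f' x + g' x); last exact: IH.
by move=> x; have := df x; have := dg x => ? ?; exact: is_deriveD.
Qed.

Lemma smooth_mul k f g : smooth k f -> smooth k g -> smooth k (fun x => f x * g x).
Proof.
elim: k f g => [|k IH] f g; first exact: continuous_mul.
move=> fS gS; have fS' := smooth_pred fS; have gS' := smooth_pred gS.
case: fS => f' df f'S; case: gS => g' dg g'S.
exists (fun x => f x * g' x + g x * f' x).
  by move=> x; have := df x; have := dg x => ? ?; exact: is_deriveM.
by apply: smooth_add; exact: IH.
Qed.

Lemma smooth_cst k (c : R) : smooth k (fun=> c).
Proof.
elim: k c => [|k IH] c /=; first exact: cst_continuous.
by exists (fun=> 0) => // x; exact: is_derive_cst.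
Qed.

Lemma is_derive_affine f (f' c d x : R) : is_derive (c * x + d) (1 : R) f f' ->
  is_derive x (1 : R) (fun t => f (c * t + d)) (c * f').
Proof.
move=> df; have dg : is_derive x (1 : R) (fun t => c * t + d) c.
  by apply: is_derive_eq; rewrite addr0; exact: mulr1.
by rewrite mulrC; exact: (is_derive1_comp (g := fun t => c * t + d) df dg).
Qed.

Lemma smooth_affine k f (c d : R) : smooth k f -> smooth k (fun t => f (c * t + d)).
Proof.
elim: k f => [|k IH] f /=.
  move=> cf x; apply: (@continuous_comp _ _ _ (fun t => c * t + d) f); last exact: cf.
  have ca : continuous (fun t : R => c * t + d); last exact: ca.
  apply: continuous_add; last exact: cst_continuous.
  by apply: continuous_mul; [exact: cst_continuous|move=> y; exact: cvg_id].
move=> [f' df f'S]; exists (fun t => c * f' (c * t + d)).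
  by move=> x; apply: is_derive_affine; exact: df.
by apply: smooth_mul; [exact: smooth_cst|exact: IH].
Qed.

(** The functions [p(1 / t) exp(- 1 / t)], extended by zero, form a class which
    is stable under derivation; hence smoothness follows by induction, with no
    formula for higher derivatives. *)
Definition flat_exp p (t : R) : R :=
  if 0 < t then p.[t^-1] * expR (- t^-1) else 0.

Lemma flat_exp_le p : exists2 C : R, 0 <= C &
  forall t : R, 0 < t -> t <= 1 -> `|flat_exp p t| <= C * t.
Proof.
exists (\sum_(i < size p) `|p`_i| * (i.+1)`!%:R).
  by apply: sumr_ge0 => i _; rewrite mulr_ge0.
move=> t t0 t1; rewrite /flat_exp t0 horner_coef mulr_suml.
apply: le_trans (ler_norm_sum _ _ _) _.
rewrite mulr_suml; apply: ler_sum => i _.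
rewrite -!mulrA normrM ler_wpM2l//.
rewrite ger0_norm ?mulr_ge0 ?exprn_ge0 ?expR_ge0 ?invr_ge0 ?(ltW t0)//.
have u0 : 0 <= t^-1 by rewrite invr_ge0 ltW.
(* The exponential dominates each monomial in [t^-1]. *)
have := expR_ge1Dxn i u0; set e := expR _; have e0 : 0 < e by exact: expR_gt0.
rewrite expRN -/e => h.
have h2 : t^-1 ^+ i.+1 <= (i.+1)`!%:R * e.
  rewrite mulrC -ler_pdivrMr ?ltr0n ?fact_gt0// (le_trans _ h)//.
  by rewrite lerDr.
rewrite ler_pdivrMr// mulrAC -ler_pdivrMr// -exprSr.
exact: h2.
Qed.

Lemma is_derive_flat_exp p x :
  is_derive x (1 : R) (flat_exp p) (flat_exp ('X^2 * (p - p^`())) x).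
Proof.
have [x0|x0|->] := ltgtP x 0.
- rewrite {2}/flat_exp ifF; last by apply/negbTE; rewrite -leNgt ltW.
  apply: (@near_eq_is_derive _ _ _ (cst 0)).
  near=> y; rewrite /flat_exp ifF//; apply/negbTE; rewrite -leNgt.
  by near: y; exact: lt_le_nbhsl.
- have -> : flat_exp ('X^2 * (p - p^`())) x =
      p.[x^-1] * (expR (- x^-1) * x^-2) + expR (- x^-1) * (p^`().[x^-1] * (- x^-2)).
    rewrite /flat_exp x0 hornerM hornerXn hornerD hornerN -exprVn; ring.
  apply: (@near_eq_is_derive _ _ _
      (fun y => (horner p \o @GRing.inv R) y * (expR \o (fun y => - y^-1)) y)).
    near=> y; rewrite /flat_exp ifT//.
    by near: y; exact: lt_nbhsr.
  have dinv : is_derive x (1 : R) (@GRing.inv R) (- x^-2).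
    have xn0 : x != 0 by rewrite gt_eqF.
    rewrite -[- x^-2]mulr1; exact: (@is_deriveV _ id x 1 1 xn0 (is_derive_id _ _)).
  have dninv : is_derive x (1 : R) (fun y : R => - y^-1) (x^-2).
    rewrite -[x^-2]opprK; exact: is_deriveN.
  exact: is_deriveM.
- have -> : flat_exp ('X^2 * (p - p^`())) 0 = 0 by rewrite /flat_exp ltxx.
  have lim0 : h^-1 *: (flat_exp p (h *: 1 + 0) - flat_exp p 0) @[h --> (0 : R)^'] --> (0 : R).
    have [C C0 CP] := flat_exp_le ('X * p).
    apply/cvgr0Pnorm_lt => e e0; near=> h.
    have hn0 : h != 0 by near: h; exact: nbhs_dnbhs_neq.
    rewrite {2}/flat_exp ltxx subr0 addr0 [h%:A]mulr1 /flat_exp.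
    have [hp|hp] := ltP 0 h; last by rewrite scaler0 normr0.
    have := CP _ hp; rewrite /flat_exp hp hornerM hornerX -mulrA => hC.
    apply: le_lt_trans (hC _) _.
      apply: le_trans (ler_norm _) _; apply: ltW; near: h; apply: dnbhs0_lt.
      exact: ltr01.
    apply: (@le_lt_trans _ _ ((C + 1) * h)); first by rewrite ler_pM2r// lerDl.
    rewrite mulrC -ltr_pdivlMr ?ltr_wpDl//; apply: le_lt_trans (ler_norm _) _.
    by near: h; apply: dnbhs0_lt; rewrite divr_gt0// ltr_wpDl.
  apply: DeriveDef; first by apply/cvg_ex; exists 0.
  exact: cvg_lim lim0.
Unshelve. all: by end_near. Qed.

Lemma smooth_flat_exp k p : smooth k (flat_exp p).
Proof.
elim: k p => [|k IH] p /=.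
  exact: is_derive_continuous (is_derive_flat_exp p).
by exists (flat_exp ('X^2 * (p - p^`()))) => //; exact: is_derive_flat_exp.
Qed.

(** As [k] grows, these tend to the indicator function of the open interval from
    [a] to [b]; the scaling by [k.+1] replaces a normalization. *)
Definition flat_bump (k : nat) (a b t : R) : R :=
  flat_exp 1 (k.+1%:R * t - k.+1%:R * a) * flat_exp 1 (k.+1%:R * b - k.+1%:R * t).

Lemma smooth_flat_bump j k a b : smooth j (flat_bump k a b).
Proof.
apply: smooth_mul; first exact: (smooth_affine _ _ (smooth_flat_exp _ _)).
rewrite (_ : (fun x => _) = (fun x => flat_exp 1 (- k.+1%:R * x + k.+1%:R * b))).
  exact: (smooth_affine _ _ (smooth_flat_exp _ _)).
by apply/funext => x; rewrite mulNr addrC.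
Qed.

Lemma flat_exp1_01 t : 0 <= flat_exp 1 t <= 1.
Proof.
rewrite /flat_exp; case: ifPn => [t0|_]; last by rewrite lexx ler01.
rewrite hornerC mul1r expR_ge0/= expR_le1 oppr_le0 invr_ge0; exact: ltW.
Qed.

Lemma flat_bump_01 k a b t : 0 <= flat_bump k a b t <= 1.
Proof.
rewrite /flat_bump; have /andP[h1 h2] := flat_exp1_01 (k.+1%:R * t - k.+1%:R * a).
have /andP[h3 h4] := flat_exp1_01 (k.+1%:R * b - k.+1%:R * t).
by rewrite mulr_ge0// mulr_ile1.
Qed.

Lemma flat_bump_eq0 k a b t : ~~ (a < t < b) -> flat_bump k a b t = 0.
Proof.
rewrite negb_and -!leNgt /flat_bump /flat_exp !subr_gt0 !ltr_pM2l ?ltr0n//.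
by move=> /orP[] h; rewrite !ltNge h/= ?(mul0r, mulr0).
Qed.

Lemma cvg_flat_bump (a b t : R) :
  flat_bump k a b t @[k --> \oo] --> ((a < t < b)%R%:R : R).
Proof.
have [/andP[at_ tb]|h] := boolP (a < t < b); last first.
  by under eq_fun do rewrite flat_bump_eq0//; exact: cvg_cst.
have cvg1 (u : R) : 0 < u -> flat_exp 1 (k.+1%:R * u) @[k --> \oo] --> (1 : R).
  move=> u0.
  have -> : (fun k : nat => flat_exp 1 (k.+1%:R * u)) = (fun k => expR (k.+1%:R^-1 * - u^-1)).
    apply/funext => k; rewrite /flat_exp mulr_gt0 ?ltr0n// hornerC mul1r.
    by rewrite invfM mulrN.
  rewrite -[X in _ --> X]expR0.
  apply: (@continuous_cvg _ _ _ _ _ _ (@expR R)); first exact: continuous_expR.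
  rewrite -[X in _ --> X](mul0r (- u^-1)); apply: cvgMr_tmp.
  exact: cvg_harmonic.
rewrite -[X in _ --> X]mulr1 /flat_bump.
under eq_fun do rewrite -!mulrBr.
by apply: cvgM; apply: cvg1; rewrite subr_gt0.
Qed.

End smooth_one_variable.

(** * Products over the coordinates *)

Section coordinate_products.
Context {R : realType} {n : nat}.
Implicit Types (x v : 'rV[R]_n) (f : 'rV[R]_n -> R) (g : 'I_n -> R -> R).
Local Notation "''e_' i" := (delta_mx 0 i : 'rV[R]_n) (at level 8, i at level 2).

Lemma upd_rV_delta x i t : upd_rV x i (t + x 0 i) = t *: 'e_i + x.
Proof.
apply/rowP => j; rewrite !mxE eqxx/=.
by have [->|ji] := eqVneq j i; rewrite ?mulr1// mulr0 add0r.
Qed.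

Lemma is_derive_updP f x i df :
  is_derive (x 0 i) (1 : R) (fun t => f (upd_rV x i t)) df <-> is_derive x 'e_i f df.
Proof.
have E : (fun h : R => h^-1 *: ((f \o shift x) (h *: 'e_i) - f x)) =
    (fun h : R => h^-1 *: (((fun t => f (upd_rV x i t)) \o shift (x 0 i)) (h *: (1 : R)) -
                       f (upd_rV x i (x 0 i)))).
  apply/funext => h /=; rewrite [h%:A]mulr1 upd_rV_delta.
  by rewrite -[x 0 i]add0r upd_rV_delta scale0r add0r.
split; case=> d1 d2; apply: DeriveDef; first by rewrite /derivable E.
- by rewrite /derive E.
- by rewrite /derivable -E.
- by rewrite /derive -E.
Qed.

(** Monomials, their derivatives and the test functions all have this shape, so
    smoothness in several variables reduces to one variable. *)
Definition prodf g x : R := \prod_i g i (x 0 i).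

Lemma prodf_upd g x i t :
  prodf g (upd_rV x i t) = g i t * \prod_(j | j != i) g j (x 0 j).
Proof.
rewrite /prodf (bigD1 i)//= mxE eqxx; congr (_ * _).
by apply: eq_bigr => j ji; rewrite mxE (negbTE ji).
Qed.

Lemma is_derive_prodf g (g' : R -> R) x i :
  is_derive (x 0 i) (1 : R) (g i) (g' (x 0 i)) ->
  is_derive x 'e_i (prodf g) (prodf (fun j => if j == i then g' else g j) x).
Proof.
move=> dg; apply/is_derive_updP.
rewrite (_ : (fun t => _) = (fun t => g i t * \prod_(j | j != i) g j (x 0 j))); last first.
  by apply/funext => t; exact: prodf_upd.
set c := \prod_(_ | _) _.
have -> : prodf (fun j => if j == i then g' else g j) x = g' (x 0 i) * c.
  rewrite /prodf (bigD1 i)//= eqxx; congr (_ * _).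
  by apply: eq_bigr => j ji; rewrite (negbTE ji).
have := @is_deriveM _ _ (g i) (cst c) (x 0 i) 1 _ _ dg (is_derive_cst _ _ _).
rewrite scaler0 add0r.
by rewrite [c *: _]mulrC.
Qed.

Lemma continuous_prodf g : (forall i, continuous (g i)) -> continuous (prodf g).
Proof.
move=> cg; apply: continuous_prod => i _ x.
by apply: (@continuous_comp _ _ _ (fun x : 'rV[R]_n => x 0 i) (g i));
  [exact: coord_continuous|exact: cg].
Qed.

Lemma class_C_prodf k g : (forall i, smooth k (g i)) -> class_C k (prodf g).
Proof.
elim: k g => [|k IH] g gS; first by apply: continuous_prodf => i; exact: gS.
split; first by apply: continuous_prodf => i; exact: smooth_continuous (gS i).
move=> i; have [g' dg g'S] := gS i.
have dp x : is_derive x 'e_i (prodf g) (prodf (fun j => if j == i then g' else g j) x).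
  by apply: is_derive_prodf; exact: dg.
split; first by move=> x; case: (dp x).
rewrite (_ : 'D_('e_i) (prodf g) = prodf (fun j => if j == i then g' else g j)); last first.
  by apply/funext => x; case: (dp x).
by apply: IH => j; case: ifPn => _ //; exact: smooth_pred (gS j).
Qed.

Lemma is_derive_sumf (I : Type) (r : seq I) (P : pred I) (F : I -> 'rV[R]_n -> R)
    (F' : I -> R) x v :
  (forall i, is_derive x v (F i) (F' i)) ->
  is_derive x v (fun y => \sum_(i <- r | P i) F i y) (\sum_(i <- r | P i) F' i).
Proof.
move=> dF; elim: r => [|i r IH].
  by under eq_fun do rewrite big_nil; rewrite big_nil; exact: is_derive_cst.
under eq_fun do rewrite big_cons; rewrite big_cons.
by case: (P i) => //; exact: is_deriveD.
Qed.

Lemma coord_poly_prodf m (P : 'I_n -> {poly R}) :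
  (forall i, size (P i) <= m.+1)%N -> coord_poly m (prodf (fun i => horner (P i))).
Proof.
move=> sP i x; exists ((\prod_(j | j != i) (P j).[x 0 j]) *: P i).
  exact: leq_trans (size_scale_leq _ _) (sP i).
by move=> t; rewrite prodf_upd hornerZ mulrC.
Qed.

Lemma coord_poly_scale m (c : R) f : coord_poly m f -> coord_poly m (fun x => c * f x).
Proof.
move=> pf i x; have [p sp pE] := pf i x; exists (c *: p).
  exact: leq_trans (size_scale_leq _ _) sp.
by move=> t; rewrite pE hornerZ.
Qed.

Lemma coord_poly_sum m (I : Type) (r : seq I) (P : pred I) (F : I -> 'rV[R]_n -> R) :
  (forall i, coord_poly m (F i)) -> coord_poly m (fun x => \sum_(i <- r | P i) F i x).
Proof.
move=> pF i x; elim: r => [|j r [p sp pE]].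
  by exists 0; rewrite ?size_poly0// => t; rewrite big_nil horner0.
have [q sq qE] := pF j i x; case Pj : (P j).
  exists (q + p); last by move=> t; rewrite big_cons Pj hornerD pE qE.
  by apply: leq_trans (size_polyD _ _) _; rewrite geq_max sq.
by exists p => // t; rewrite big_cons Pj.
Qed.

(** All that is used of a polynomial: its gradient, and the restrictions of the
    partial derivatives to coordinate lines. *)
Lemma poly_fun_derive m f : poly_fun m f ->
  continuous f /\ exists f' : 'I_n -> 'rV[R]_n -> R, forall i,
    [/\ forall x, is_derive x 'e_i f (f' i x), continuous (f' i) & coord_poly m (f' i)].
Proof.
case=> c ->; split.
  apply: continuous_sum => a _; apply: continuous_mul; first exact: cst_continuous.
  by apply: (@continuous_prodf (fun i t => t ^+ a i)) => i; exact: exprn_continuous.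
pose P (a : {ffun 'I_n -> 'I_m.+1}) (i j : 'I_n) : {poly R} :=
  if j == i then ('X^(a j))^`() else 'X^(a j).
pose G a (i : 'I_n) (x : 'rV[R]_n) : R := c a * prodf (fun j => horner (P a i j)) x.
exists (fun i x => \sum_(a : {ffun 'I_n -> 'I_m.+1} | (\sum_i a i <= m)%N) G a i x) => i.
split.
- move=> x; apply: is_derive_sumf => a; rewrite /G.
  apply: is_deriveZ.
  rewrite (_ : (fun x => _) = prodf (fun j => horner 'X^(a j))); last first.
    by apply/funext => y; apply: eq_bigr => j _; rewrite hornerXn.
  rewrite (_ : (fun j => horner (P a i j)) =
      (fun j => if j == i then horner ('X^(a i))^`() else horner 'X^(a j))).
    by apply: is_derive_prodf; exact: is_derive_poly.
  by apply/funext => j; rewrite /P; case: eqP => [->|].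
- apply: continuous_sum => a _; apply: continuous_mul; first exact: cst_continuous.
  by apply: continuous_prodf => j; exact: continuous_horner.
- apply: coord_poly_sum => a; apply: coord_poly_scale; apply: coord_poly_prodf => j.
  rewrite /P; case: eqP => _; last by rewrite size_polyXn ltn_ord.
  have Xn0 : 'X^(a j) != 0 :> {poly R} by rewrite monic_neq0// monicXn.
  by rewrite (leq_trans (ltnW (lt_size_deriv Xn0)))// size_polyXn ltn_ord.
Qed.

Definition bump_rV (k : nat) (a b : 'rV[R]_n) : 'rV[R]_n -> R :=
  prodf (fun i => flat_bump k (a 0 i) (b 0 i)).

Definition obox (a b : 'rV[R]_n) : set 'rV[R]_n :=
  [set x | forall i, a 0 i < x 0 i < b 0 i].

Definition cbox (a b : 'rV[R]_n) : set 'rV[R]_n :=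
  [set x | forall i, a 0 i <= x 0 i <= b 0 i].

Lemma compact_cbox a b : compact (cbox a b).
Proof.
rewrite (_ : cbox a b = [set x | forall i, `[a 0 i, b 0 i]%classic (x 0 i)]).
  apply: (@rV_compact _ _ (fun i => `[a 0 i, b 0 i]%classic)) => i.
  exact: segment_compact.
by apply/seteqP; split => x xP i; have := xP i; rewrite /= in_itv.
Qed.

Lemma closed_cbox a b : closed (cbox a b).
Proof.
apply: compact_closed; last exact: compact_cbox.
exact: norm_hausdorff.
Qed.

Lemma bump_rV_01 k a b x : 0 <= bump_rV k a b x <= 1.
Proof.
rewrite /bump_rV /prodf; elim/big_rec: _ => [|i y _ /andP[y0 y1]].
  by rewrite ler01 lexx.
have /andP[h0 h1] := flat_bump_01 k (a 0 i) (b 0 i) (x 0 i).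
by rewrite mulr_ge0//= mulr_ile1.
Qed.

Lemma bump_rV_neq0 k a b x : bump_rV k a b x != 0 -> obox a b x.
Proof.
rewrite /bump_rV /prodf => /prodf_neq0 h i.
by apply/negPn/negP => /(flat_bump_eq0 k) h0; have := h i isT; rewrite h0 eqxx.
Qed.

(** Integrals against bumps therefore determine integrals over open boxes. *)
Lemma cvg_bump_rV a b x : bump_rV k a b x @[k --> \oo] --> (\1_(obox a b) x : R).
Proof.
have -> : \1_(obox a b) x = \prod_i ((a 0 i < x 0 i < b 0 i)%R%:R : R).
  rewrite indicE; have [xab|nx] := boolP (x \in obox a b).
    by rewrite big1// => i _; move/set_mem : xab => /(_ i) ->.
  have [i /negbTE xi] : exists i, ~~ (a 0 i < x 0 i < b 0 i).
    apply: contrapT => h; move/negP : nx; apply; apply/mem_set => i.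
    by apply: contrapT => /negP hi; apply: h; exists i.
  by rewrite (bigD1 i)//= xi mul0r.
rewrite /bump_rV /prodf; elim: (index_enum _) => [|i r IH].
  by under eq_fun do rewrite big_nil; rewrite big_nil; exact: cvg_cst.
under eq_fun do rewrite big_cons; rewrite big_cons.
by apply: cvgM => //; exact: cvg_flat_bump.
Qed.

Lemma test_function_bump k a b D : cbox a b `<=` D ->
  test_function D (bump_rV k a b).
Proof.
move=> abD; have sub : closure [set x | bump_rV k a b x != 0] `<=` cbox a b.
  apply: subset_trans (@closed_cbox a b).
  apply: closure_subset => x /bump_rV_neq0 xab i.
  by have /andP[/ltW -> /ltW ->] := xab i.
split.
- by move=> j; apply: class_C_prodf => i; exact: smooth_flat_bump.
- apply: subclosed_compact sub; first exact: closed_closure.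
  exact: compact_cbox.
- exact: subset_trans sub abD.
Qed.

End coordinate_products.

(** * Integration by parts *)

Section bounded_integrable.
Context d (T : measurableType d) (R : realType) (mu : {measure set T -> \bar R}).

Lemma integrable_of_bounded (A : set T) (f : T -> R) (M : R) :
  measurable A -> (mu A < +oo)%E -> measurable_fun A f ->
  (forall x, A x -> `|f x| <= M) -> mu.-integrable A (EFin \o f).
Proof.
move=> mA Aoo mf fM; apply: measurable_bounded_integrable => //.
exists M; split; first exact: num_real.
by move=> y My x Ax; exact: le_trans (fM x Ax) (ltW My).
Qed.

End bounded_integrable.

Section integration_by_parts.
Context {R : realType}.
Local Notation leb := (@lebesgue_measure R).
Local Notation "''e_' i" := (delta_mx 0 i : 'rV[R]_(_)) (at level 8, i at level 2).

(** A cube centred at the origin: the supports of test functions and the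
    elements are enclosed in such cubes. *)
Definition ccube n (M : R) : set 'rV[R]_n := cube (const_mx (- M)) (2 * M).
Arguments ccube : clear implicits.

Lemma ccubeP n M (x : 'rV[R]_n) : ccube n M x <-> forall i, `|x 0 i| <= M.
Proof.
have e i : (const_mx (- M) : 'rV[R]_n) 0 i + 2 * M = M by rewrite mxE; lra.
by split=> h i; have := h i; rewrite e mxE -ler_norml.
Qed.

Lemma ccube_lty n M : (lebesgue_rV n (ccube n M) < +oo)%E.
Proof.
apply: (@le_lt_trans _ _ (lebesgue_rV n (ccube n `|M|))).
  apply: le_measure; rewrite ?inE; try exact: measurable_cube.
  by move=> x /ccubeP xM; apply/ccubeP => i; rewrite (le_trans (xM i))// ler_norm.
by rewrite lebesgue_cube ?ltry// mulr_ge0.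
Qed.

Lemma compact_ccube n M : compact (ccube n M).
Proof.
rewrite (_ : ccube n M = cbox (const_mx (- M)) (const_mx M)); first exact: compact_cbox.
apply/seteqP; split=> x.
  by move=> /ccubeP h i; rewrite !mxE -ler_norml.
by move=> h; apply/ccubeP => i; have := h i; rewrite !mxE ler_norml.
Qed.

Lemma continuous_bounded_on_compact n (f : 'rV[R]_n -> R) A : continuous f -> compact A ->
  exists M : R, forall x, A x -> `|f x| <= M.
Proof.
move=> cf cA; have [->|/set0P A0] := eqVneq A set0; first by exists 0.
have cnf : continuous (fun x => `|f x|).
  by move=> x; apply: (@continuous_comp _ _ _ f (@Num.norm _ R)); [exact: cf|exact: norm_continuous].
have [c _ cM] := @compact_EVT_max _ _ (fun x => `|f x|) A A0 cA (continuous_subspaceT cnf).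
by exists `|f c| => x Ax; apply: cM; rewrite inE.
Qed.

Lemma compact_sub_ccube n (A : set 'rV[R]_n) : compact A ->
  exists2 M, 0 < M & A `<=` ccube n M.
Proof.
move=> cA; have [B hB] : exists B : R, forall x : 'rV[R]_n, A x -> `|enorm (x - 0)| <= B.
  by apply: continuous_bounded_on_compact => //; exact: continuous_enormB.
exists (`|B| + 1); first by rewrite ltr_wpDl.
move=> x /hB xB; apply/ccubeP => i; apply: le_trans (coord_le_enorm _ _) _.
rewrite -[x]subr0 (le_trans (ler_norm _))// (le_trans xB)//.
by rewrite (le_trans (ler_norm _))// lerDl.
Qed.

Lemma integrable_ccube n (F : 'rV[R]_n -> R) M : continuous F ->
  (forall x, ~ ccube n M x -> F x = 0) -> (lebesgue_rV n).-integrable setT (EFin \o F).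
Proof.
move=> cF F0.
have -> : EFin \o F = (EFin \o F) \_ (ccube n M).
  apply/funext => x; rewrite patchE; case: ifPn => //= /negP xM.
  by rewrite F0// => h; apply: xM; exact: mem_set.
apply/(integrable_mkcond _ (measurable_cube _ _)).
have [K FK] := continuous_bounded_on_compact cF (@compact_ccube n M).
apply: (integrable_of_bounded (M := K)) => //.
- exact: measurable_cube.
- exact: ccube_lty.
- exact: measurable_funTS (continuous_measurable_rV cF).
Qed.

Lemma integral_derive_compact1 (g g' : R -> R) M : 0 < M ->
  (forall t, is_derive t (1 : R) g (g' t)) -> continuous g' ->
  (forall t, M <= `|t| -> g t = 0 /\ g' t = 0) ->
  (\int[leb]_t (g' t)%:E = 0)%E.
Proof.
move=> M0 dg cg' out.
have MM : - M < M by lra.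
have -> : (\int[leb]_t (g' t)%:E = \int[leb]_(t in `[(- M)%R, M]) (g' t)%:E)%E.
  rewrite [RHS]integral_mkcond; apply: eq_integral => t _.
  rewrite patchE; case: ifPn => // /negP tM.
  rewrite (proj2 (out t _))// leNgt; apply/negP => h; apply: tM.
  by apply/mem_set; rewrite /= in_itv/= -ler_norml ltW.
rewrite (@continuous_FTC2 _ g' g)//.
- by rewrite !(proj1 (out _ _)) ?normrN ?gtr0_norm// subee.
- exact: continuous_subspaceT.
- have cg := is_derive_continuous dg.
  split.
  + by move=> x _; case: (dg x).
  + apply: cvg_at_right_filter; exact: cg.
  + apply: cvg_at_left_filter; exact: cg.
- by move=> x _; rewrite derive1E; case: (dg x).
Qed.

Lemma continuous_consrVl n (F : 'rV[R]_n.+1 -> R) (t : R) :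
  continuous F -> continuous (fun v => F (consrV (t, v))).
Proof.
move=> cF v; apply: (@continuous_comp _ _ _ (fun v => consrV (t, v)) F); last exact: cF.
move=> A /near_box_rV[r r0 rA]; apply/near_box_rV; exists r => // w vw; apply: rA.
apply/forall_ord_consrV; rewrite !consrV0/= subrr normr0; split => // j.
by rewrite !consrVS/=; exact: vw.
Qed.

Lemma continuous_consrVr n (F : 'rV[R]_n.+1 -> R) v :
  continuous F -> continuous (fun t => F (consrV (t, v))).
Proof.
move=> cF t; apply: (@continuous_comp _ _ _ (fun t => consrV (t, v)) F); last exact: cF.
move=> A /near_box_rV[r r0 rA]; apply/nbhs_ballP; exists r => // s ts; apply: rA.
apply/forall_ord_consrV; rewrite !consrV0/=; split => // j.
by rewrite !consrVS/= subrr normr0.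
Qed.

(** Integrate first in the direction [i], where the fundamental theorem of
    calculus applies; Fubini's theorem reduces the remaining coordinates to this
    one by induction. *)
Lemma integral_derive_compact n (F F' : 'rV[R]_n -> R) i M : 0 < M ->
  (forall x, is_derive x 'e_i F (F' x)) -> continuous F' ->
  (forall (x : 'rV[R]_n) j, M <= `|x 0 j| -> F x = 0 /\ F' x = 0) ->
  (\int[lebesgue_rV n]_x (F' x)%:E = 0)%E.
Proof.
move=> M0; elim: n F F' i => [|n IH] F F' i dF cF' out; first by case: i dF.
have intF' : (lebesgue_rV n.+1).-integrable setT (EFin \o F').
  apply: (@integrable_ccube _ _ M) => // x /ccubeP h.
  have [j xj] : exists j, M < `|x 0 j|.
    by apply: contrapT => nj; apply: h => j; rewrite leNgt; apply/negP => ?; apply: nj; exists j.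
  by case: (out x j (ltW xj)).
have [e1 e2] := integral_lebesgue_rVS intF'.
have di (x : 'rV[R]_n.+1) : is_derive (x 0 i) (1 : R) (fun t => F (upd_rV x i t)) (F' x).
  by apply/is_derive_updP; exact: dF.
case: (unliftP ord0 i) => [j ij|i0]; [rewrite {}e1|rewrite {}e2].
  apply: integral0_eq => t _.
  apply: (IH (fun v => F (consrV (t, v))) (fun v => F' (consrV (t, v))) j).
  - move=> v; apply/is_derive_updP; have := di (consrV (t, v)); rewrite ij consrVS/=.
    by under [X in is_derive _ _ X _]eq_fun do rewrite upd_consrVS.
  - exact: continuous_consrVl.
  - by move=> v k vk; apply: (out _ (lift ord0 k)); rewrite consrVS.
apply: integral0_eq => v _; apply: (@integral_derive_compact1 (fun t => F (consrV (t, v)))).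
- exact: M0.
- move=> t; have := di (consrV (t, v)); rewrite i0 consrV0/=.
  by under [X in is_derive _ _ X _]eq_fun do rewrite upd_consrV0.
- exact: continuous_consrVr.
- by move=> t tM; apply: (out _ ord0); rewrite consrV0.
Qed.

End integration_by_parts.

(** * Weak gradients of functions that are polynomial on an open set *)

Section weak_derivative.
Context {R : realType} {n : nat}.
Local Notation leb := (@lebesgue_rV R n).
Local Notation "''e_' i" := (delta_mx 0 i : 'rV[R]_n) (at level 8, i at level 2).
Implicit Types (D : set 'rV[R]_n) (phi : 'rV[R]_n -> R).

Lemma compact_measurable_rV (A : set 'rV[R]_n) : compact A -> measurable A.
Proof.
by move=> cA; apply: closed_measurable_rV; apply: compact_closed => //; exact: norm_hausdorff.
Qed.

Lemma compact_leb_lty (A : set 'rV[R]_n) : compact A -> (leb A < +oo)%E.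
Proof.
move=> cA; have [M _ AM] := compact_sub_ccube cA.
apply: le_lt_trans (ccube_lty n M).
apply: le_measure; rewrite ?inE//; last exact: measurable_cube.
exact: compact_measurable_rV.
Qed.

Lemma loc_integrable_continuous D (w p : 'rV[R]_n -> R) : open D -> continuous p ->
  (forall x, D x -> w x = p x) -> loc_integrable D w.
Proof.
move=> oD cp wp; have mp : measurable_fun D p.
  exact: measurable_funTS (continuous_measurable_rV cp).
split; first by apply: eq_measurable_fun mp => x /set_mem Dx; rewrite wp.
move=> A cA AD; have mA := compact_measurable_rV cA.
have [K pK] := continuous_bounded_on_compact cp cA.
apply: (integrable_of_bounded (M := K)) => //.
- exact: compact_leb_lty.
- apply: measurable_funS AD _; first exact: open_measurable_rV.
  by apply: eq_measurable_fun mp => x /set_mem Dx; rewrite wp.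
- by move=> x Ax; rewrite wp; [exact: pK|exact: AD].
Qed.

Lemma test_function_derive D phi i : test_function D phi ->
  [/\ continuous phi, continuous ('D_('e_i) phi),
    forall x, is_derive x 'e_i phi ('D_('e_i) phi x) &
    forall x, ~ closure [set x | phi x != 0] x -> phi x = 0 /\ 'D_('e_i) phi x = 0].
Proof.
move=> [/(_ 1%N) [cphi /(_ i)[dphi cdphi]] _ _]; split => //.
move=> x xS; split.
  by apply: contrapT => /eqP h; apply: xS; exact: subset_closure.
have near0 : \near x, (cst 0 : 'rV[R]_n -> R) x = phi x.
  have oS : open (~` closure [set x | phi x != 0]) by apply: closed_openC; exact: closed_closure.
  have : nbhs x (~` closure [set x | phi x != 0]) by exact: open_nbhs_nbhs.
  apply: filterS => y yS; apply: esym; apply: contrapT => /eqP h; apply: yS; exact: subset_closure.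
by case: (near_eq_is_derive near0 (is_derive_cst 0 x 'e_i)).
Qed.

(** A product with a test function has compact support, so the integral of its
    derivative is zero. *)
Lemma weak_partial_classical D i (w p p' : 'rV[R]_n -> R) :
  open D -> continuous p -> continuous p' ->
  (forall x, is_derive x 'e_i p (p' x)) ->
  (forall x, D x -> w x = p x) -> weak_partial D i w p'.
Proof.
move=> oD cp cp' dp wp; split.
- exact: loc_integrable_continuous cp wp.
- exact: loc_integrable_continuous cp' _.
move=> phi tphi; have [cphi cdphi dphi phi0] := test_function_derive i tphi.
have [_ cS SD] := tphi.
have [M M0 SM] := compact_sub_ccube cS.
have out (x : 'rV[R]_n) : ~ ccube M x -> phi x = 0 /\ 'D_('e_i) phi x = 0.
  by move=> xM; apply: phi0 => /SM.
have i1 : leb.-integrable setT (EFin \o (fun x => p x * 'D_('e_i) phi x)).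
  apply: (@integrable_ccube _ _ _ M); first exact: continuous_mul.
  by move=> x /out[_ ->]; rewrite mulr0.
have i2 : leb.-integrable setT (EFin \o (fun x => p' x * phi x)).
  apply: (@integrable_ccube _ _ _ M); first exact: continuous_mul.
  by move=> x /out[-> _]; rewrite mulr0.
have e0 : (\int[leb]_x ((p x * 'D_('e_i) phi x) + (p' x * phi x))%:E = 0)%E.
  apply: (@integral_derive_compact _ _ (fun x => p x * phi x) _ i (M + 1)).
  - by rewrite ltr_wpDr.
  - move=> x; have := dphi x; have := dp x => h1 h2.
    rewrite [p' x * _]mulrC; exact: is_deriveM.
  - by apply: continuous_add; exact: continuous_mul.
  - move=> x j xj; have xM : ~ ccube M x.
      move=> /ccubeP /(_ j); apply/negP; rewrite -ltNge; apply: lt_le_trans xj.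
      by rewrite ltrDl.
    by have [-> ->] := out x xM; rewrite !mulr0 addr0.
have restr (f g : 'rV[R]_n -> R) : (forall x, D x -> f x = g x) ->
    (forall x, ~ D x -> g x = 0) -> \int[leb]_(x in D) f x = \int[leb]_x g x.
  move=> fg g0; rewrite Rintegral_mkcond; apply: eq_Rintegral => x _.
  rewrite patchE; case: ifPn => [/set_mem/fg//|/negP xD].
  by rewrite g0// => Dx; apply: xD; exact/mem_set.
rewrite (restr _ (fun x => p x * 'D_('e_i) phi x)); last 2 first.
- by move=> x Dx; rewrite wp.
- by move=> x xD; rewrite (proj2 (phi0 x _)) ?mulr0// => /SD.
rewrite (restr _ (fun x => p' x * phi x))//; last first.
  by move=> x xD; rewrite (proj1 (phi0 x _)) ?mulr0// => /SD.
apply/eqP; rewrite -addr_eq0 -RintegralD//.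
by rewrite /Rintegral e0.
Qed.

Lemma measurable_obox (a b : 'rV[R]_n) : measurable (obox a b).
Proof.
rewrite (_ : obox a b = \bigcap_(i in [set: 'I_n])
    ((fun x : 'rV[R]_n => x 0 i) @^-1` `]a 0 i, b 0 i[%classic)).
  apply: fin_bigcap_measurable => // i _; rewrite -[X in measurable X]setTI.
  by apply: measurable_coord => //; exact: measurable_itv.
by apply/seteqP; split => [x xP i _|x xP i]; have := xP i; rewrite /= in_itv//; apply.
Qed.

(** The bumps of a box are test functions and converge to its indicator
    function; dominated convergence passes to the limit on both sides. *)
Lemma integral_obox_eq D (g1 g2 : 'rV[R]_n -> R) :
  loc_integrable D g1 -> loc_integrable D g2 ->
  (forall phi, test_function D phi ->
    \int[leb]_(x in D) (g1 x * phi x) = \int[leb]_(x in D) (g2 x * phi x)) ->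
  forall a b, cbox a b `<=` D ->
  (\int[leb]_(x in obox a b) (g1 x)%:E = \int[leb]_(x in obox a b) (g2 x)%:E)%E.
Proof.
move=> l1 l2 eqphi a b abD.
have mA : measurable (cbox a b) by apply: compact_measurable_rV; exact: compact_cbox.
have mO := measurable_obox a b.
have OA : obox a b `<=` cbox a b by move=> x xab i; have /andP[/ltW -> /ltW ->] := xab i.
have cont k : continuous (bump_rV k a b : 'rV[R]_n -> R).
  by have [/(_ 0%N)] := test_function_bump k abD.
have lim (g : 'rV[R]_n -> R) : loc_integrable D g ->
    (\int[leb]_(x in cbox a b) (g x * bump_rV k a b x)%:E @[k --> \oo] -->
     \int[leb]_(x in obox a b) (g x)%:E)%E.
  move=> [mg lg]; have ig := lg _ (@compact_cbox _ _ a b) abD.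
  have mgA : measurable_fun (cbox a b) (EFin \o g) := measurable_int _ ig.
  have -> : (\int[leb]_(x in obox a b) (g x)%:E =
             \int[leb]_(x in cbox a b) (g x * \1_(obox a b) x)%:E)%E.
    rewrite integral_mkcond [RHS]integral_mkcond; apply: eq_integral => x _.
    rewrite !patchE indicE; case: ifPn => [xO|xO].
      by rewrite mulr1 mem_set//; apply: OA; exact: set_mem.
    by rewrite mulr0; case: ifP.
  apply: (@dominated_cvg _ _ _ leb _ mA
     (fun k x => (g x * bump_rV k a b x)%:E) _ (fun x => `|g x|%:E)).
  - move=> k; apply/measurable_EFinP; apply: measurable_funM; first exact/measurable_EFinP.
    exact: measurable_funTS (continuous_measurable_rV (cont k)).
  - move=> x Ax; apply: cvg_EFin; first by apply: nearW.
    by apply: cvgMl_tmp; exact: cvg_bump_rV.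
  - by [].
  - exact: integrable_abse ig.
  - move=> k x Ax; rewrite lee_fin normrM ler_piMr//.
    by have /andP[h0 h1] := bump_rV_01 k a b x; rewrite ger0_norm.
have fin (g : 'rV[R]_n -> R) k : loc_integrable D g ->
    (\int[leb]_(x in cbox a b) (g x * bump_rV k a b x)%:E)%E \is a fin_num.
  move=> [mg lg]; have ig := lg _ (@compact_cbox _ _ a b) abD.
  have mgA : measurable_fun (cbox a b) (EFin \o g) := measurable_int _ ig.
  apply: integrable_fin_num => //; apply: le_integrable ig => //.
    apply/measurable_EFinP; apply: measurable_funM; first exact/measurable_EFinP.
    exact: measurable_funTS (continuous_measurable_rV (cont k)).
  move=> x Ax /=; rewrite lee_fin normrM ler_piMr//.
  by have /andP[h0 h1] := bump_rV_01 k a b x; rewrite ger0_norm.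
have same k : (\int[leb]_(x in cbox a b) (g1 x * bump_rV k a b x)%:E =
               \int[leb]_(x in cbox a b) (g2 x * bump_rV k a b x)%:E)%E.
  have toD (g : 'rV[R]_n -> R) : (\int[leb]_(x in cbox a b) (g x * bump_rV k a b x)%:E =
       \int[leb]_(x in D) (g x * bump_rV k a b x)%:E)%E.
    rewrite integral_mkcond [RHS]integral_mkcond; apply: eq_integral => x _.
    rewrite !patchE; have [xA|xA] := boolP (x \in cbox a b).
      by rewrite mem_set//; apply: abD; exact: set_mem.
    case: ifP => // _; rewrite (_ : bump_rV k a b x = 0) ?mulr0//.
    apply: contrapT => /eqP /bump_rV_neq0 /OA h; move/negP : xA; apply; exact/mem_set.
  rewrite -[LHS]fineK ?fin// -[RHS]fineK ?fin//; congr EFin.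
  rewrite !toD; apply: eqphi; exact: test_function_bump.
have c1 := lim _ l1; have c2 := lim _ l2.
rewrite -(funext same) in c2.
exact: (cvg_unique _ c1 c2).
Qed.

(** Sets bounded from above in some of the coordinates: they are stable under
    intersection and generate the measurable sets, as the monotone class
    argument requires. Bounding only some of the coordinates makes coordinate
    half-spaces members of the family. *)
Definition orthant (p : {set 'I_n} * 'rV[R]_n) : set 'rV[R]_n :=
  [set x | forall i, i \in p.1 -> x 0 i < p.2 0 i].

Lemma measurable_orthantE :
  (@measurable _ 'rV[R]_n) = <<s [set E | exists p, E = orthant p] >>.
Proof.
apply/seteqP; split; last first.
  apply: smallest_sub; first exact: sigma_algebra_measurable.
  move=> _ [p ->].
  rewrite (_ : orthant p = \bigcap_(i in [set i | i \in p.1])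
      ((fun x : 'rV[R]_n => x 0 i) @^-1` `]-oo, p.2 0 i[%classic)).
    apply: fin_bigcap_measurable => // i _; rewrite -[X in measurable X]setTI.
    by apply: measurable_coord => //; exact: measurable_itv.
  by apply/seteqP; split => [x xP i ip|x xP i ip]; have := xP i ip; rewrite /= in_itv.
have [s0 sC sU] := @smallest_sigma_algebra _ setT [set E | exists p, E = orthant p].
apply: smallest_sub => //.
rewrite -bigcup_seq => B [i _ [Y mY <-]] /=; rewrite setTI.
suff h : (@ocitv R).-sigma.-measurable `<=`
    [set C : set R | <<s [set E | exists p, E = orthant p] >> (rV_coord i @^-1` C)].
  exact: (h Y mY).
rewrite measurable_realfun.RGenInftyO.measurableE; apply: smallest_sub.
  split => /=.
  - by rewrite preimage_set0.
  - by move=> C cC; rewrite setTD -preimage_setC -setTD; exact: sC.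
  - by move=> F cF; rewrite preimage_bigcup; exact: sU.
move=> _ [c ->] /=; apply: sub_gen_smallest; exists ([set i]%SET, const_mx c).
apply/seteqP; split => x /=; rewrite in_itv/= /rV_coord.
  by move=> xc j /=; rewrite inE => /eqP ->; rewrite mxE.
by move=> /(_ i); rewrite inE eqxx mxE; apply.
Qed.

Lemma orthant_setI : setI_closed [set E | exists p, E = orthant p].
Proof.
move=> _ _ [[I a] ->] [[J b] ->].
exists ((I :|: J)%SET, \row_i (if i \in I then
  (if i \in J then Num.min (a 0 i) (b 0 i) else a 0 i) else b 0 i)).
apply/seteqP; split => x; rewrite /orthant /=.
  move=> [xI xJ] i; rewrite inE mxE => /orP[iI|iJ].
    by rewrite iI; case: ifP => [iJ|_]; rewrite ?lt_min xI// xJ.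
  by rewrite iJ; case: ifP => [iI|_]; rewrite ?lt_min ?xI// xJ.
move=> h; split => i iS; have := h i; rewrite inE mxE iS ?orbT => /(_ isT).
  by case: ifP => // _; rewrite lt_min => /andP[].
by case: ifP => // _; rewrite lt_min => /andP[].
Qed.

Lemma orthant_obox p a b :
  orthant p `&` obox a b =
  obox a (\row_i (if i \in p.1 then Num.min (b 0 i) (p.2 0 i) else b 0 i)).
Proof.
apply/seteqP; split => x; rewrite /orthant /obox /=.
  move=> [xI xab] i; rewrite mxE; have /andP[-> xb] := xab i.
  by case: ifP => // ip; rewrite lt_min xb xI.
move=> h; split => i.
  by move=> ip; have := h i; rewrite mxE ip lt_min => /and3P[].
have := h i; rewrite mxE; case: ifP => // _.
by rewrite lt_min => /and3P[-> ->].
Qed.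

(** The two integrals agree on all orthants, hence by a monotone class argument
    on all measurable subsets of the box. *)
Lemma ae_eq_obox D (g1 g2 : 'rV[R]_n -> R) :
  loc_integrable D g1 -> loc_integrable D g2 ->
  (forall phi, test_function D phi ->
    \int[leb]_(x in D) (g1 x * phi x) = \int[leb]_(x in D) (g2 x * phi x)) ->
  forall a b, cbox a b `<=` D ->
  ae_eq leb (obox a b) (EFin \o g1) (EFin \o g2).
Proof.
move=> l1 l2 eqphi a b abD.
have OA : obox a b `<=` cbox a b by move=> x xab i; have /andP[/ltW -> /ltW ->] := xab i.
have mA : measurable (cbox a b) by apply: compact_measurable_rV; exact: compact_cbox.
have mO := measurable_obox a b.
have int (g : 'rV[R]_n -> R) : loc_integrable D g -> leb.-integrable (obox a b) (EFin \o g).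
  move=> [_ lg]; apply: integrableS (lg _ (@compact_cbox _ _ a b) abD) => //.
pose P E := (\int[leb]_(x in E `&` obox a b) (g1 x)%:E =
             \int[leb]_(x in E `&` obox a b) (g2 x)%:E)%E.
have PO p : P (orthant p).
  rewrite /P orthant_obox; apply: (integral_obox_eq l1 l2 eqphi).
  apply: subset_trans abD => x xab i; have := xab i; rewrite mxE => /andP[-> h].
  rewrite /= (le_trans h)//; by case: ifP => // _; rewrite ge_min lexx.
have Pall E : measurable E -> P E.
  rewrite measurable_orthantE.
  apply: (dynkin_induction measurable_orthantE orthant_setI).
  - have <- : orthant (finset.set0, 0) = setT; last exact: PO.
    by apply/seteqP; split => // x _ i; rewrite inE.
  - by move=> _ [p ->]; exact: PO.
  - move=> S mS PS; rewrite /P.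
    have split_int (g : 'rV[R]_n -> R) : loc_integrable D g ->
       (\int[leb]_(x in ~` S `&` obox a b) (g x)%:E =
        \int[leb]_(x in obox a b) (g x)%:E - \int[leb]_(x in S `&` obox a b) (g x)%:E)%E.
      move=> /int ig.
      have mSO : measurable (S `&` obox a b) by exact: measurableI.
      have mCO : measurable (~` S `&` obox a b) by apply: measurableI => //; exact: measurableC.
      have OE : obox a b = (~` S `&` obox a b) `|` (S `&` obox a b).
        by rewrite -setIUl setUC setUCr setTI.
      rewrite [X in (_ = X - _)%E](congr1 (fun A => integral leb A _) OE) integral_setU//; last 2 first.
      - by rewrite -OE; exact: measurable_int ig.
      - by rewrite disj_set2E setIACA setICl set0I.
      rewrite addeK// integrable_fin_num//.
      by apply: integrableS ig => // x [].
    rewrite !split_int// PS; congr (_ - _)%E.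
    exact: (integral_obox_eq l1 l2 eqphi).
  - move=> F mF tF PF; rewrite /P setI_bigcupl.
    have tFO : trivIset setT (fun k => F k `&` obox a b).
      exact: trivIset_setIr.
    have mFO k : measurable (F k `&` obox a b) by exact: measurableI.
    rewrite !integral_bigcup//; first by apply: eq_eseriesr => k _; exact: PF.
    + apply: integrableS (int _ l2) => //; first exact: bigcupT_measurable.
      by move=> x [k _ []].
    + apply: integrableS (int _ l1) => //; first exact: bigcupT_measurable.
      by move=> x [k _ []].
apply: integral_ae_eq => //; first exact: int.
  exact: measurable_int (int _ l2).
move=> E EO mE; have := Pall E mE; rewrite /P setIidl//.
Qed.

(** An open set is a countable union of boxes whose closures it contains. *)
Lemma ae_local D (Q : 'rV[R]_n -> Prop) : open D ->
  (forall a b, cbox a b `<=` D -> {ae leb, forall x, obox a b x -> Q x}) ->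
  {ae leb, forall x, D x -> Q x}.
Proof.
move=> oD loc.
pose lo (p : 'rV[rat]_n * nat) : 'rV[R]_n := \row_i (ratr (p.1 0 i) - p.2.+1%:R^-1).
pose hi (p : 'rV[rat]_n * nat) : 'rV[R]_n := \row_i (ratr (p.1 0 i) + p.2.+1%:R^-1).
pose N (k : nat) : set 'rV[R]_n := if unpickle k is Some p then
  (if `[< cbox (lo p) (hi p) `<=` D >] then ~` [set x | obox (lo p) (hi p) x -> Q x]
   else set0) else set0.
have N0 : leb.-negligible (\bigcup_k N k).
  apply: negligible_bigcup => k; rewrite /N.
  case: unpickle => [p|]; last exact: negligible_set0.
  case: asboolP => [pD|_]; last exact: negligible_set0.
  exact: loc _ _ pD.
apply: negligibleS N0 => x /= /not_implyP[Dx nQ].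
have /near_box_rV[r r0 rD] : nbhs x D by exact: open_nbhs_nbhs.
have r20 : 0 < r / 2 by rewrite divr_gt0.
have [k kr] := ltr_add_invr r20; rewrite add0r in kr.
have k0 : 0 < k.+1%:R^-1 :> R by rewrite invr_gt0.
have [q qP] := rat_near_rV x k0.
pose p : 'rV[rat]_n * nat := (q, k).
exists (pickle p) => //; rewrite /N pickleK; case: asboolP => [_|npD].
  apply/not_implyP; split => // i; have := qP i; rewrite !mxE ltr_distlC => /andP[h1 h2].
  by apply/andP; split.
exfalso; apply: npD => y yp; apply: rD => i.
have := yp i; rewrite !mxE -ler_distlC => h.
rewrite (le_lt_trans (ler_distD (ratr (q 0 i)) _ _))// (splitr r).
by rewrite ltrD//; [rewrite distrC (lt_trans (qP i))|rewrite (le_lt_trans h)].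
Qed.

(** The fundamental lemma of the calculus of variations. *)
Lemma ae_eq_of_test_functions D (g1 g2 : 'rV[R]_n -> R) : open D ->
  loc_integrable D g1 -> loc_integrable D g2 ->
  (forall phi, test_function D phi ->
    \int[leb]_(x in D) (g1 x * phi x) = \int[leb]_(x in D) (g2 x * phi x)) ->
  {ae leb, forall x, D x -> g1 x = g2 x}.
Proof.
move=> oD l1 l2 eqphi; apply: ae_local => // a b abD.
have := ae_eq_obox l1 l2 eqphi abD.
by apply: filterS => x h xab; have := h xab => -[].
Qed.

(** Both sides satisfy the same integral identities against test functions. The
    existence of the classical gradient matters as well: it excludes the default
    value of the weak gradient. *)
Lemma weak_gradient_classical D (w p : 'rV[R]_n -> R) (p' : 'I_n -> 'rV[R]_n -> R) :
  open D -> continuous p -> (forall i, continuous (p' i)) ->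
  (forall i x, is_derive x 'e_i p (p' i x)) ->
  (forall x, D x -> w x = p x) ->
  forall i, {ae leb, forall x, D x -> weak_gradient D w x 0 i = p' i x}.
Proof.
move=> oD cp cp' dp wp i.
have wpart j := weak_partial_classical oD cp (cp' j) (dp j) wp.
have wG : forall j, weak_partial D j w (fun x => weak_gradient D w x 0 j).
  apply: (@xgetPex _ (fun=> 0) [set G : 'rV[R]_n -> 'rV[R]_n |
      forall i, weak_partial D i w (fun x => G x 0 i)]).
  exists (fun x => \row_j p' j x) => j /=.
  by under eq_fun do rewrite mxE.
have [_ lG GP] := wG i; have [_ lp pP] := wpart i.
apply: ae_eq_of_test_functions => // phi tphi.
by apply: oppr_inj; rewrite -GP// -pP.
Qed.

Lemma measurable_weak_gradient D (w : 'rV[R]_n -> R) i :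
  measurable_fun D (fun x => weak_gradient D w x 0 i).
Proof.
rewrite /weak_gradient; case: xgetP => [G _ GP|_]; first by case: (GP i) => _ [].
by under eq_fun do rewrite mxE; exact: measurable_cst.
Qed.

End weak_derivative.

(** * Measurability and bounds of traces *)

Section traces.
Context {R : realType} {n : nat}.
Local Notation leb := (@lebesgue_rV R n).
Implicit Types (D : set 'rV[R]_n) (f : 'rV[R]_n -> R) (x y : 'rV[R]_n).

Lemma limn_dvg (u : R^nat) : ~ cvgn u -> limn u = 0.
Proof.
move=> nu; rewrite /lim /lim_in xgetPN// => l ul.
by apply: nu; apply/cvg_ex; exists l.
Qed.

Lemma cvgn_cauchyP (u : R^nat) : cvgn u <->
  forall j, exists N, forall a b, (N <= a)%N -> (N <= b)%N -> `|u a - u b| < j.+1%:R^-1.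
Proof.
split.
  move=> /cvg_ex[l ul] j.
  have j0 : 0 < j.+1%:R^-1 / 2 :> R by rewrite divr_gt0.
  have /cvgrPdist_lt /(_ _ j0)[N _ NP] := ul.
  exists N => a b Na Nb; rewrite (le_lt_trans (ler_distD l _ _))// (splitr _^-1).
  by rewrite ltrD//; [rewrite distrC|]; exact: NP.
move=> h; apply: R_complete; apply: cauchy_exP => e e0.
have [j je] := ltr_add_invr e0; rewrite add0r in je.
have [N NP] := h j; exists (u N); exists N => // k /= Nk.
by rewrite /ball/= (lt_trans _ je)// NP.
Qed.

(** The set of convergence is measurable, by Cauchy's criterion, and off this
    set the limit operator has the value 0. *)
Lemma measurable_limn (d : measure_display) (T : measurableType d) (u : (T -> R)^nat) :
  (forall k, measurable_fun setT (u k)) ->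
  measurable_fun setT (fun t : T => limn (u ^~ t)).
Proof.
move=> mu.
pose C : set T := \bigcap_j \bigcup_N \bigcap_(a in [set a | N <= a]%N)
   \bigcap_(b in [set b | N <= b]%N) [set t : T | `|u a t - u b t| < j.+1%:R^-1].
have mC : measurable C.
  apply: bigcap_measurableType => j _; apply: bigcup_measurable => N _.
  apply: bigcap_measurableType => a _; apply: bigcap_measurableType => b _.
  have mab : measurable_fun setT (fun t : T => `|u a t - u b t|).
    by apply: measurableT_comp => //; exact: measurable_funB.
  rewrite -[X in measurable X]setTI.
  have := mab measurableT `]-oo, j.+1%:R^-1[%classic (measurable_itv _).
  by congr measurable; apply/seteqP; split => t /=; rewrite in_itv/=.
have CP (t : T) : C t <-> cvgn (u ^~ t).
  rewrite cvgn_cauchyP; split=> [Ct j|h j _].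
    by have [N _ h] := Ct j I; exists N => a b Na Nb; exact: h.
  by have [N NP] := h j; exists N => // a Na b Nb; exact: NP.
(* Truncated to the set of convergence, the sequence converges everywhere, and
   to the required limit. *)
apply: (@measurable_fun_cvg _ T R setT (fun k => (u k) \_ C)).
  by move=> k; apply/(measurable_restrictT _ mC); exact: measurable_funTS.
move=> t _; have [Ct|nCt] := pselect (C t).
  rewrite (_ : (fun k => _) = u ^~ t); first exact/CP.
  by apply/funext => k; rewrite patchE mem_set.
rewrite limn_dvg; last by move=> /CP.
rewrite (_ : (fun k => _) = cst 0); first exact: cvg_cst.
by apply/funext => k; rewrite patchE memNset.
Qed.

Lemma measurable_invr : measurable_fun setT (@GRing.inv R).
Proof.
have m0 : measurable [set (0 : R)] by exact: measurable_set1.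
rewrite -(setvU [set (0 : R)]); apply/measurable_funU => //; first exact: measurableC.
split; last exact: measurable_fun_set1.
apply: open_continuous_measurable_fun.
  by apply: closed_openC; exact: closed_eq.
by move=> t /set_mem /= /eqP t0; exact: inv_continuous.
Qed.

Lemma measurable_near_diagonal r :
  measurable [set p : 'rV[R]_n * 'rV[R]_n | eball p.1 r p.2].
Proof.
have mE : measurable_fun setT (fun p : 'rV[R]_n * 'rV[R]_n => enorm (p.2 - p.1)).
  apply: (measurableT_comp (f := @Num.sqrt R)).
    by apply: continuous_measurable_fun; exact: sqrt_continuous.
  rewrite /dotr; apply: measurable_sum => i.
  have mi : measurable_fun setT (fun p : 'rV[R]_n * 'rV[R]_n => (p.2 - p.1) 0 i).
    under eq_fun do rewrite !mxE.
    apply: measurable_funB.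
      by apply: (measurableT_comp (measurable_coord i)).
    by apply: (measurableT_comp (measurable_coord i)).
  exact: measurable_funM.
have := mE measurableT `]-oo, r[%classic (measurable_itv _).
by rewrite setTI; congr measurable; apply/seteqP; split => p /=; rewrite in_itv.
Qed.

(** The integral over a ball with variable centre is the integral of a section
    of a function of two points, restricted to the pairs at distance less than
    [r]; the theorem of Fubini and Tonelli provides measurability for the
    positive and the negative part. *)
Lemma measurable_ball_integral r D f : measurable D -> measurable_fun D f ->
  measurable_fun setT (fun x => \int[leb]_(y in eball x r `&` D) f y).
Proof.
move=> mD mf; apply: (measurableT_comp (f := fine)); first exact: fine_measurable.
pose E := [set p : 'rV[R]_n * 'rV[R]_n | eball p.1 r p.2].
have mE : measurable E := measurable_near_diagonal r.
have mfD : measurable_fun setT ((EFin \o f) \_ D).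
  by apply/(measurable_restrictT _ mD); exact/measurable_EFinP.
have part (g : 'rV[R]_n -> \bar R) : measurable_fun setT g -> (forall y, 0 <= g y)%E ->
    measurable_fun setT (fun x => \int[leb]_(y in eball x r) g y)%E.
  move=> mg g0; pose h (p : 'rV[R]_n * 'rV[R]_n) := ((g \o snd) \_ E) p.
  have mh : measurable_fun setT h.
    apply/(measurable_restrictT _ mE); apply: measurable_funTS.
    by apply: (measurableT_comp mg).
  have h0 p : (0 <= h p)%E by rewrite /h patchE; case: ifP => // _; exact: g0.
  have := @measurable_fun_fubini_tonelli_F _ _ _ _ _ leb h mh h0.
  congr measurable_fun; apply/funext => x; rewrite [RHS]integral_mkcond.
  apply: eq_integral => y _; rewrite /h !patchE /=; congr (if _ then _ else _).
rewrite (_ : (fun x => _) = (fun x =>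
    \int[leb]_(y in eball x r) ((EFin \o f) \_ D)^\+ y -
    \int[leb]_(y in eball x r) ((EFin \o f) \_ D)^\- y)%E); last first.
  by apply/funext => x; rewrite integral_mkcondr integralE.
apply: emeasurable_funB; apply: part => //.
- exact: measurable_funepos.
- exact: measurable_funeneg.
Qed.

Lemma measurable_trace D f : measurable D -> measurable_fun D f ->
  measurable_fun setT (trace D f).
Proof.
move=> mD mf; apply: (@measurable_limn _ _
    (fun k x => let B := eball x k.+1%:R^-1 `&` D in
      (\int[leb]_(y in B) f y) / fine (leb B))) => k /=.
apply: measurable_funM; first exact: measurable_ball_integral.
apply: (measurableT_comp (f := @GRing.inv R)); first exact: measurable_invr.
rewrite (_ : (fun x => _) =
    (fun x => \int[leb]_(y in eball x k.+1%:R^-1 `&` D) (cst 1 : 'rV[R]_n -> R) y)).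
  by apply: measurable_ball_integral.
apply/funext => x; rewrite Rintegral_cst ?mul1r//.
by apply: measurableI => //; apply: open_measurable_rV; exact: eball_open.
Qed.

(** Each mean is bounded by [M], so the limit is too; if the means diverge, the
    trace is 0, and if a ball has a null intersection with [D], the quotient is
    0. *)
Lemma trace_le D f M x : measurable D -> (leb D < +oo)%E -> measurable_fun D f ->
  0 <= M -> {ae leb, forall y, D y -> `|f y| <= M} -> `|trace D f x| <= M.
Proof.
move=> mD Doo mf M0 fM; rewrite /trace; set u := (X in limn X).
have uM k : `|u k| <= M.
  rewrite /u /=; set B := _ `&` D.
  have mB : measurable B by apply: measurableI => //; apply: open_measurable_rV; exact: eball_open.
  have BD : B `<=` D by move=> ? [].
  have Boo : (leb B < +oo)%E by apply: le_lt_trans Doo; apply: le_measure; rewrite ?inE.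
  have Bfin : leb B \is a fin_num by rewrite ge0_fin_numE.
  rewrite normrM normfV [X in _ / X]ger0_norm ?fine_ge0//.
  have [->|B0] := eqVneq (fine (leb B)) 0; first by rewrite invr0 mulr0.
  rewrite ler_pdivrMr; last by rewrite lt_def B0 fine_ge0.
  have h : (\int[leb]_(y in B) `|(f y)%:E| <= M%:E * leb B)%E.
    apply: integral_le_bound => //.
    - by apply/measurable_EFinP; exact: measurable_funS mf.
    - by apply: filterS fM => y fy By; rewrite lee_fin; apply: fy; exact: BD.
  have iB : leb.-integrable B (EFin \o f).
    apply/integrableP; split; first by apply/measurable_EFinP; exact: measurable_funS mf.
    by apply: le_lt_trans h _; rewrite -(fineK Bfin) -EFinM ltry.
  rewrite (le_trans (le_normr_Rintegral _ _))//.
  rewrite /Rintegral -lee_fin EFinM !fineK//.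
  exact: integrable_fin_num (integrable_abse iB).
have [cu|/limn_dvg ->] := pselect (cvgn u); last by rewrite normr0.
rewrite ler_norml; apply/andP; split.
  by apply: limr_ge => //; apply: nearW => k; have := uM k; rewrite ler_norml => /andP[].
by apply: limr_le => //; apply: nearW => k; have := uM k; rewrite ler_norml => /andP[].
Qed.

End traces.

(** * Measurability of the outward normal *)

Section outward_normal.
Context {R : realType} {n : nat}.
Implicit Types (D : set 'rV[R]_n) (x y q nu : 'rV[R]_n).

(** The condition on the outward normal for one [eps] and one radius, with the
    vector allowed to have any length; this closed set of base points is the
    building block of the measurability proof. *)
Definition cone_separated D (eps r : R) q : set 'rV[R]_n :=
  [set x | forall y, eball x r y ->
    (dotr (y - x) q < - eps * enorm (y - x) -> D y) /\
    (eps * enorm (y - x) < dotr (y - x) q -> ~ D y)].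

(** Both conditions say that [x] avoids certain open sets, one for each point
    [y] of [D] or of its complement. *)
Lemma measurable_cone_separated D eps r q : measurable (cone_separated D eps r q).
Proof.
apply: closed_measurable_rV.
pose U y : set 'rV[R]_n := [set x | eball x r y] `&`
  [set x | dotr (y - x) q < - eps * enorm (y - x)].
pose V y : set 'rV[R]_n := [set x | eball x r y] `&`
  [set x | eps * enorm (y - x) < dotr (y - x) q].
have -> : cone_separated D eps r q =
    \bigcap_(y in ~` D) ~` U y `&` \bigcap_(y in D) ~` V y.
  apply/seteqP; split => x.
    by move=> h; split => y Dy [xy hy]; have [h1 h2] := h y xy; [exact: Dy (h1 hy)|exact: h2 hy Dy].
  move=> [hU hV] y xy; split => hy; last by move=> Dy; exact: (hV y Dy).
  by apply: contrapT => Dy; exact: (hU y Dy).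
have cE y : continuous (fun x : 'rV[R]_n => enorm (y - x)).
  by under eq_fun do rewrite enormC; exact: continuous_enormB.
have cD y : continuous (fun x : 'rV[R]_n => dotr (y - x) q).
  under eq_fun do rewrite dotrBl.
  apply: continuous_add; first exact: cst_continuous.
  by apply: continuous_opp; exact: continuous_dotr.
have oB y : open [set x : 'rV[R]_n | eball x r y].
  have -> : [set x : 'rV[R]_n | eball x r y] = eball y r.
    by apply/seteqP; split => x; rewrite /eball /= enormC.
  exact: eball_open.
apply: closedI; apply: closed_bigI => y _; apply: open_closedC; apply: openI => //.
  rewrite (_ : [set x | _] = [set x | dotr (y - x) q + eps * enorm (y - x) < 0]).
    apply: open_lt_rV; apply: continuous_add => //.
    by apply: continuous_mul => //; exact: cst_continuous.
  by apply/seteqP; split => x /=; rewrite mulNr; lra.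
rewrite (_ : [set x | _] = [set x | eps * enorm (y - x) + - dotr (y - x) q < 0]).
  apply: open_lt_rV; apply: continuous_add; last exact: continuous_opp.
  by apply: continuous_mul => //; exact: cst_continuous.
by apply/seteqP; split => x /=; lra.
Qed.

Lemma rat_dense_rV nu (e : R) : 0 < e ->
  exists q : 'rV[rat]_n, enorm ((\row_i (ratr (q 0 i) : R)) - nu) < e.
Proof.
move=> e0.
have [r r0 rP] : exists2 r : R, 0 < r &
    forall y, (forall i, `|nu 0 i - y 0 i| < r) -> eball nu e y.
  by apply/near_box_rV; apply/near_eball_rV; exists e.
have [q qP] := rat_near_rV nu r0; exists q.
by apply: rP => i; rewrite mxE distrC.
Qed.

(** If the normals were distinct, moving from [x] in the direction of their
    difference would lead both inside and outside of [D]. *)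
Lemma is_outward_normal_inj D x nu nu' :
  is_outward_normal D x nu -> is_outward_normal D x nu' -> nu = nu'.
Proof.
move=> [n1 h] [n1' h']; apply/eqP; rewrite -subr_eq0; apply/negPn/negP => z0.
set z := nu - nu' in z0.
have s0 : 0 < enorm z.
  by rewrite lt_def enorm_ge0 andbT; apply: contra z0 => /eqP/enorm_eq0 ->.
have e0 : 0 < enorm z / 4 by rewrite divr_gt0.
have [r r0 rP] := h _ e0; have [r' r0' rP'] := h' _ e0.
have [a1 a2] : dotr nu nu = 1 /\ dotr nu' nu' = 1.
  by rewrite -!sqr_enorm n1 n1' expr1n.
have zz := sqr_enorm z.
have zn : dotr z nu = enorm z ^+ 2 / 2.
  by rewrite zz /z !(dotrBl, dotrBr) (dotrC nu' nu) a1 a2; lra.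
have zn' : dotr z nu' = - (enorm z ^+ 2 / 2).
  by rewrite zz /z !(dotrBl, dotrBr) (dotrC nu' nu) a1 a2; lra.
pose t := Num.min r r' / (2 * enorm z).
have m0 : 0 < Num.min r r' by rewrite lt_min r0.
have t0 : 0 < t by rewrite divr_gt0// mulr_gt0.
have tz : enorm (t *: z) < Num.min r r'.
  rewrite enormZ gtr0_norm// /t invfM mulrA mulfVK ?gt_eqF//.
  by rewrite ltr_pdivrMr// ltr_pMr// ltr1n.
have yx : x + t *: z - x = t *: z by rewrite addrAC subrr add0r.
have br : eball x r (x + t *: z).
  by rewrite /eball /= yx (lt_le_trans tz)// ge_min lexx.
have br' : eball x r' (x + t *: z).
  by rewrite /eball /= yx (lt_le_trans tz)// ge_min lexx orbT.
have [_ nD] := rP _ br; have [yD _] := rP' _ br'.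
rewrite yx dotrZl enormZ gtr0_norm// zn in nD.
rewrite yx dotrZl enormZ gtr0_norm// zn' in yD.
have t2 : 0 < t * enorm z ^+ 2 by rewrite mulr_gt0// exprn_gt0.
by apply: nD; [lra|apply: yD; lra].
Qed.

(** The existence of a normal with a bounded coordinate, expressed by countably
    many conditions on rational vectors. Conversely, rational vectors that
    satisfy the condition for every [k] are bounded, and a cluster point of them
    is the normal. *)
Lemma is_outward_normal_approx D x i (c : R) :
  (exists2 nu, is_outward_normal D x nu & nu 0 i <= c) <->
  forall k : nat, exists j : nat, exists q : 'rV[rat]_n,
    let v := \row_i (ratr (q 0 i) : R) in
    [/\ `|enorm v - 1| < k.+1%:R^-1, v 0 i < c + k.+1%:R^-1 &
        cone_separated D k.+1%:R^-1 j.+1%:R^-1 v x].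
Proof.
split.
  move=> [nu [n1 h] nc] k.
  have : 0 < k.+1%:R^-1 :> R by [].
  move: (k.+1%:R^-1 : R) => e k0.
  have k20 : 0 < e / 2 :> R by rewrite divr_gt0.
  have [r r0 rP] := h _ k20.
  have [j jr] := ltr_add_invr r0; rewrite add0r in jr; exists j.
  have [q qn] := rat_dense_rV nu k20; exists q.
  set v := \row__ _ in qn *.
  have kk : e / 2 < e by rewrite ltr_pdivrMr// ltr_pMr// ltr1n.
  split.
  - rewrite (lt_trans _ kk)// (le_lt_trans _ qn)// -n1 ler_norml.
    have := ler_enormD (v - nu) nu; have := ler_enormD (nu - v) v.
    rewrite !subrK (enormC nu v) => ? ?; apply/andP; split; lra.
  - have := le_lt_trans (coord_le_enorm (v - nu) i) qn.
    have -> : (v - nu) 0 i = v 0 i - nu 0 i by rewrite [LHS]mxE [X in _ + X]mxE.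
    rewrite ltr_norml => /andP[_]; rewrite ltrBlDl => hv.
    by rewrite (lt_le_trans hv)// lerD// ltW.
  - move=> y xy; have [h1 h2] := rP y (lt_trans xy jr).
    have := ler_abs_dotr (y - x) (v - nu); rewrite dotrBr ler_norml => /andP[b1 b2].
    have b3 : enorm (y - x) * enorm (v - nu) <= enorm (y - x) * (e / 2).
      by rewrite ler_wpM2l ?enorm_ge0// ltW.
    by split => hy; [apply: h1|apply: h2]; move: b1 b2 b3 hy; lra.
move=> /choice[j /choice[q qP]].
pose v k : 'rV[R]_n := \row_i (ratr (q k 0 i) : R).
have cA := @compact_ccube R n 2.
have v2 k : enorm (v k) <= 2.
  have [+ _ _] := qP k; rewrite -/(v k) ltr_norml => /andP[_ h].
  have k1 : k.+1%:R^-1 <= 1 :> R by rewrite invf_le1// ler1n.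
  by have := lt_le_trans h k1; lra.
have vF : (v @ \oo) (ccube 2).
  by exists 0%N => // k _; apply/ccubeP => l; exact: le_trans (coord_le_enorm _ _) (v2 k).
have [nu [_ clnu]] := cA _ _ vF.
have near_nu (e : R) : 0 < e -> exists k : nat,
    [/\ enorm (v k - nu) < e, k.+1%:R^-1 < e & k.+1%:R^-1 < e].
  move=> e0; have [N Ne] := ltr_add_invr e0; rewrite add0r in Ne.
  have A1 : (v @ \oo) [set w | exists2 k, (N <= k)%N & w = v k].
    by exists N => // k /= Nk; exists k.
  have B1 : nbhs nu (eball nu e) by apply/near_eball_rV; exists e.
  have [w [[k Nk ->] kB]] := clnu _ _ A1 B1.
  have ke : k.+1%:R^-1 < e.
    by apply: le_lt_trans Ne; rewrite lef_pV2 ?posrE// ler_nat.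
  by exists k.
exists nu.
  split.
    apply/eqP; rewrite -subr_eq0 -normr_le0; apply/ler_addgt0Pr => e e0; rewrite add0r.
    have e20 : 0 < e / 2 by rewrite divr_gt0.
    have [k [k1 k2 _]] := near_nu _ e20; have [k3 _ _] := qP k.
    have := ler_enormD (v k - nu) nu; have := ler_enormD (nu - v k) (v k).
    rewrite !subrK (enormC nu (v k)) => h1 h2.
    move: (k.+1%:R^-1 : R) k2 k3 => k' k2 k3; move: k3; rewrite -/(v k) ltr_norml ler_norml => /andP[h3 h4].
    by apply/andP; split; lra.
  move=> e e0; have e20 : 0 < e / 2 by rewrite divr_gt0.
  have [k [k1 k2 _]] := near_nu _ e20; have [_ _ k3] := qP k.
  exists (j k).+1%:R^-1 => // y xy; have [h1 h2] := k3 y xy.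
  have := ler_abs_dotr (y - x) (v k - nu); rewrite dotrBr ler_norml => /andP[b1 b2].
  have b3 : enorm (y - x) * enorm (v k - nu) <= enorm (y - x) * (e / 2).
    by rewrite ler_wpM2l ?enorm_ge0// ltW.
  have b4 : enorm (y - x) * k.+1%:R^-1 <= enorm (y - x) * (e / 2).
    by rewrite ler_wpM2l ?enorm_ge0// ltW.
  move: (k.+1%:R^-1 : R) b4 h1 h2 => k' b4 h1 h2.
  by split => hy; [apply: h1|apply: h2]; move: b1 b2 b3 b4 hy; rewrite -/(v k); lra.
apply/ler_addgt0Pr => e e0; have e20 : 0 < e / 2 by rewrite divr_gt0.
have [k [k1 k2 _]] := near_nu _ e20; have [_ k3 _] := qP k.
have := le_lt_trans (coord_le_enorm (v k - nu) i) k1.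
have -> : (v k - nu) 0 i = v k 0 i - nu 0 i by rewrite [LHS]mxE [X in _ + X]mxE.
rewrite ltr_norml => /andP[h _]; move: k3; rewrite -/(v k).
by move: (k.+1%:R^-1 : R) k2 => k'; lra.
Qed.

(** Sublevel sets of a coordinate are countable combinations of the closed sets
    [cone_separated]; the points without a normal, where the value is 0, form
    the complement of [E 1], because a unit vector has coordinates at most 1. *)
Lemma measurable_outward_normal D i :
  measurable_fun setT (fun x => outward_normal D x 0 i).
Proof.
pose E c := [set x | exists2 nu, is_outward_normal D x nu & nu 0 i <= c].
have mE c : measurable (E c).
  rewrite (_ : E c = \bigcap_k \bigcup_j \bigcup_(q in [set q : 'rV[rat]_n |
      `|enorm (\row_i (ratr (q 0 i) : R)) - 1| < k.+1%:R^-1 /\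
      (\row_i (ratr (q 0 i) : R)) 0 i < c + k.+1%:R^-1])
      cone_separated D k.+1%:R^-1 j.+1%:R^-1 (\row_i (ratr (q 0 i) : R))); last first.
    apply/seteqP; split => x.
      move=> /is_outward_normal_approx h k _; have [j [q [q1 q2 q3]]] := h k.
      by exists j => //; exists q.
    move=> h; apply/is_outward_normal_approx => k.
    by have [j _ [q [q1 q2] q3]] := h k I; exists j, q.
  apply: bigcap_measurableType => k _; apply: bigcup_measurable => j _.
  apply: countType_bigcup_measurable => q _; exact: measurable_cone_separated.
have le1 nu : enorm nu = 1 -> nu 0 i <= 1.
  by move=> <-; rewrite (le_trans (ler_norm _))// coord_le_enorm.
have EE c : [set x | outward_normal D x 0 i <= c] =
    E c `|` (if 0 <= c then ~` E 1 else set0).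
  apply/seteqP; split => x /=; rewrite /outward_normal.
    case: xgetP => [nu _ nuP nc|nP].
      by left; exists nu.
    rewrite mxE => c0; right; rewrite c0 => -[nu nuP _].
    exact: nP nu nuP.
  case=> [[nu nuP nc]|].
    by rewrite (@xget_unique _ 0 _ nu)// => y yP; exact: is_outward_normal_inj yP nuP.
  case: ifP => // c0 nE; rewrite xgetPN ?mxE// => nu nuP.
  by apply: nE; exists nu => //; apply: le1; case: nuP.
apply: (measurability _ (@measurable_realfun.RGenOInfty.measurableE R)) => //.
move=> _ [_ [c ->] <-]; rewrite setTI.
rewrite (_ : _ @^-1` _ = ~` [set x | outward_normal D x 0 i <= c]).
  apply: measurableC; rewrite EE; apply: measurableU => //.
  by case: ifP => // _; exact: measurableC.
by apply/seteqP; split => x /=; rewrite in_itv/= andbT ltNge => /negP.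
Qed.

End outward_normal.

(** * Upper bounds for the Hausdorff measure *)

Section hausdorff_bound.
Context {R : realType} {n : nat}.
Implicit Types (x y a : 'rV[R]_n).

Definition ecball a (r : R) : set 'rV[R]_n := [set y | enorm (y - a) <= r].

Lemma measurable_ecball a r : measurable (ecball a r).
Proof.
apply: closed_measurable_rV; rewrite -[ecball a r]setCK; apply: open_closedC.
rewrite (_ : ~` _ = (fun y => enorm (y - a)) @^-1` [set t | r < t]).
  by apply: open_comp; [move=> y _; exact: continuous_enormB|exact: open_gt].
by apply/seteqP; split => y /=; rewrite /ecball /= ltNge => /negP.
Qed.

Lemma hausdorff_gauge_ecball s (dlt : R) a r : 0 <= r -> 2 * r <= dlt ->
  (hausdorff_gauge s dlt (ecball a r) <=
   (unit_ball_volume s / 2 ^+ s * (2 * r) ^+ s)%:E)%E.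
Proof.
move=> r0 rd; rewrite /hausdorff_gauge; case: asboolP => [_|_].
  by rewrite lee_fin mulr_ge0 ?exprn_ge0 ?divr_ge0 ?unit_ball_volume_ge0 ?mulr_ge0.
have dr : (ediam (ecball a r) <= (2 * r)%:E)%E.
  apply: ge_ereal_sup => _ [x xa [y ya <-]]; rewrite lee_fin.
  rewrite (le_trans (ler_enorm_dist a _ _))// mulr_natl mulr2n lerD//.
  by rewrite enormC.
have aa : ecball a r a by rewrite /ecball /= subrr enorm0.
have d0 : (0 <= ediam (ecball a r))%E by apply: ediam_ge0; exists a.
rewrite (le_trans dr) ?lee_fin//.
have fd : ediam (ecball a r) \is a fin_num.
  by rewrite ge0_fin_numE// (le_lt_trans dr)// ltry.
rewrite -(fineK fd) -EFin_expe -EFinM lee_fin ler_wpM2l//.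
  by rewrite divr_ge0 ?unit_ball_volume_ge0 ?exprn_ge0.
rewrite lerXn2r ?nnegrE ?fine_ge0// ?mulr_ge0//.
by rewrite -lee_fin fineK.
Qed.

(** The outer measure takes sequences of sets; a finite family is completed by
    the empty set. *)
Lemma mu_ext_finite_cover (g : set 'rV[R]_n -> \bar R) (S : set 'rV[R]_n)
    (I : finType) (F : I -> set 'rV[R]_n) (b : R) :
  (forall A, 0 <= g A)%E -> g set0 = 0%E -> 0 <= b ->
  (forall i, measurable (F i)) -> (forall i, g (F i) <= b%:E)%E ->
  S `<=` \bigcup_i F i -> (mu_ext g S <= (#|I|%:R * b)%:E)%E.
Proof.
move=> g0 gset0 b0 mF Fb SF.
pose G (k : nat) : set 'rV[R]_n := nth set0 [seq F i | i <- enum I] k.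
have sz : size [seq F i | i <- enum I] = #|I| by rewrite size_map -cardE.
have Gb k : (g (G k) <= (if (k < #|I|)%N then b%:E else 0))%E.
  rewrite /G; case: ltnP => kI; last by rewrite nth_default ?sz// gset0.
  have [i _ ->] : exists2 i, i \in enum I & nth set0 [seq F i | i <- enum I] k = F i.
    by apply/mapP; apply: mem_nth; rewrite sz.
  exact: Fb.
apply: (@le_trans _ _ (\sum_(k <oo) g (G k))%E).
  apply: ereal_inf_lbound; exists G => //; split.
    move=> k; rewrite /G; have [kI|kI] := ltnP k #|I|; last by rewrite nth_default ?sz.
    have [i _ ->] : exists2 i, i \in enum I & nth set0 [seq F i | i <- enum I] k = F i.
      by apply/mapP; apply: mem_nth; rewrite sz.
    exact: mF.
  move=> x /SF[i _ Fx]; exists (index i (enum I)) => //.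
  rewrite /G (nth_map i); last by rewrite index_mem mem_enum.
  by rewrite nth_index// mem_enum.
apply: lime_le; first by apply: is_cvg_nneseries.
apply: nearW => N.
apply: (@le_trans _ _ ((minn N #|I|)%:R * b)%:E); last first.
  by rewrite lee_fin ler_wpM2r// ler_nat geq_minr.
elim: N => [|N IH]; first by rewrite big_geq// min0n mul0r.
rewrite big_nat_recr//=; apply: le_trans (leeD IH (Gb N)) _.
case: ltnP => NI; rewrite -?EFinD ?adde0 lee_fin.
  by rewrite (minn_idPl NI) -[N.+1%:R]natr1 mulrDl mul1r.
by rewrite (minn_idPr (leqW NI)) addr0.
Qed.

Lemma grid_cell (N : nat) (w t : R) : 0 <= w -> 0 <= t -> t <= N.+1%:R * w ->
  exists j : 'I_N.+1, j%:R * w <= t <= j.+1%:R * w.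
Proof.
move=> w0 t0; elim: N => [|N IH] tN.
  by exists ord0; rewrite mul0r t0.
have [/IH[j jP]|Nt] := leP t (N.+1%:R * w); last first.
  by exists ord_max; rewrite /= (ltW Nt).
by exists (widen_ord (leqnSn _) j).
Qed.

(** If [P] is expanding up to the factor [L], a grid of [N ^ s] boxes in the
    image cuts [S] into pieces of diameter [L * l / N]. *)
Lemma hausdorff_le_expanding s (S : set 'rV[R]_n) (P : 'rV[R]_n -> 'I_s -> R)
    (c : 'I_s -> R) (l L : R) : 0 <= l -> 0 <= L ->
  (forall x y (b : R), S x -> S y -> 0 <= b -> (forall k, `|P x k - P y k| <= b) ->
    enorm (x - y) <= L * b) ->
  (forall x k, S x -> c k <= P x k <= c k + l) ->
  (hausdorff s S <= (unit_ball_volume s * (L * l) ^+ s)%:E)%E.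
Proof.
move=> l0 L0 PL Pl; apply: ge_ereal_sup => _ [dlt d0 <-].
have Ll0 : 0 <= L * l by exact: mulr_ge0.
(* A grid fine enough for the covering balls to be admissible for the gauge. *)
have [N Nd] : exists N : nat, 2 * (L * (l / N.+1%:R)) <= dlt.
  have p0 : 0 < 2 * (L * l) + 1 by rewrite ltr_wpDl// mulr_ge0.
  have [N] := ltr_add_invr (divr_gt0 d0 p0); rewrite add0r => Nd; exists N.
  apply: (@le_trans _ _ ((2 * (L * l) + 1) * (dlt / (2 * (L * l) + 1)))).
    rewrite (_ : 2 * _ = (2 * (L * l)) * N.+1%:R^-1); last by rewrite !mulrA.
    apply: ler_pM.
    - by rewrite mulr_ge0.
    - by rewrite invr_ge0.
    - by rewrite lerDl.
    - exact: ltW.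
  by rewrite mulrC divfK ?gt_eqF.
pose w := l / N.+1%:R.
have w0 : 0 <= w by rewrite divr_ge0.
have Lw0 : 0 <= L * w by rewrite mulr_ge0.
pose cell (j : {ffun 'I_s -> 'I_N.+1}) : set 'rV[R]_n :=
  [set x | S x /\ forall k, c k + (j k)%:R * w <= P x k <= c k + (j k).+1%:R * w].
pose F j : set 'rV[R]_n := if pselect (exists x, cell j x) is left h
  then ecball (projT1 (cid h)) (L * w) else set0.
have -> : unit_ball_volume s * (L * l) ^+ s = #|{ffun 'I_s -> 'I_N.+1}|%:R *
    (unit_ball_volume s / 2 ^+ s * (2 * (L * w)) ^+ s).
  rewrite card_ffun !card_ord natrX /w !exprMn exprVn; field.
  by rewrite ?expf_neq0//= ?pnatr_eq0.
apply: (mu_ext_finite_cover (F := F)).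
- exact: hausdorff_gauge_ge0.
- exact: hausdorff_gauge0.
- by rewrite mulr_ge0 ?exprn_ge0 ?divr_ge0 ?unit_ball_volume_ge0 ?exprn_ge0 ?mulr_ge0.
- by move=> j; rewrite /F; case: pselect => [h|_] //; exact: measurable_ecball.
- move=> j; rewrite /F; case: pselect => [h|_]; first exact: hausdorff_gauge_ecball.
  rewrite hausdorff_gauge0 lee_fin.
  by rewrite mulr_ge0 ?exprn_ge0 ?divr_ge0 ?unit_ball_volume_ge0 ?exprn_ge0 ?mulr_ge0.
move=> x Sx.
have j_ k : exists j : 'I_N.+1, c k + j%:R * w <= P x k <= c k + j.+1%:R * w.
  have /andP[h1 h2] := Pl x k Sx.
  have [||j jP] := @grid_cell N w (P x k - c k) w0.
  - by rewrite subr_ge0.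
  - by rewrite /w mulrC divfK ?pnatr_eq0// lerBlDl.
  by exists j; move: jP => /andP[a1 a2]; apply/andP; split; lra.
have [j jP] := choice j_; exists [ffun k => j k] => //; rewrite /F.
have xcell : cell [ffun k => j k] x by split => // k; rewrite ffunE.
case: pselect => [h|]; last by case; exists x.
case: (cid h) => y [Sy yP] /=; rewrite /ecball /=; apply: PL => // k.
have /andP[a1 a2] := jP k; have := yP k; rewrite ffunE => /andP[b1 b2].
move: a1 a2 b1 b2; rewrite -[(j k).+1%:R]natr1 mulrDl mul1r ler_norml.
by move=> *; apply/andP; split; lra.
Qed.

End hausdorff_bound.

(** * Graphs over hyperplanes *)

Section surfaces.
Context {R : realType} {n : nat}.
Implicit Types (x y z nu : 'rV[R]_n.+1) (S D : set 'rV[R]_n.+1).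

(** Orthogonal projection to the hyperplane with unit normal [nu]. *)
Definition hproj nu x : 'rV[R]_n.+1 := x - dotr x nu *: nu.

Lemma hprojB nu x y : hproj nu (x - y) = hproj nu x - hproj nu y.
Proof. by apply/rowP => i; rewrite /hproj dotrBl !mxE; ring. Qed.

Lemma dotr_hproj nu x : enorm nu = 1 -> dotr (hproj nu x) nu = 0.
Proof.
by move=> n1; rewrite /hproj dotrBl dotrZl -sqr_enorm n1 expr1n mulr1 subrr.
Qed.

Lemma enorm_hproj_le nu x : enorm nu = 1 -> enorm (hproj nu x) <= 2 * enorm x.
Proof.
move=> n1; rewrite /hproj (le_trans (ler_enormD _ _))// enormN enormZ n1 mulr1.
by have := ler_abs_dotr x nu; rewrite n1 mulr1; lra.
Qed.

Lemma max_coord nu : exists k, forall j, `|nu 0 j| <= `|nu 0 k|.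
Proof.
exists [arg max_(k > ord0) `|nu 0 k|]%O => j.
by case: Order.TotalTheory.arg_maxP => // i _; apply.
Qed.

(** On the hyperplane orthogonal to [nu], the coordinate where [nu] is largest
    is controlled by the others; dropping it gives [n] coordinates of the
    hyperplane without an orthonormal basis. *)
Lemma enorm_le_offdiag nu (u : 'rV[R]_n.+1) k (b : R) : nu != 0 ->
  (forall j, `|nu 0 j| <= `|nu 0 k|) -> dotr u nu = 0 ->
  (forall j, `|u 0 (lift k j)| <= b) -> enorm u <= 2 * n%:R * b.
Proof.
move=> nu0 kmax u0 ub.
have nk : 0 < `|nu 0 k|.
  rewrite normr_gt0; apply: contra nu0 => /eqP nk0; apply/eqP/rowP => j.
  by apply/eqP; rewrite mxE -normr_le0 (le_trans (kmax j))// nk0 normr0.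
have S0 : \sum_j `|u 0 (lift k j)| <= n%:R * b.
  apply: (@le_trans _ _ (\sum_(j < n) b)); first by apply: ler_sum => j _.
  by rewrite sumr_const card_ord mulr_natl.
have uk : `|u 0 k| <= \sum_j `|u 0 (lift k j)|.
  rewrite -(ler_pM2r nk) -normrM.
  have -> : u 0 k * nu 0 k = - \sum_j u 0 (lift k j) * nu 0 (lift k j).
    move: u0; rewrite /dotr (bigD1_ord k)//= => /eqP.
    by rewrite addr_eq0 => /eqP ->.
  rewrite normrN (le_trans (ler_norm_sum _ _ _))// mulr_suml ler_sum// => j _.
  by rewrite normrM ler_wpM2l.
rewrite (le_trans (enorm_le_sum _))// (bigD1_ord k)//=.
by rewrite (le_trans (lerD uk (lexx _)))//; lra.
Qed.

(** If the projection along [nu] shrinks distances in [S] at most by the factor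
    [M], the coordinates of the projection other than the largest one of [nu]
    form a map that satisfies [hausdorff_le_expanding]. *)
Lemma hausdorff_graph nu S z (M h : R) : enorm nu = 1 -> 0 <= M -> 0 <= h ->
  (forall x y, S x -> S y -> enorm (x - y) <= M * enorm (hproj nu x - hproj nu y)) ->
  S `<=` ecball z h ->
  (hausdorff n S <= (unit_ball_volume n * (8 * n%:R * M) ^+ n * h ^+ n)%:E)%E.
Proof.
move=> n1 M0 h0 SM Sz; have [k kmax] := max_coord nu.
have nu0 : nu != 0.
  by apply/eqP => e; move: n1; rewrite e enorm0 => /eqP; rewrite eq_sym oner_eq0.
have -> : unit_ball_volume n * (8 * n%:R * M) ^+ n * h ^+ n =
    unit_ball_volume n * (2 * n%:R * M * (4 * h)) ^+ n.
  by rewrite -mulrA -exprMn; congr (_ * _ ^+ _); lra.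
apply: (@hausdorff_le_expanding _ _ n S (fun x j => hproj nu x 0 (lift k j))
   (fun j => hproj nu z 0 (lift k j) - 2 * h)).
- by rewrite mulr_ge0.
- by rewrite !mulr_ge0.
- move=> x y b Sx Sy b0 xy; rewrite (le_trans (SM _ _ Sx Sy))//.
  rewrite -mulrA [M * b]mulrC mulrA [_ * M]mulrC ler_wpM2l//.
  apply: (enorm_le_offdiag nu0 kmax).
    by rewrite -hprojB dotr_hproj.
  by move=> j; rewrite !mxE; have := xy j; rewrite !mxE.
- move=> x j Sx; have := coord_le_enorm (hproj nu (x - z)) (lift k j).
  have := enorm_hproj_le (x - z) n1; have := Sz x Sx; rewrite /ecball /=.
  rewrite hprojB => a1 a2; have -> : (hproj nu x - hproj nu z) 0 (lift k j) =
    hproj nu x 0 (lift k j) - hproj nu z 0 (lift k j) by rewrite [LHS]mxE [X in _ + X]mxE.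
  by rewrite ler_norml => /andP[a3 a4]; apply/andP; split; lra.
Qed.

Lemma hausdorff_in_hyperplane nu S z (h : R) : nu != 0 -> 0 <= h ->
  (forall x y, S x -> S y -> dotr (x - y) nu = 0) ->
  S `<=` ecball z h ->
  (hausdorff n S <= (unit_ball_volume n * (8 * n%:R) ^+ n * h ^+ n)%:E)%E.
Proof.
move=> nu0 h0 Snu Sz.
have en0 : 0 < enorm nu.
  by rewrite lt_def enorm_ge0 andbT; apply: contra nu0 => /eqP/enorm_eq0 ->.
rewrite -[8 * n%:R]mulr1; apply: (@hausdorff_graph ((enorm nu)^-1 *: nu)) Sz => //.
  by rewrite enormZ gtr0_norm ?invr_gt0// mulVf// gt_eqF.
move=> x y Sx Sy; rewrite mul1r -hprojB /hproj dotrZr Snu// mulr0 scale0r subr0.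
exact: lexx.
Qed.

Lemma hausdorff_seq_bigcup (I : eqType) (s : seq I) (A : I -> set 'rV[R]_n.+1)
    (b : I -> R) :
  (forall i, i \in s -> (hausdorff n (A i) <= (b i)%:E)%E) ->
  (hausdorff n (\bigcup_(i in [set` s]) A i) <= (\sum_(i <- s) b i)%:E)%E.
Proof.
elim: s => [|i s IH] Ab.
  rewrite big_nil (_ : \bigcup_(_ in _) _ = set0) ?hausdorff0//.
  by apply/seteqP; split => // x [].
rewrite big_cons EFinD.
apply: (@le_trans _ _ (hausdorff n (A i `|` \bigcup_(i in [set` s]) A i))).
  apply: le_hausdorff => x [j /=]; rewrite inE => /orP[/eqP ->|js] Ax; first by left.
  by right; exists j.
apply: le_trans (outer_measureU2 _ _ _) _; apply: leeD.
  by apply: Ab; rewrite mem_head.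
by apply: IH => j js; apply: Ab; rewrite inE js orbT.
Qed.

End surfaces.

(** * Surface measure of the interface *)

Section locally_lipschitz.
Context {R : realType} {n : nat}.
Implicit Types (x y u v : 'rV[R]_n).
Local Notation "''e_' i" := (delta_mx 0 i : 'rV[R]_n) (at level 8, i at level 2).

Lemma continuous_upd (f : 'rV[R]_n -> R) x i :
  continuous f -> continuous (fun t => f (upd_rV x i t)).
Proof.
move=> cf t; apply: (@continuous_comp _ _ _ (upd_rV x i) f); last exact: cf.
move=> A /near_box_rV[r r0 rA]; apply/nbhs_ballP; exists r => // s ts; apply: rA => j.
by rewrite !mxE; case: eqP => // _; rewrite subrr normr0.
Qed.

Lemma upd_le (f f' : 'rV[R]_n -> R) x i (B K s t : R) :
  continuous f -> (forall x, is_derive x 'e_i f (f' x)) ->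
  (forall y, ccube B y -> `|f' y| <= K) -> ccube B x -> `|s| <= B -> `|t| <= B ->
  `|f (upd_rV x i t) - f (upd_rV x i s)| <= K * `|t - s|.
Proof.
move=> cf df fK xB; wlog st : s t / s <= t.
  move=> h sB tB; have [st|/ltW ts] := leP s t; first exact: h.
  by rewrite distrC (distrC t); exact: h.
move=> sB tB.
have dg r : is_derive r (1 : R) (fun t => f (upd_rV x i t)) (f' (upd_rV x i r)).
  have := (is_derive_updP _ _ _ _).2 (df (upd_rV x i r)); rewrite mxE eqxx.
  rewrite (_ : (fun t => f (upd_rV (upd_rV x i r) i t)) = (fun t => f (upd_rV x i t)))//.
  apply/funext => t'; congr (f _); apply/rowP => j; rewrite !mxE.
  by case: eqP.
have [c cst ->] := MVT_segment st (fun r _ => dg r)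
  (continuous_subspaceT (@continuous_upd f x i cf)).
rewrite normrM ler_wpM2r//; apply: fK; apply/ccubeP => j; rewrite mxE.
case: eqP => _; last by move/ccubeP : xB; apply.
move: cst sB tB; rewrite in_itv/= !ler_norml => /andP[? ?] /andP[? ?] /andP[? ?].
by apply/andP; split; lra.
Qed.

(** Pass from [u] to [v] by changing one coordinate at a time: all intermediate
    points stay in the cube, so the mean value theorem in each coordinate
    applies with a bound of the partial derivatives on the cube. *)
Lemma class_C1_lipschitz (f : 'rV[R]_n -> R) (B : R) : class_C 1 f ->
  exists2 M : R, 0 <= M & forall u v, ccube B u -> ccube B v ->
    `|f u - f v| <= M * enorm (u - v).
Proof.
move=> [cf df].
have K_ i : exists K : R, 0 <= K /\ forall y, ccube B y -> `|'D_('e_i) f y| <= K.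
  have [_ cdf] := df i.
  have [K KP] := continuous_bounded_on_compact cdf (@compact_ccube R n B).
  by exists `|K|; split => // y yB; rewrite (le_trans (KP y yB))// ler_norm.
have [K KP] := choice K_; exists (\sum_i K i).
  by apply: sumr_ge0 => i _; have [] := KP i.
move=> u v uB vB.
pose w k : 'rV[R]_n := \row_j (if (j < k)%N then v 0 j else u 0 j).
have wB k : ccube B (w k).
  by apply/ccubeP => j; rewrite mxE; case: ifP => _; [move/ccubeP : vB|move/ccubeP : uB]; apply.
have step k (kn : (k < n)%N) : `|f (w k) - f (w k.+1)| <= K (Ordinal kn) * enorm (u - v).
  set i := Ordinal kn; have [K0 Ki] := KP i.
  have -> : w k = upd_rV (w k) i (u 0 i).
    by apply/rowP => j; rewrite !mxE; case: eqP => // ->; rewrite ltnn.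
  have -> : w k.+1 = upd_rV (w k) i (v 0 i).
    apply/rowP => j; rewrite !mxE ltnS leq_eqVlt.
    case: (eqVneq j i) => [->|ji] /=; first by rewrite eqxx.
    by rewrite -[k]/(val i) (inj_eq val_inj) (negbTE ji).
  apply: (@le_trans _ _ (K i * `|u 0 i - v 0 i|)).
    apply: (upd_le (f' := 'D_('e_i) f) (B := B)) => //.
    - by move=> x; apply: DeriveDef => //; case: (df i).
    - by move/ccubeP : vB; apply.
    - by move/ccubeP : uB; apply.
  rewrite ler_wpM2l//; have := coord_le_enorm (u - v) i.
  by rewrite [X in `|X|]mxE [X in `|_ + X|]mxE.
have main k : (k <= n)%N ->
    `|f u - f (w k)| <= (\sum_(i < n | (i < k)%N) K i) * enorm (u - v).
  elim: k => [|k IH] kn.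
    rewrite (_ : w 0%N = u); last by apply/rowP => j; rewrite mxE.
    by rewrite subrr normr0 mulr_ge0 ?enorm_ge0// sumr_ge0// => i _; have [] := KP i.
  rewrite (le_trans (ler_distD (f (w k)) _ _))//.
  rewrite (bigD1 (Ordinal kn))//= mulrDl addrC lerD//.
  rewrite (le_trans (IH (ltnW kn)))// ler_wpM2r ?enorm_ge0//.
  rewrite le_eqVlt; apply/orP; left; apply/eqP; apply: eq_bigl => i.
  rewrite ltnS -(inj_eq val_inj) /=; case: ltngtP => //.
have := main n (leqnn n); rewrite (_ : w n = v); last first.
  by apply/rowP => j; rewrite mxE ltn_ord.
by under eq_bigl do rewrite ltn_ord.
Qed.

End locally_lipschitz.

Section frontier_measure.
Context {R : realType} {n : nat}.
Implicit Types (x y z nu : 'rV[R]_n.+1) (D : set 'rV[R]_n.+1).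

Definition surface_bounded (S : set 'rV[R]_n.+1) (C : R) : Prop :=
  forall z h, 0 <= h -> (hausdorff n (S `&` ecball z h) <= (C * h ^+ n)%:E)%E.

Lemma surface_bounded_bigcup (I : eqType) (s : seq I) (S : set 'rV[R]_n.+1)
    (A : I -> set 'rV[R]_n.+1) (C : I -> R) :
  (forall i, i \in s -> surface_bounded (A i) (C i)) ->
  S `<=` \bigcup_(i in [set` s]) A i -> surface_bounded S (\sum_(i <- s) C i).
Proof.
move=> AC SA z h h0.
apply: (@le_trans _ _ (hausdorff n (\bigcup_(i in [set` s]) (A i `&` ecball z h)))).
  by apply: le_hausdorff => x [/SA[i si Ax] xz]; exists i.
rewrite mulr_suml; apply: hausdorff_seq_bigcup => i si; exact: AC.
Qed.

(** Each boundary point of a polytope lies on the hyperplane of one of its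
    constraints. A vanishing constraint defines no hyperplane, but it is never
    active, since the polytope has a point. *)
Lemma surface_bounded_polytope D : convex_polytope D -> open D ->
  exists C : R, surface_bounded (frontier D) C.
Proof.
move=> [[p Dp] _ [N [a [b DE]]]] oD.
pose s := [seq i <- enum 'I_N | a i != 0].
exists (\sum_(i <- s) (unit_ball_volume n * (8 * n%:R) ^+ n)).
apply: (@surface_bounded_bigcup _ s _ (fun i => [set x | dotr x (a i) = b i])).
  move=> i; rewrite mem_filter => /andP[ai _] z h h0.
  apply: (@hausdorff_in_hyperplane _ _ (a i) _ z) => //.
  by move=> x y [/= xb _] [/= yb _]; rewrite dotrBl xb yb subrr.
move=> x [clx nintx].
have le i : dotr x (a i) <= b i.
  rewrite leNgt; apply/negP => lt.
  have : nbhs x [set y | b i < dotr y (a i)].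
    by apply: open_nbhs_nbhs; split => //; apply: open_gt_rV; exact: continuous_dotr.
  move=> /clx[y []]; rewrite DE => /(_ i) h1 h2.
  by have := lt_trans h2 (_ : dotr y (a i) < b i); rewrite ltxx dotrC => /(_ h1).
have nDx : ~ D x by move=> Dx; apply: nintx; rewrite /interior; exact: open_nbhs_nbhs.
have [i xi] : exists i, ~ dotr (a i) x < b i.
  apply: contrapT => h; apply: nDx; rewrite DE => i.
  by apply: contrapT => hi; apply: h; exists i.
exists i; last by apply/eqP; rewrite eq_le le dotrC leNgt; apply/negP.
rewrite /= mem_filter mem_enum andbT; apply/eqP => ai0; apply: xi.
move: Dp; rewrite DE => /(_ i); rewrite ai0.
by rewrite /dotr; under eq_bigr do rewrite mxE mul0r; under [X in _ -> X < _]eq_bigr do rewrite mxE mul0r.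
Qed.

(** Near [x] the domain is a strict epigraph of a continuous function, so
    boundary points lie on its graph. *)
Lemma frontier_graph D x r nu (gam : 'rV[R]_n.+1 -> R) : enorm nu = 1 ->
  continuous gam ->
  (forall y, eball x r y -> D y <-> gam (y - dotr y nu *: nu) < dotr y nu) ->
  forall y, frontier D y -> eball x r y -> gam (hproj nu y) = dotr y nu.
Proof.
move=> n1 cg DP y [cly ninty] xy.
have ch : continuous (fun y => gam (hproj nu y)).
  move=> w; apply: (@continuous_comp _ _ _ (hproj nu) gam); last exact: cg.
  move=> A /near_eball_rV[e e0 eA]; apply/near_eball_rV; exists (e / 2).
    by rewrite divr_gt0.
  move=> w' ww'; apply: eA; rewrite /eball /= -hprojB.
  rewrite (le_lt_trans (enorm_hproj_le _ n1))//.
  by rewrite mulrC -ltr_pdivlMr.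
have cd : continuous (fun y => dotr y nu) by exact: continuous_dotr.
have oB : nbhs y (eball x r) by apply: open_nbhs_nbhs; split => //; exact: eball_open.
have cdiff : continuous (fun y => dotr y nu + - gam (hproj nu y)).
  by apply: continuous_add => //; exact: continuous_opp.
have [lt|gt|//] := ltgtP (gam (hproj nu y)) (dotr y nu).
  exfalso; apply: ninty; rewrite /interior /=.
  have : nbhs y [set w | 0 < dotr w nu + - gam (hproj nu w)].
    apply: open_nbhs_nbhs; split; last by rewrite /= subr_gt0.
    exact: open_gt_rV cdiff.
  by move=> h; near=> w; apply/DP; [near: w|rewrite -subr_gt0; near: w].
exfalso; have : nbhs y [set w | dotr w nu + - gam (hproj nu w) < 0].
  apply: open_nbhs_nbhs; split; last by rewrite /= subr_lt0.
  exact: open_lt_rV cdiff.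
move=> h; have [w [Dw [w1 w2]]] := cly _ (filterI h oB).
by move/(DP _ w2) : Dw; rewrite -subr_gt0 ltNge (ltW w1).
Unshelve. all: by end_near. Qed.

(** The graph of a Lipschitz function is parametrized by the hyperplane with
    distortion at most [1 + M]. *)
Lemma surface_bounded_C2 D x : C2_boundary D -> frontier D x ->
  exists rC : R * R, [/\ 0 < rC.1, 0 <= rC.2 &
    surface_bounded (frontier D `&` eball x rC.1) rC.2].
Proof.
move=> C2 fx; have [r [nu [gam [r0 n1 gC DP]]]] := C2 x fx.
pose B := 2 * (enorm x + r).
have [M M0 ML] : exists2 M : R, 0 <= M & forall u v, ccube B u -> ccube B v ->
    `|gam u - gam v| <= M * enorm (u - v).
  apply: class_C1_lipschitz; case: gC => cg dg; split => // i.
  by have [d1 [cd _]] := dg i; split.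
exists (r, unit_ball_volume n * (8 * n%:R * (1 + M)) ^+ n); split => //=.
  by rewrite mulr_ge0 ?unit_ball_volume_ge0// exprn_ge0// !mulr_ge0// addr_ge0.
move=> z h h0; apply: (@hausdorff_graph _ _ nu _ z (1 + M)) => //.
- by rewrite addr_ge0.
- move=> y1 y2 [[f1 b1] _] [[f2 b2] _].
  have g1 := frontier_graph n1 (proj1 gC) DP f1 b1.
  have g2 := frontier_graph n1 (proj1 gC) DP f2 b2.
  have yB y : eball x r y -> ccube B (hproj nu y).
    move=> xy; apply/ccubeP => i; rewrite (le_trans (coord_le_enorm _ _))//.
    rewrite (le_trans (enorm_hproj_le _ n1))// ler_pM2l//.
    rewrite -[y](subrK x) (le_trans (ler_enormD _ _))// addrC lerD2l.
    exact: ltW.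
  have E : y1 - y2 = (hproj nu y1 - hproj nu y2) + (dotr y1 nu - dotr y2 nu) *: nu.
    by apply/rowP => i; rewrite /hproj !mxE; ring.
  rewrite {1}E (le_trans (ler_enormD _ _))// enormZ n1 mulr1 mulrDl mul1r lerD2l.
  by rewrite -g1 -g2; apply: ML; exact: yB.
Qed.

(** In the smooth case, compactness of the boundary makes finitely many graphs
    suffice, so one constant serves for all scales and positions. *)
Lemma surface_bounded_frontier D : open D -> compact (closure D) ->
  C2_boundary D \/ convex_polytope D ->
  exists2 C : R, 0 < C & surface_bounded (frontier D) C.
Proof.
move=> oD cD; suff h : (C2_boundary D \/ convex_polytope D) ->
    exists C : R, surface_bounded (frontier D) C.
  move=> /h[C CP]; exists (`|C| + 1); first by rewrite ltr_wpDl.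
  move=> z e e0; apply: le_trans (CP z e e0) _; rewrite lee_fin ler_wpM2r ?exprn_ge0//.
  by rewrite (le_trans (ler_norm C))// lerDl.
case=> [C2|/surface_bounded_polytope]; last exact.
have fcl : closed (frontier D).
  by rewrite /frontier setDE; apply: closedI; [exact: closed_closure|apply: open_closedC; exact: open_interior].
have cF : compact (frontier D) by apply: subclosed_compact fcl cD _ => x [].
have h x : exists rC : R * R, frontier D x -> [/\ 0 < rC.1, 0 <= rC.2 &
    surface_bounded (frontier D `&` eball x rC.1) rC.2].
  have [fx|nfx] := pselect (frontier D x); last by exists (0, 0).
  by have [rC rCP] := surface_bounded_C2 C2 fx; exists rC.
have [rC rCP] := choice h.
move: cF; rewrite compact_cover => cF.
have [||s sF cov] := cF 'rV[R]_n.+1 (frontier D) (fun x => eball x (rC x).1).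
- by move=> x _; exact: eball_open.
- move=> x fx; exists x => //; rewrite /eball /= subrr enorm0.
  by have [] := rCP x fx.
exists (\sum_(x <- finmap.enum_fset s) (rC x).2).
apply: (@surface_bounded_bigcup _ (finmap.enum_fset s) _ (fun x => frontier D `&` eball x (rC x).1)).
  by move=> x xs; have [] := rCP x (set_mem (sF x xs)).
by move=> y fy; have [x xs xy] := cov y fy; exists x.
Qed.

End frontier_measure.

(** * Geometry of simplices *)

Section simplices.
Context {R : realType} {d : nat} (T : mesh R d).
Implicit Types (V K e : {set 'I_(nnodes T)}) (x y z : 'rV[R]_d).

(** The functions [x |-> dotr x (g i) + c i] are the barycentric coordinates of
    the simplex with vertex set [K]. *)
Definition barycentric K (g : 'I_(nnodes T) -> 'rV[R]_d) (c : 'I_(nnodes T) -> R) : Prop :=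
  [/\ forall l : 'I_(nnodes T) -> R, \sum_(i in K) l i = 1 -> forall i, i \in K ->
        dotr (\sum_(j in K) l j *: node j) (g i) + c i = l i,
      forall x, \sum_(i in K) (dotr x (g i) + c i) = 1 &
      forall x, \sum_(i in K) (dotr x (g i) + c i) *: node i = x].

(** Affine independence says that the matrix with rows [(1, node i)] is
    invertible; the coordinates are read off from its inverse. *)
Lemma barycentric_exists K : #|K| = d.+1 -> affinely_independent K ->
  exists g c, barycentric K g c.
Proof.
move=> cK aK.
have [i0 i0K] : exists i0, i0 \in K by apply/set0Pn; rewrite -card_gt0 cK.
pose M : 'M[R]_(#|K|, 1 + d) := \matrix_(k, j) (row_mx 1%:M (node (enum_val k)) : 'rV_(1 + d)) 0 j.
have MV (v : 'rV[R]_#|K|) : v *m M = row_mx (\sum_k v 0 k)%:M (\sum_k v 0 k *: node (enum_val k)).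
  apply/rowP => j; rewrite mxE.
  case: (split_ordP j) => j' ->.
    rewrite row_mxEl mxE (ord1 j') eqxx mulr1n; apply: eq_bigr => k _.
    by rewrite mxE row_mxEl mxE eqxx mulr1.
  rewrite row_mxEr summxE; apply: eq_bigr => k _.
  by rewrite mxE row_mxEr [RHS]mxE.
have rf : row_free M.
  rewrite -kermx_eq0; apply/rowV0P => v /sub_kermxP.
  rewrite MV => /eqP; rewrite row_mx_eq0 => /andP[/eqP v1 /eqP v2].
  have v10 : \sum_k v 0 k = 0 by move: v1 => /matrixP /(_ 0 0); rewrite !mxE eqxx mulr1n.
  pose l i := v 0 (enum_rank_in i0K i).
  have lE k : l (enum_val k) = v 0 k by rewrite /l enum_valK_in.
  have l0 : forall i, i \in K -> l i = 0.
    apply: aK; rewrite big_enum_val/=; first by under eq_bigr do rewrite lE.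
    by under eq_bigr do rewrite lE.
  by apply/rowP => k; rewrite mxE -lE l0// enum_valP.
have rfull : row_full M by move: rf; rewrite /row_free /row_full => /eqP ->; rewrite cK.
pose Q := pinvmx M.
pose g i : 'rV[R]_d := \row_j Q (rshift 1 j) (enum_rank_in i0K i).
pose c i : R := Q (lshift d 0) (enum_rank_in i0K i).
have gE x i : dotr x (g i) + c i = (row_mx 1%:M x *m Q) 0 (enum_rank_in i0K i).
  rewrite mxE big_split_ord/= big_ord1 row_mxEl mxE eqxx mul1r addrC; congr (_ + _).
  by apply: eq_bigr => j _; rewrite row_mxEr mxE.
exists g, c; split.
- move=> l l1 i iK; rewrite gE.
  have -> : row_mx 1%:M (\sum_(j in K) l j *: node j) = (\row_k l (enum_val k)) *m M.
    rewrite MV; congr row_mx.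
      congr (_%:M); rewrite -l1 big_enum_val/=; by apply: eq_bigr => k _; rewrite mxE.
    by rewrite big_enum_val/=; apply: eq_bigr => k _; rewrite mxE.
  by rewrite -mulmxA mulmxVp// mulmx1 mxE enum_rankK_in.
- move=> x; have := mulmxA (row_mx 1%:M x) Q M; rewrite mulVpmx// mulmx1 MV.
  move=> /eq_row_mx[/matrixP /(_ 0 0)]; rewrite !mxE eqxx mulr1n => -> _.
  by rewrite big_enum_val/=; apply: eq_bigr => k _; rewrite gE enum_valK_in.
- move=> x; have := mulmxA (row_mx 1%:M x) Q M; rewrite mulVpmx// mulmx1 MV.
  move=> /eq_row_mx[_ xE]; rewrite [RHS]xE.
  by rewrite big_enum_val/=; apply: eq_bigr => k _; rewrite gE enum_valK_in.
Qed.

(** A face is described by the barycentric coordinates of the whole element: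
    those of its vertices are positive and the others vanish. Openness of
    elements, measurability of faces and disjointness follow from this. *)
Lemma simplex_barycentric K V g c x : barycentric K g c -> V \subset K ->
  simplex V x <-> forall i, i \in K ->
    (i \in V -> 0 < dotr x (g i) + c i) /\ (i \notin V -> dotr x (g i) + c i = 0).
Proof.
move=> [b1 b2 b3] VK; split.
  move=> [l [l0 l1 ->]] i iK.
  pose l' i := if i \in V then l i else 0.
  have sumV (E : zmodType) (F : 'I_(nnodes T) -> E) : (forall i, i \notin V -> F i = 0) ->
      \sum_(i in V) F i = \sum_(i in K) F i.
    move=> F0; rewrite [RHS](big_setID V)/= (finset.setIidPr VK) [X in _ + X]big1 ?addr0// => j.
    by rewrite inE => /andP[/F0].
  have l'1 : \sum_(i in K) l' i = 1.
    rewrite -sumV; last by move=> j /negbTE jV; rewrite /l' jV.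
    by rewrite -l1; apply: eq_bigr => j jV; rewrite /l' jV.
  have -> : \sum_(i in V) l i *: node i = \sum_(i in K) l' i *: node i.
    rewrite -(sumV _ (fun i => l' i *: node i)).
      by apply: eq_bigr => j jV; rewrite /l' jV.
    by move=> j /negbTE jV; rewrite /l' jV scale0r.
  rewrite (b1 l' l'1 i iK) /l'; split=> [iV|/negbTE ->//].
  by rewrite iV; exact: l0.
move=> h; exists (fun i => dotr x (g i) + c i); split.
- by move=> i iV; exact: (h i (fintype.subsetP VK i iV)).1 iV.
- rewrite -(b2 x) [RHS](big_setID V)/= (finset.setIidPr VK) [X in _ + X]big1 ?addr0// => j.
  by rewrite inE => /andP[jV jK]; exact: (h j jK).2.
- rewrite -[LHS](b3 x) [LHS](big_setID V)/= (finset.setIidPr VK) [X in _ + X]big1 ?addr0// => j.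
  by rewrite inE => /andP[jV jK]; rewrite (h j jK).2// scale0r.
Qed.

Lemma continuous_barycentric (g : 'rV[R]_d) (c : R) : continuous (fun x => dotr x g + c).
Proof.
by apply: continuous_add; [exact: continuous_dotr|exact: cst_continuous].
Qed.

Lemma simplex_open K : #|K| = d.+1 -> affinely_independent K -> open (simplex K).
Proof.
move=> cK aK; have [g [c b]] := barycentric_exists cK aK.
rewrite (_ : simplex K = \bigcap_(i in [set` enum K]) [set x | 0 < dotr x (g i) + c i]).
  elim: (enum K) => [|i s IH].
    rewrite (_ : \bigcap_(_ in _) _ = setT); first exact: openT.
    by apply/seteqP; split => // x _ j.
  rewrite (_ : \bigcap_(_ in _) _ = [set x | 0 < dotr x (g i) + c i] `&`
      \bigcap_(i in [set` s]) [set x | 0 < dotr x (g i) + c i]).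
    by apply: openI => //; apply: open_gt_rV; exact: continuous_barycentric.
  apply/seteqP; split => x.
    by move=> h; split; [apply: (h i); rewrite /= mem_head|move=> j js; apply: (h j); rewrite /= inE js orbT].
  by move=> [h1 h2] j /=; rewrite inE => /orP[/eqP ->|/h2].
apply/seteqP; split => x.
  move/(simplex_barycentric x b (subxx K)) => h i; rewrite /= mem_enum => iK.
  exact: (h i iK).1.
move=> h; apply/(simplex_barycentric x b (subxx K)) => i iK; rewrite iK; split => // _.
by apply: (h i); rewrite /= mem_enum.
Qed.

Lemma measurable_simplex K V : #|K| = d.+1 -> affinely_independent K -> V \subset K ->
  measurable (simplex V).
Proof.
move=> cK aK VK; have [g [c b]] := barycentric_exists cK aK.
rewrite (_ : simplex V = \bigcap_(i in [set` K])
    ((fun x => dotr x (g i) + c i) @^-1` (if i \in V then `]0, +oo[%classic else [set 0]))).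
  apply: fin_bigcap_measurable => [|i _]; first exact: finite_finpred.
  rewrite -[X in measurable X]setTI.
  apply: (continuous_measurable_rV (@continuous_barycentric (g i) (c i))) => //.
  by case: ifP => _; [exact: measurable_itv|exact: measurable_set1].
apply/seteqP; split => x.
  move/(simplex_barycentric x b VK) => h i /= iK; have [h1 h2] := h i iK.
  by case: ifPn => iV /=; [rewrite in_itv/= andbT h1|exact: h2].
move=> h; apply/(simplex_barycentric x b VK) => i iK; have := h i iK.
by case: ifPn => iV /=; rewrite ?in_itv/= ?andbT.
Qed.

Lemma simplex_bounded V x : simplex V x -> enorm x <= \sum_(i in V) enorm (node i).
Proof.
move=> [l [l0 l1 ->]].
have l1i i : i \in V -> l i <= 1.
  move=> iV; rewrite -l1 (bigD1 i)//= lerDl sumr_ge0// => j /andP[jV _].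
  by rewrite ltW// l0.
elim/big_ind2 : _ => [|x1 a x2 b h1 h2|i iV]; first by rewrite enorm0.
  by rewrite (le_trans (ler_enormD _ _))// lerD.
by rewrite enormZ gtr0_norm ?l0// ler_piMl ?enorm_ge0// l1i.
Qed.

Lemma simplex_neq0 V : V != finset.set0 -> simplex V !=set0.
Proof.
move=> V0; have c0 : (0 : R) < #|V|%:R by rewrite ltr0n card_gt0.
exists (\sum_(i in V) (#|V|%:R^-1 : R) *: node i), (fun=> #|V|%:R^-1); split => //.
  by move=> i _; rewrite invr_gt0.
by rewrite sumr_const -[X in X *+ _]mulr1 -mulrnAr mulVf// gt_eqF.
Qed.

Lemma ediam_simplex_fin V : V != finset.set0 -> ediam (simplex V) \is a fin_num.
Proof.
move=> V0; rewrite ge0_fin_numE; last exact: ediam_ge0 (simplex_neq0 V0).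
apply: (@le_lt_trans _ _ (2 * \sum_(i in V) enorm (node i))%:E); last by rewrite ltry.
apply: ge_ereal_sup => _ [x xV [y yV <-]]; rewrite lee_fin.
have := ler_enormD x (- y); rewrite enormN.
by have := simplex_bounded xV; have := simplex_bounded yV; lra.
Qed.

Lemma enorm_le_diam V x y : simplex V x -> simplex V y -> enorm (x - y) <= diam V.
Proof.
move=> xV yV; have V0 : V != finset.set0.
  apply/eqP => V0; case: xV => l [_]; rewrite V0 big_set0 => /eqP.
  by rewrite eq_sym oner_eq0.
by rewrite -lee_fin /diam fineK ?ediam_simplex_fin// le_enorm_ediam.
Qed.

(** Transferring weight between two vertices, starting from the barycentre,
    gives two distinct points of the open simplex. *)
Lemma diam_gt0 V K : affinely_independent K -> V \subset K -> (1 < #|V|)%N -> 0 < diam V.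
Proof.
move=> aK VK V1; have c0 : (0 : R) < #|V|%:R by rewrite ltr0n (ltn_trans _ V1).
have [i [j [iV jV ij]]] : exists i j, [/\ i \in V, j \in V & i != j].
  by move/card_gt1P : V1 => [i [j [iV jV ij]]]; exists i, j.
have [a a0 sa] : exists2 a : R, 0 < a & \sum_(k in V) a = 1.
  exists (#|V|%:R^-1); first by rewrite invr_gt0.
  by rewrite sumr_const -[X in X *+ _]mulr1 -mulrnAr mulVf// gt_eqF.
pose e k : R := (k == i)%:R * (a / 2) - (k == j)%:R * (a / 2).
have se (E : lmodType R) (F : 'I_(nnodes T) -> E) :
    \sum_(k in V) e k *: F k = (a / 2) *: (F i - F j).
  rewrite (bigD1 i)//= (bigD1 j)//= ?jV 1?eq_sym// big1 ?addr0.
    rewrite /e !eqxx (negbTE ij) eq_sym (negbTE ij) !mul0r !mul1r subr0 sub0r.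
    by rewrite scaleNr scalerBr.
  by move=> k /andP[/andP[_ /negbTE ki] /negbTE kj]; rewrite /e ki kj !mul0r subr0 scale0r.
pose x := \sum_(k in V) a *: (node k : 'rV[R]_d).
have xV : simplex V x by exists (fun=> a); split.
have yV : simplex V (x + (a / 2) *: (node i - node j)).
  exists (fun k => a + e k); split.
  - move=> k _; rewrite /e; case: eqP => [->|_].
      by rewrite (negbTE ij) mul1r mul0r; lra.
    by case: eqP => _; rewrite ?mul1r !mul0r; lra.
  - rewrite big_split/= sa.
    by have := se R^o (fun=> 1); rewrite subrr scaler0 => se1;
      rewrite -[X in _ + X = _]/(\sum_(k in V) e k) -[RHS]addr0 -[in RHS]se1;
      congr (_ + _); apply: eq_bigr => k _; rewrite [_ *: _]mulr1.
  - have := se _ (@node _ _ T) => <-; rewrite /x -big_split/=.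
  by apply: eq_bigr => k _; rewrite [RHS]scalerDl.
apply: lt_le_trans (enorm_le_diam yV xV).
rewrite addrAC subrr add0r enormZ mulr_gt0//; first by rewrite normr_gt0 gt_eqF// divr_gt0.
rewrite lt_def enorm_ge0 andbT; apply/eqP => /enorm_eq0 /eqP; rewrite subr_eq0 => /eqP nij.
pose l k : R := (k == i)%:R - (k == j)%:R.
have sl (E : lmodType R) (F : 'I_(nnodes T) -> E) : \sum_(k in K) l k *: F k = F i - F j.
  rewrite (bigD1 i)/= ?(fintype.subsetP VK)// (bigD1 j)/= ?(fintype.subsetP VK) 1?eq_sym//.
  rewrite big1 ?addr0.
    rewrite /l !eqxx (negbTE ij) eq_sym (negbTE ij) subr0 sub0r.
    by rewrite scale1r scaleN1r.
  by move=> k /andP[/andP[_ /negbTE ki] /negbTE kj]; rewrite /l ki kj subrr scale0r.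
have := aK l _ _ i (fintype.subsetP VK i iV); rewrite sl nij subrr.
have l0 : \sum_(k in K) l k = 0.
  have := sl R^o (fun=> 1); rewrite subrr => sl1; rewrite -[RHS]sl1.
  by apply: eq_bigr => k _; rewrite [_ *: _]mulr1.
by move=> /(_ l0 erefl); rewrite /l eqxx (negbTE ij) subr0 => /eqP; rewrite oner_eq0.
Qed.

(** Moving a point of the face slightly towards an interior point makes all
    barycentric coordinates positive. *)
Lemma simplex_face_closure V K : #|K| = d.+1 -> affinely_independent K ->
  V \subset K -> simplex V `<=` closure (simplex K).
Proof.
move=> cK aK VK x xV; have [g [c b]] := barycentric_exists cK aK.
have [z zK] : simplex K !=set0 by apply: simplex_neq0; rewrite -card_gt0 cK.
move=> A /near_eball_rV[r r0 rA].
pose t := Num.min (1 / 2) (r / (2 * (enorm (z - x) + 1))).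
have p0 : 0 < 2 * (enorm (z - x) + 1) by rewrite mulr_gt0// ltr_wpDl ?enorm_ge0.
have t0 : 0 < t by rewrite lt_min !divr_gt0.
have t1 : t < 1 by rewrite gt_min; apply/orP; left; lra.
exists (x + t *: (z - x)); split.
  apply/(simplex_barycentric _ b (subxx K)) => i iK; rewrite iK; split => // _.
  have [x1 x2] := (simplex_barycentric x b VK).1 xV i iK.
  have [z1 _] := (simplex_barycentric z b (subxx K)).1 zK i iK.
  have x0 : 0 <= dotr x (g i) + c i.
    by have [/x1/ltW//|/x2 ->] := boolP (i \in V).
  have -> : dotr (x + t *: (z - x)) (g i) + c i =
      (1 - t) * (dotr x (g i) + c i) + t * (dotr z (g i) + c i).
    by rewrite dotrDl dotrZl dotrBl; ring.
  by rewrite ltr_wpDl ?mulr_ge0 ?mulr_gt0 ?z1// subr_ge0 ltW.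
apply: rA; rewrite /eball /= addrAC subrr add0r enormZ gtr0_norm//.
apply: (@le_lt_trans _ _ (r / (2 * (enorm (z - x) + 1)) * enorm (z - x))).
  by rewrite ler_wpM2r ?enorm_ge0// ge_min lexx orbT.
rewrite mulrAC ltr_pdivrMr// ltr_pM2l//.
by have := enorm_ge0 (z - x); lra.
Qed.

Lemma enorm_le_diam_closure K x y : closure (simplex K) x -> closure (simplex K) y ->
  enorm (x - y) <= diam K.
Proof.
move=> cx cy; apply/ler_addgt0Pr => e e0.
have e20 : 0 < e / 2 by rewrite divr_gt0.
have nb z : nbhs z (eball z (e / 2)) by apply/near_eball_rV; exists (e / 2).
have [x' [xK xx]] := cx _ (nb x); have [y' [yK yy]] := cy _ (nb y).
rewrite /eball /= in xx yy.
have := enorm_le_diam xK yK; have := ler_enorm_dist x' x y.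
by have := ler_enorm_dist y' x' y; rewrite (enormC x x'); lra.
Qed.

(** A common point would lie in the closure of the common face, where the
    barycentric coordinate of a vertex of [K] outside [K'] is at most 0. *)
Lemma simplex_disjoint K K' : #|K| = d.+1 -> affinely_independent K -> #|K'| = d.+1 ->
  closure (simplex K) `&` closure (simplex K') = closure (simplex (K :&: K')) ->
  K != K' -> simplex K `&` simplex K' = set0.
Proof.
move=> cK aK cK' KK' neq; apply/seteqP; split => // x [xK xK'].
have [g [c b]] := barycentric_exists cK aK.
have [i iK iK'] : exists2 i, i \in K & i \notin K'.
  apply/subsetPn; apply: contra neq => sub; rewrite eqEcard sub cK cK'/=; exact: leqnn.
have [x1 _] := (simplex_barycentric x b (subxx K)).1 xK i iK.
have : closure (simplex (K :&: K')) x.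
  by rewrite -KK'; split; exact: subset_closure.
have cl : closed [set y | dotr y (g i) + c i <= 0].
  rewrite -[X in closed X]setCK; apply: open_closedC.
  rewrite (_ : ~` _ = [set y | 0 < dotr y (g i) + c i]).
    by apply: open_gt_rV; exact: continuous_barycentric.
  by apply/seteqP; split => y /=; rewrite ltNge => /negP.
have sub : simplex (K :&: K') `<=` [set y | dotr y (g i) + c i <= 0].
  move=> y yKK' /=; have [_ y2] := (simplex_barycentric y b (finset.subsetIl K K')).1 yKK' i iK.
  by rewrite y2// inE negb_and iK' orbT.
move=> /(closure_subset sub); rewrite -(closure_id _).1// /= leNgt.
by move/negP; apply; apply: x1.
Qed.

End simplices.

(** * Quasi-uniform meshes *)

Section mesh_geometry.
Context {R : realType} {n : nat} (T : mesh R n.+1).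
Implicit Types (V K e : {set 'I_(nnodes T)}) (x y z : 'rV[R]_n.+1).
Variables (Om : set 'rV[R]_n.+1) (sigma : R).
Hypotheses (tr : triangulation T Om) (qu : quasi_uniform T sigma).

Local Notation h := (mesh_size T).

Lemma element_card K : K \in elements T -> #|K| = n.+2.
Proof. by case: tr => t _ _ /t []. Qed.

Lemma element_indep K : K \in elements T -> affinely_independent K.
Proof. by case: tr => t _ _ /t []. Qed.

Lemma diam_le_mesh_size K : K \in elements T -> diam K <= h.
Proof. by move=> KT; exact: (le_bigmax_cond _ (@diam _ _ T)). Qed.

Lemma diam_element_gt0 K : K \in elements T -> 0 < diam K.
Proof.
move=> KT; apply: (diam_gt0 (element_indep KT) (subxx K)).
by rewrite element_card.
Qed.

Lemma mesh_size_gt0 K : K \in elements T -> 0 < h.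
Proof. by move=> KT; exact: lt_le_trans (diam_element_gt0 KT) (diam_le_mesh_size KT). Qed.

Lemma inscribed_ball K : K \in elements T -> 0 < sigma /\
  exists x, eball x (h / (2 * sigma)) `<=` simplex K.
Proof.
move=> KT; have h0 := mesh_size_gt0 KT.
have hr : h <= sigma * inradius K by exact: qu.
set A := [set r : R | 0 <= r /\ exists x, eball x r `<=` simplex K].
have rE : inradius K = sup A by [].
have sr : 0 < sigma * sup A by rewrite -rE; exact: lt_le_trans hr.
have supA : has_sup A.
  by apply: contrapT => /sup_out s0; move: sr; rewrite s0 mulr0 ltxx.
have r0 : 0 < sup A.
  rewrite lt_def; apply/andP; split.
    by apply/eqP => s0; move: sr; rewrite s0 mulr0 ltxx.
  by have [[r Ar] _] := supA; exact: le_trans Ar.1 (sup_upper_bound supA Ar).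
have s0 : 0 < sigma by rewrite -(pmulr_lgt0 _ r0).
split => //; have r20 : 0 < sup A / 2 by rewrite divr_gt0.
have [r [_ [x xr]] hr'] := sup_adherent r20 supA.
exists x; apply: subset_trans xr => y; rewrite /eball /= => /lt_le_trans; apply.
apply: ltW; apply: le_lt_trans hr'.
rewrite ler_pdivrMr ?mulr_gt0//; move: hr; rewrite rE; lra.
Qed.

(** The ratio of the mesh size to the side of a cube that fits into every
    element. *)
Definition cube_ratio : R := 4 * sigma * n.+1%:R.

Lemma inscribed_cube K : K \in elements T -> 0 < cube_ratio /\
  exists a, cube a (h / cube_ratio) `<=` simplex K.
Proof.
move=> KT; have [s0 [x xK]] := inscribed_ball KT; have h0 := mesh_size_gt0 KT.
have L0 : 0 < cube_ratio by rewrite !mulr_gt0.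
split => //; exists x; apply: subset_trans xK => y yx; rewrite /eball /=.
apply: (@le_lt_trans _ _ (n.+1%:R * (h / cube_ratio))).
  apply: enorm_le_coord => i; have /andP[y1 y2] := yx i; rewrite !mxE ger0_norm ?subr_ge0//.
  by rewrite lerBlDl.
have -> : n.+1%:R * (h / cube_ratio) = h / (4 * sigma).
  by rewrite /cube_ratio; field; rewrite gt_eqF//= addrC natr1 pnatr_eq0.
rewrite ltr_pM2l// ltf_pV2 ?posrE ?mulr_gt0// ltr_pM2r//; lra.
Qed.

Lemma elements_disjoint K K' : K \in elements T -> K' \in elements T -> K != K' ->
  simplex K `&` simplex K' = set0.
Proof.
move=> KT KT'; case: tr => _ _ t; apply: simplex_disjoint; rewrite ?element_card//.
  exact: element_indep.
exact: t.
Qed.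

(** The number of cubes of side [h / cube_ratio] that have the volume of a cube
    of side [6 * h]. *)
Definition packing_bound : R := (6 * `|cube_ratio|) ^+ n.+1.

(** The elements are disjoint, contain cubes of the same size and lie in a cube
    of side [6 * h]; compare volumes. *)
Lemma packing (A : {set {set 'I_(nnodes T)}}) z :
  (forall K, K \in A -> K \in elements T /\ simplex K `<=` ecball z (3 * h)) ->
  #|A|%:R <= packing_bound.
Proof.
move=> AP; have [->|[K0 K0A]] := set_0Vmem A.
  by rewrite cards0 exprn_ge0// mulr_ge0.
have [K0T _] := AP K0 K0A; have h0 := mesh_size_gt0 K0T.
have [L0 _] := inscribed_cube K0T.
pose l := h / cube_ratio; have l0 : 0 < l by rewrite divr_gt0.
have mK K : K \in A -> measurable (simplex K).
  move=> /AP[KT _]; apply: open_measurable_rV; apply: simplex_open; first exact: element_card.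
  exact: element_indep.
have count (s : seq {set 'I_(nnodes T)}) : uniq s -> {subset s <= A} ->
    (((size s)%:R * l ^+ n.+1)%:E <= lebesgue_rV n.+1 (\bigcup_(K in [set` s]) simplex K))%E.
  elim: s => [|K s IH] /=; first by rewrite mul0r.
  move=> /andP[Ks us] sA.
  have KA : K \in A by apply: sA; rewrite mem_head.
  have sA' : {subset s <= A} by move=> K' K's; apply: sA; rewrite inE K's orbT.
  rewrite (_ : \bigcup_(_ in _) _ = simplex K `|` \bigcup_(K in [set` s]) simplex K); last first.
    apply/seteqP; split => x.
      by move=> [K' /=]; rewrite inE => /orP[/eqP ->|K's]; [left|right; exists K'].
    by case=> [xK|[K' K's xK']]; [exists K|exists K'] => //=; rewrite ?mem_head// inE K's orbT.
  have mU : measurable (\bigcup_(K in [set` s]) simplex K).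
    by apply: fin_bigcup_measurable; [exact: finite_seq|move=> K' /sA'; exact: mK].
  have [KT _] := AP K KA.
  rewrite measureU//; [|exact: mK|]; last first.
    apply/seteqP; split => // x [xK [K' K's xK']].
    have [K'T _] := AP K' (sA' K' K's).
    have KK' : K != K' by apply: contraNneq Ks => ->.
    by rewrite -(elements_disjoint KT K'T KK').
  rewrite -natr1 mulrDl mul1r EFinD addeC leeD//; last exact: IH.
  have [_ [a aK]] := inscribed_cube KT.
  rewrite -(lebesgue_cube a (ltW l0)); apply: le_measure; rewrite ?inE//.
  - exact: measurable_cube.
  - exact: mK.
have cnt := count (enum A) (enum_uniq _) _.
have {cnt} : ((#|A|%:R * l ^+ n.+1)%:E <= ((6 * h) ^+ n.+1)%:E)%E.
  rewrite cardE; apply: le_trans (cnt _) _; first by move=> K; rewrite mem_enum.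
  have h60 : 0 <= 6 * h by rewrite mulr_ge0// ltW.
  rewrite -(lebesgue_cube (z - const_mx (3 * h)) h60); apply: le_measure; rewrite ?inE.
  - apply: fin_bigcup_measurable; first exact: finite_seq.
    by move=> K /=; rewrite mem_enum; exact: mK.
  - exact: measurable_cube.
  - move=> x [K /=]; rewrite mem_enum => /AP[_ KP] /KP xz i; rewrite !mxE.
    have := le_trans (coord_le_enorm _ i) xz; rewrite !mxE ler_norml => /andP[? ?].
    by apply/andP; split; lra.
rewrite lee_fin /packing_bound (gtr0_norm L0) /l expr_div_n mulrA ler_pdivrMr ?exprn_gt0//.
move=> H; rewrite -(ler_pM2r (exprn_gt0 n.+1 h0)) (le_trans H)// -!exprMn.
by rewrite (mulrAC 6 h).
Qed.

Lemma faceP e : e \in faces T -> exists K, [/\ K \in elements T, e \subset K & #|e| = n.+1].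
Proof.
rewrite inE => /andP[/eqP ce /existsP[K /andP[KT eK]]]; by exists K.
Qed.

Lemma diam_face_gt0 e : (0 < n)%N -> e \in faces T -> 0 < diam e.
Proof.
move=> n0 /faceP[K [KT eK ce]]; apply: (diam_gt0 (element_indep KT) eK).
by rewrite ce ltnS.
Qed.

Lemma element_closure e K : K \in elements T -> e \subset K ->
  simplex e `<=` closure (simplex K).
Proof.
by move=> KT eK; apply: simplex_face_closure => //; [exact: element_card|exact: element_indep].
Qed.

Lemma diam_face_le e : e \in faces T -> diam e <= h.
Proof.
move=> /faceP[K [KT eK ce]]; apply: le_trans (diam_le_mesh_size KT).
have e0 : e != finset.set0 by rewrite -card_gt0 ce.
rewrite -lee_fin /diam fineK ?ediam_simplex_fin//.
apply: ge_ereal_sup => _ [x xe [y ye <-]]; rewrite lee_fin.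
by apply: enorm_le_diam_closure; exact: (element_closure KT eK).
Qed.

Lemma measurable_element K : K \in elements T -> measurable (simplex K).
Proof.
move=> KT; apply: open_measurable_rV; apply: simplex_open; first exact: element_card.
exact: element_indep.
Qed.

Lemma measurable_face e : e \in faces T -> measurable (simplex e).
Proof.
move=> /faceP[K [KT eK ce]]; apply: (measurable_simplex _ (element_indep KT) eK).
exact: element_card.
Qed.

(** A face lies in the zero set of the barycentric coordinate of the opposite
    vertex. *)
Lemma hausdorff_face e : e \in faces T ->
  (hausdorff n (simplex e) <= (unit_ball_volume n * (8 * n%:R) ^+ n * h ^+ n)%:E)%E.
Proof.
move=> ef; have [K [KT eK ce]] := faceP ef.
have e0 : e != finset.set0 by rewrite -card_gt0 ce.
have [z ze] := simplex_neq0 e0.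
have [i iK ie] : exists2 i, i \in K & i \notin e.
  apply/subsetPn/negP => /subset_leq_card; by rewrite ce element_card// ltnn.
have [g [c b]] := barycentric_exists (element_card KT) (element_indep KT).
have lam0 x : simplex e x -> dotr x (g i) + c i = 0.
  by move=> xe; exact: ((simplex_barycentric x b eK).1 xe i iK).2.
have gi0 : g i != 0.
  apply/eqP => gi0; have d0 y : dotr y (g i) = 0.
    by rewrite dotrC gi0 /dotr big1// => j _; rewrite mxE mul0r.
  have [w wK] : simplex K !=set0 by apply: simplex_neq0; rewrite -card_gt0 element_card.
  have := ((simplex_barycentric w b (subxx K)).1 wK i iK).1 iK.
  by have := lam0 z ze; rewrite !d0 => ->; rewrite ltxx.
apply: (@hausdorff_in_hyperplane _ _ (g i) _ z) => //.
- exact: ltW (mesh_size_gt0 KT).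
- by move=> x y /lam0 xe /lam0 ye; rewrite dotrBl; lra.
- by move=> x xe; exact: le_trans (enorm_le_diam xe ze) (diam_face_le ef).
Qed.

Lemma card_elements_at_face e : e \in faces T ->
  #|[set K in elements T | e \subset K]|%:R <= packing_bound.
Proof.
move=> ef; have [K0 [K0T eK0 ce]] := faceP ef.
have [z ze] : simplex e !=set0 by apply: simplex_neq0; rewrite -card_gt0 ce.
apply: (@packing _ z) => K; rewrite inE => /andP[KT eK]; split => // x xK.
have zK := element_closure KT eK ze; have xK' := subset_closure xK.
rewrite /ecball /= (le_trans (enorm_le_diam_closure xK' zK))//.
rewrite (le_trans (diam_le_mesh_size KT))//.
have := mesh_size_gt0 KT; lra.
Qed.

Lemma enorm_le_adjacent K K' x y : K \in elements T -> K' \in Defs.adjacent K ->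
  simplex K x -> simplex K' y -> enorm (x - y) <= 2 * h.
Proof.
rewrite inE => KT /andP[K'T /asboolP[z [zK' zK]]] xK yK'.
have := ler_enorm_dist z x y.
have := enorm_le_diam_closure (subset_closure xK) zK.
have := enorm_le_diam_closure zK' (subset_closure yK').
have := diam_le_mesh_size KT; have := diam_le_mesh_size K'T; lra.
Qed.

Lemma card_adjacent K' (A : {set {set 'I_(nnodes T)}}) : K' \in elements T ->
  (forall K, K \in A -> K \in elements T /\ (K = K' \/ K' \in Defs.adjacent K)) ->
  #|A|%:R <= packing_bound.
Proof.
move=> K'T AP; have [z zK'] : simplex K' !=set0.
  by apply: simplex_neq0; rewrite -card_gt0 element_card.
have h0 := mesh_size_gt0 K'T.
apply: (@packing _ z) => K /AP[KT [KK'|adj]]; split => // x xK; rewrite /ecball /=.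
  rewrite KK' in xK; rewrite (le_trans (enorm_le_diam xK zK'))//.
  by rewrite (le_trans (diam_le_mesh_size K'T))//; lra.
by rewrite (le_trans (enorm_le_adjacent KT adj xK zK'))//; lra.
Qed.

End mesh_geometry.

(** * Cauchy-Schwarz inequalities *)

Section cauchy_schwarz.
Local Open Scope ereal_scope.
Context {R : realType}.

(** The Cauchy-Schwarz inequality for pairs, in a form that allows infinite
    values: of the energy norm of a function with a part in H2, only
    nonnegativity is used. *)
Lemma sqrte_mul2_le (a b c d : \bar R) : 0 <= a -> 0 <= b -> 0 <= c -> 0 <= d ->
  sqrte a * sqrte b + sqrte c * sqrte d <= sqrte (a + c) * sqrte (b + d).
Proof.
move=> a0 b0 c0 d0.
have [ac0|ac0] := eqVneq (a + c) 0.
  move: ac0 => /eqP; rewrite padde_eq0// => /andP[/eqP -> /eqP ->].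
  by rewrite adde0 !sqrte0 !mul0e adde0.
have [bd0|bd0] := eqVneq (b + d) 0.
  move: bd0 => /eqP; rewrite padde_eq0// => /andP[/eqP -> /eqP ->].
  by rewrite adde0 !sqrte0 !mule0 adde0.
have pos (x : \bar R) : 0 <= x -> x != 0 -> 0 < sqrte x.
  case: x => [r| |]//= r0 rn0.
  by rewrite lte_fin sqrtr_gt0 lt_def -!lee_fin r0 andbT; apply: contra rn0 => /eqP ->.
have sac := pos _ (adde_ge0 a0 c0) ac0; have sbd := pos _ (adde_ge0 b0 d0) bd0.
have [acoo|acoo] := eqVneq (a + c) +oo.
  by rewrite acoo /= gt0_mulye// leey.
have [bdoo|bdoo] := eqVneq (b + d) +oo.
  by rewrite bdoo /= gt0_muley// leey.
move: a b c d a0 b0 c0 d0 acoo bdoo {ac0 bd0 pos sac sbd} =>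
  [a| |] [b| |] [c| |] [d| |]//= a0 b0 c0 d0 _ _; rewrite !lee_fin in a0 b0 c0 d0.
rewrite -!EFinM -EFinD lee_fin.
rewrite -ler_sqr ?nnegrE ?addr_ge0 ?mulr_ge0 ?sqrtr_ge0//.
rewrite exprMn !sqr_sqrtr ?addr_ge0//.
have := sqr_ge0 (Num.sqrt a * Num.sqrt d - Num.sqrt c * Num.sqrt b)%R.
have := sqr_sqrtr a0; have := sqr_sqrtr b0; have := sqr_sqrtr c0; have := sqr_sqrtr d0.
move: (Num.sqrt a) (Num.sqrt b) (Num.sqrt c) (Num.sqrt d) => p q r s <- <- <- <- h.
rewrite -subr_ge0; apply: le_trans h _; rewrite le_eqVlt; apply/orP; left; apply/eqP; ring.
Qed.

Lemma sum_sqrte_le (I : Type) (r : seq I) (P : pred I) (x y : I -> \bar R) :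
  (forall i, P i -> 0 <= x i) -> (forall i, P i -> 0 <= y i) ->
  \sum_(i <- r | P i) sqrte (x i) * sqrte (y i) <=
  sqrte (\sum_(i <- r | P i) x i) * sqrte (\sum_(i <- r | P i) y i).
Proof.
move=> x0 y0; elim: r => [|i r IH]; first by rewrite !big_nil sqrte0 mul0e.
rewrite !big_cons; case Pi : (P i) => //.
apply: le_trans (leeD (lexx _) IH) _; apply: sqrte_mul2_le.
- exact: x0.
- exact: y0.
- by apply: sume_ge0 => j; exact: x0.
- by apply: sume_ge0 => j; exact: y0.
Qed.

(** Hoelder's inequality for the exponent 2. *)
Lemma cauchy_schwarz_integral (dd : measure_display) (T : measurableType dd)
    (mu : {measure set T -> \bar R}) (S : set T) (f g : T -> R) :
  measurable S -> measurable_fun S f -> measurable_fun S g ->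
  \int[mu]_(x in S) `|f x * g x|%:E <=
  sqrte (\int[mu]_(x in S) (f x ^+ 2)%:E) * sqrte (\int[mu]_(x in S) (g x ^+ 2)%:E).
Proof.
move=> mS mf mg.
have mfS : measurable_fun setT (f \_ S) by apply/(measurable_restrictT _ mS).
have mgS : measurable_fun setT (g \_ S) by apply/(measurable_restrictT _ mS).
have half : (2^-1 + 2^-1 = 1 :> R)%R by lra.
have := hoelder mu mfS mgS (ltr0n _ 2) (ltr0n _ 2) half.
have N2 (k : T -> R) : Lnorm mu 2%:E (EFin \o (k \_ S)) =
    sqrte (\int[mu]_(x in S) (k x ^+ 2)%:E).
  rewrite unlock poweR12_sqrt; last by apply: integral_ge0 => x _; exact: poweR_ge0.
  congr sqrte; rewrite [RHS]integral_mkcond; apply: eq_integral => x _ /=.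
  rewrite powR_mulrn// real_normK ?num_real// !patchE.
  by case: ifP => // _; rewrite expr0n.
rewrite !N2 Lnorm1 => /(le_trans _); apply.
rewrite integral_mkcond le_eqVlt; apply/orP; left; apply/eqP.
apply: eq_integral => x _ /=; rewrite !patchE.
by case: ifP => // _; rewrite mul0r normr0.
Qed.

End cauchy_schwarz.

Section vector_cauchy_schwarz.
Context {R : realType} {n : nat}.
Variable mu : {measure set 'rV[R]_n -> \bar R}.
Implicit Types (S : set 'rV[R]_n) (q r : 'rV[R]_n -> 'rV[R]_n).

Definition vmeasurable S q : Prop := forall i, measurable_fun S (fun x => q x 0 i).

Lemma measurable_dotr S q r : vmeasurable S q -> vmeasurable S r ->
  measurable_fun S (fun x => dotr (q x) (r x)).
Proof.
by move=> mq mr; apply: measurable_sum => i; apply: measurable_funM.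
Qed.

Lemma measurable_enorm S q : vmeasurable S q -> measurable_fun S (fun x => enorm (q x)).
Proof.
move=> mq; apply: (measurableT_comp (f := @Num.sqrt R)).
  by apply: continuous_measurable_fun; exact: sqrt_continuous.
exact: measurable_dotr.
Qed.

Lemma L2_norm_sq_ge0 S q : (0 <= L2_norm_sq mu S q)%E.
Proof. by apply: integral_ge0 => x _; rewrite lee_fin sqr_ge0. Qed.

Lemma integral_abs_dotr_le S q r : measurable S -> vmeasurable S q -> vmeasurable S r ->
  (\int[mu]_(x in S) `|dotr (q x) (r x)|%:E <=
   sqrte (L2_norm_sq mu S q) * sqrte (L2_norm_sq mu S r))%E.
Proof.
move=> mS mq mr.
apply: le_trans (cauchy_schwarz_integral mu mS (measurable_enorm mq) (measurable_enorm mr)).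
apply: ge0_le_integral => //.
- apply/measurable_EFinP; apply: measurableT_comp => //; exact: measurable_dotr.
- apply/measurable_EFinP; apply: measurableT_comp => //.
  by apply: measurable_funM; exact: measurable_enorm.
- by move=> x _; rewrite lee_fin (le_trans (ler_abs_dotr _ _))// ler_norm.
Qed.

(** Holds without integrability: the real-valued integral is 0 when the extended
    one is infinite. *)
Lemma abs_Rintegral_le S (f : 'rV[R]_n -> R) : measurable S -> measurable_fun S f ->
  (`|\int[mu]_(x in S) f x|%:E <= \int[mu]_(x in S) `|f x|%:E)%E.
Proof.
move=> mS mf; have mfE : measurable_fun S (EFin \o f) by apply/measurable_EFinP.
have := le_abse_integral mu mS mfE.
by rewrite /Rintegral; case: (integral _ _ _) => [r| |] //=; rewrite ?normr0 => h;
  apply: integral_ge0.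
Qed.

(** The terms of the energy norm, with [h] the diameter for fluxes and its
    inverse for jumps. *)
Definition weighted_sq (h : R) S q : \bar R := (h%:E * L2_norm_sq mu S q)%E.

Lemma weighted_sq_ge0 (h : R) S q : 0 <= h -> (0 <= weighted_sq h S q)%E.
Proof. by move=> h0; rewrite mule_ge0 ?L2_norm_sq_ge0. Qed.

(** In a product of a flux and a jump the weights [h] and [h^-1] cancel; in the
    penalty term they are already there. *)
Lemma face_form_le S (a1 a2 j1 j2 : 'rV[R]_n -> 'rV[R]_n) (h m : R) :
  measurable S -> vmeasurable S a1 -> vmeasurable S a2 ->
  vmeasurable S j1 -> vmeasurable S j2 -> 0 < h -> 0 <= m ->
  (`|\int[mu]_(x in S) (dotr (a1 x) (j2 x) + dotr (a2 x) (j1 x) -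
      m / h * dotr (j1 x) (j2 x))|%:E <=
   sqrte (weighted_sq h S a1) * sqrte (weighted_sq h^-1 S j2) +
   sqrte (weighted_sq h^-1 S j1) * sqrte (weighted_sq h S a2) +
   m%:E * (sqrte (weighted_sq h^-1 S j1) * sqrte (weighted_sq h^-1 S j2)))%E.
Proof.
move=> mS ma1 ma2 mj1 mj2 h0 m0.
pose A q := weighted_sq h S q; pose J q := weighted_sq h^-1 S q.
change (`|\int[mu]_(x in S) (dotr (a1 x) (j2 x) + dotr (a2 x) (j1 x) -
      m / h * dotr (j1 x) (j2 x))|%:E <=
   sqrte (A a1) * sqrte (J j2) + sqrte (J j1) * sqrte (A a2) +
   m%:E * (sqrte (J j1) * sqrte (J j2)))%E.
have hV0 : 0 < h^-1 by rewrite invr_gt0.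
have m1 := measurable_dotr ma1 mj2; have m2 := measurable_dotr ma2 mj1.
have m3 := measurable_dotr mj1 mj2.
have m3' : measurable_fun S (fun x => m / h * dotr (j1 x) (j2 x)).
  by apply: measurable_funM.
have mabs (f : 'rV[R]_n -> R) : measurable_fun S f -> measurable_fun S (fun x => `|f x|%:E).
  by move=> mf; apply/measurable_EFinP; exact: measurableT_comp.
apply: le_trans (abs_Rintegral_le mS _) _.
  by apply: measurable_funB => //; exact: measurable_funD.
apply: (@le_trans _ _ (\int[mu]_(x in S) (`|dotr (a1 x) (j2 x)|%:E +
   `|dotr (a2 x) (j1 x)|%:E + (m / h)%:E * `|dotr (j1 x) (j2 x)|%:E))%E).
  apply: ge0_le_integral => //.
  - by apply: mabs; apply: measurable_funB => //; exact: measurable_funD.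
  - apply: emeasurable_funD; first by apply: emeasurable_funD; exact: mabs.
    by apply: measurable_funeM; exact: mabs.
  - move=> x _; rewrite -EFinM -!EFinD lee_fin (le_trans (ler_normB _ _))// lerD//.
      exact: ler_normD.
    by rewrite normrM ger0_norm// divr_ge0// ltW.
rewrite ge0_integralD//=; last 4 first.
- by move=> x _; rewrite adde_ge0.
- by apply: emeasurable_funD; exact: mabs.
- by move=> x _; rewrite mule_ge0// lee_fin divr_ge0// ltW.
- by apply: measurable_funeM; exact: mabs.
rewrite ge0_integralD//=; [|exact: mabs|exact: mabs].
rewrite ge0_integralZl//=; [|exact: mabs|by rewrite lee_fin divr_ge0// ltW].
have AJ q r : (sqrte (L2_norm_sq mu S q) * sqrte (L2_norm_sq mu S r) =
    sqrte (A q) * sqrte (J r))%E.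
  rewrite /A /J /weighted_sq !sqrteM ?lee_fin ?(ltW h0) ?(ltW hV0)//.
  rewrite muleACA -[X in (_ = X * _)%E]sqrteM ?lee_fin ?(ltW h0)//.
  by rewrite -EFinM mulfV ?gt_eqF//= sqrtr1 mul1e.
apply: leeD; first apply: leeD.
- by rewrite -AJ; exact: integral_abs_dotr_le.
- by rewrite muleC -AJ; exact: integral_abs_dotr_le.
- rewrite EFinM -muleA; apply: lee_wpmul2l; first by rewrite lee_fin.
  apply: (@le_trans _ _ (h^-1%:E * (sqrte (L2_norm_sq mu S j1) * sqrte (L2_norm_sq mu S j2)))%E).
    by apply: lee_wpmul2l; [rewrite lee_fin ltW|exact: integral_abs_dotr_le].
  rewrite /J /weighted_sq !sqrteM ?lee_fin ?(ltW hV0)// muleACA.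
  by rewrite -[X in (_ <= X * _)%E]sqrteM ?lee_fin ?(ltW hV0)// -EFinM /= -expr2 sqrtr_sqr gtr0_norm.
Qed.

End vector_cauchy_schwarz.

(** * Continuity of the bilinear form *)

Section sums_of_forms.
Context {R : realType} {n : nat}.
Variable nu : {measure set 'rV[R]_n -> \bar R}.

Lemma abs_sum_le (I : finType) (P : pred I) (r : I -> R) (b : I -> \bar R) :
  (forall i, P i -> `|r i|%:E <= b i)%E ->
  (`|\sum_(i | P i) r i|%:E <= \sum_(i | P i) b i)%E.
Proof.
move=> rb; apply: (@le_trans _ _ (\sum_(i | P i) `|r i|%:E)%E).
  by rewrite sumEFin lee_fin ler_norm_sum.
exact: lee_sum.
Qed.

Lemma sum_face_form_le (I : finType) (P : pred I) (S : I -> set 'rV[R]_n)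
    (a1 a2 j1 j2 : I -> 'rV[R]_n -> 'rV[R]_n) (h : I -> R) (m : R) (N1 N2 : \bar R) :
  (forall i, P i -> measurable (S i) /\ 0 < h i) ->
  (forall i, P i -> vmeasurable (S i) (a1 i) /\ vmeasurable (S i) (j1 i)) ->
  (forall i, P i -> vmeasurable (S i) (a2 i) /\ vmeasurable (S i) (j2 i)) ->
  0 <= m ->
  (sqrte (\sum_(i | P i) weighted_sq nu (h i) (S i) (a1 i)) <= N1)%E ->
  (sqrte (\sum_(i | P i) weighted_sq nu (h i)^-1 (S i) (j1 i)) <= N1)%E ->
  (sqrte (\sum_(i | P i) weighted_sq nu (h i) (S i) (a2 i)) <= N2)%E ->
  (sqrte (\sum_(i | P i) weighted_sq nu (h i)^-1 (S i) (j2 i)) <= N2)%E ->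
  (`|\sum_(i | P i) \int[nu]_(x in S i) (dotr (a1 i x) (j2 i x) + dotr (a2 i x) (j1 i x) -
      m / h i * dotr (j1 i x) (j2 i x))|%:E <= (2 + m)%:E * (N1 * N2))%E.
Proof.
move=> hS m1 m2 m0 A1 J1 A2 J2.
have hw i : P i -> 0 <= h i by move=> /hS [_ /ltW].
have hv i : P i -> 0 <= (h i)^-1 by move=> /hw; rewrite invr_ge0.
apply: le_trans.
  apply: abs_sum_le => i Pi; have [mS h0] := hS i Pi.
  have [ma1 mj1] := m1 i Pi; have [ma2 mj2] := m2 i Pi.
  exact: face_form_le.
have S0 (x : \bar R) : (0 <= sqrte x)%E by exact: sqrte_ge0.
have N10 : (0 <= N1)%E := le_trans (S0 _) A1.
have N20 : (0 <= N2)%E := le_trans (S0 _) A2.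
rewrite big_split /= big_split /= EFinD.
have -> : (((2%:E + m%:E) * (N1 * N2)) = N1 * N2 + N1 * N2 + m%:E * (N1 * N2))%E.
  by rewrite ge0_muleDl// mulr2n EFinD ge0_muleDl// mul1e.
have CS (w w' : I -> R) (q q' : I -> 'rV[R]_n -> 'rV[R]_n) :
    (forall i, P i -> 0 <= w i) -> (forall i, P i -> 0 <= w' i) ->
    (sqrte (\sum_(i | P i) weighted_sq nu (w i) (S i) (q i)) <= N1)%E ->
    (sqrte (\sum_(i | P i) weighted_sq nu (w' i) (S i) (q' i)) <= N2)%E ->
    (\sum_(i | P i) sqrte (weighted_sq nu (w i) (S i) (q i)) *
       sqrte (weighted_sq nu (w' i) (S i) (q' i)) <= N1 * N2)%E.
  move=> w0 w'0 q1 q2.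
  apply: (le_trans (@sum_sqrte_le _ _ _ _ (fun i => weighted_sq nu (w i) (S i) (q i))
    (fun i => weighted_sq nu (w' i) (S i) (q' i)) _ _)).
  - by move=> i /w0; exact: weighted_sq_ge0.
  - by move=> i /w'0; exact: weighted_sq_ge0.
  - exact: lee_pmul.
apply: leeD; first apply: leeD.
- exact: CS.
- exact: (@CS (fun i => (h i)^-1)).
- rewrite -ge0_sume_distrr; last by move=> i _; rewrite mule_ge0.
  apply: lee_wpmul2l; first by rewrite lee_fin.
  exact: (@CS (fun i => (h i)^-1) (fun i => (h i)^-1)).
Qed.

End sums_of_forms.

Section mesh_functions.
Context {R : realType} {n : nat} (T : mesh R n.+1).
Implicit Types (V K e : {set 'I_(nnodes T)}) (x y z : 'rV[R]_n.+1)
  (u v w : 'rV[R]_n.+1 -> R).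
Variables (Om Om0 : set 'rV[R]_n.+1) (sigma : R).
Variable intK : {set 'I_(nnodes T)} -> {set 'I_(nnodes T)}.
Variables (m : nat) (cs : bool).
Hypotheses (n0 : (0 < n)%N) (oOm0 : open Om0).
Hypothesis adm : admissible_mesh Om0 Om sigma intK.
Local Notation leb := (lebesgue_rV n.+1).
Local Notation surf := (@hausdorff R n.+1 n).

Lemma admissible_tr : triangulation T Om. Proof. by case: adm => -[]. Qed.
Lemma admissible_qu : quasi_uniform T sigma. Proof. by case: adm => -[]. Qed.
Let tr := admissible_tr.
Let qu := admissible_qu.

Lemma cells0_elements K : K \in cells0 T Om0 -> K \in elements T.
Proof. by rewrite inE => /andP[]. Qed.

Lemma cells_cut_elements K : K \in cells_cut T Om0 -> K \in elements T.
Proof. by rewrite inE => /andP[]. Qed.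

Lemma cells_cut_cells0 K : K \in cells_cut T Om0 -> K \in cells0 T Om0.
Proof. by case: adm => _ -> _ _ _; rewrite inE => /andP[]. Qed.

Lemma faces0_faces e : e \in faces0 T Om0 -> e \in faces T.
Proof. by rewrite inE => /andP[]. Qed.

Lemma cells0_intP K : K \in cells0_int T Om0 -> K \in elements T /\ simplex K `<=` Om0.
Proof. by rewrite inE => /andP[/cells0_elements KT /asboolP]. Qed.

(** The uncut element on which the polynomial of [K] lives: for a cut element
    the assigned one, otherwise the element itself. *)
Definition source K := if K \in cells_cut T Om0 then intK K else K.

Lemma source_int K : K \in cells0 T Om0 -> source K \in cells0_int T Om0.
Proof.
case: adm => _ cut _ _ ad K0; rewrite /source; case: ifPn => [/ad|].
  by rewrite inE => /andP[].
by rewrite cut inE K0 andbT negbK.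
Qed.

Lemma source_adjacent K : K = source K \/ source K \in Defs.adjacent K.
Proof.
case: adm => _ _ _ _ ad; rewrite /source; case: ifPn => [/ad|_]; last by left.
by rewrite inE => /andP[]; right.
Qed.

(** The extension is built so that one polynomial serves on [K] and on its
    source. *)
Lemma Vh_poly w K : Vh Om0 intK m cs w -> K \in cells0 T Om0 ->
  exists2 p, poly_fun m p &
    (forall x, simplex K x -> w x = p x) /\ (forall x, simplex (source K) x -> w x = p x).
Proof.
move=> [v [vP _] [wint wcut]] K0; have sint := source_int K0; move: sint.
rewrite /source; case: ifPn => [Kc|_] sint.
  have [p pm [p1 p2]] := wcut K Kc; exists p => //; split => // x xK.
  by rewrite (wint _ _ sint xK) p1.
have [p pm p1] := vP K sint; exists p => //.
by split => x xK; rewrite (wint _ _ sint xK) p1.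
Qed.

Lemma measurable_cell K : K \in elements T -> measurable (simplex K `&` Om0).
Proof.
move=> KT; apply: measurableI; first exact: (measurable_element tr).
exact: open_measurable_rV.
Qed.

Lemma measurable_face0 e : e \in faces0 T Om0 -> measurable (simplex e `&` Om0).
Proof.
move=> /faces0_faces ef; apply: measurableI; first exact: (measurable_face tr).
exact: open_measurable_rV.
Qed.

Lemma measurable_interface K : K \in elements T -> measurable (simplex K `&` frontier Om0).
Proof.
move=> KT; apply: measurableI; first exact: (measurable_element tr).
apply: measurableD; first by apply: closed_measurable_rV; exact: closed_closure.
by apply: open_measurable_rV; exact: open_interior.
Qed.

(** An element that does not meet the domain contributes the empty set, on which
    the function may be arbitrary. *)
Lemma measurable_Vh w K : Vh Om0 intK m cs w -> K \in elements T ->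
  measurable_fun (simplex K `&` Om0) w.
Proof.
move=> wV KT.
have [K0|K0] := boolP (K \in cells0 T Om0); last first.
  rewrite (_ : _ `&` _ = classical_sets.set0); first exact: measurable_fun_set0.
  apply/eqP/negPn/negP => /set0P h; move/negP: K0; apply.
  by rewrite inE KT; apply/asboolP.
have [p pm [wp _]] := Vh_poly wV K0; have [cp _] := poly_fun_derive pm.
apply: (eq_measurable_fun p); first by move=> x /set_mem[xK _]; rewrite wp.
exact: measurable_funS (continuous_measurable_rV cp).
Qed.

Lemma measurable_energy u K : Vh_plus_H2 Om0 intK m cs u -> K \in elements T ->
  measurable_fun (simplex K `&` Om0) u.
Proof.
move=> [w [f [wV [[mf _] _] ->]]] KT.
apply: measurable_funD; first exact: measurable_Vh.
by apply: measurable_funS mf => //; exact: open_measurable_rV.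
Qed.

Section traces_measurable.
Variable u : 'rV[R]_n.+1 -> R.
Hypothesis mu : forall K, K \in elements T -> measurable_fun (simplex K `&` Om0) u.

Lemma measurable_cell_trace K : K \in elements T -> measurable_fun setT (cell_trace Om0 K u).
Proof. by move=> KT; apply: measurable_trace; [exact: measurable_cell|exact: mu]. Qed.

Lemma measurable_grad_trace K S : K \in elements T -> measurable S ->
  vmeasurable S (grad_trace Om0 K u).
Proof.
move=> KT mS i; under eq_fun do rewrite mxE.
apply: (measurable_funS measurableT) => //; apply: measurable_trace.
  exact: measurable_cell.
exact: measurable_weak_gradient.
Qed.

Lemma measurable_bnd_jump K S : K \in elements T -> measurable S ->
  vmeasurable S (bnd_jump Om0 K u).
Proof.
move=> KT mS i; under eq_fun do rewrite mxE.
apply: (measurable_funS measurableT) => //; apply: measurable_funM.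
  exact: measurable_cell_trace.
exact: measurable_outward_normal.
Qed.

Lemma measurable_jump e S : measurable S -> vmeasurable S (jump Om0 e u).
Proof.
move=> mS i; apply: (measurable_funS measurableT) => //.
under eq_fun do rewrite /jump summxE big_mkcond /=.
apply: (@measurable_sum _ _ _ _ _ _ (fun K x => if (K \in elements T) && (e \subset K)
  then (cell_trace Om0 K u x *: face_normal K e) 0 i else 0)) => K.
case KTe : ((K \in elements T) && (e \subset K)); last exact: measurable_cst.
have /andP[KT _] := KTe.
under eq_fun do rewrite mxE.
by apply: measurable_funM; [exact: measurable_cell_trace|exact: measurable_cst].
Qed.

Lemma measurable_average_grad e S : measurable S -> vmeasurable S (average_grad Om0 e u).
Proof.
move=> mS i; apply: (measurable_funS measurableT) => //.
under eq_fun do rewrite /average_grad mxE summxE big_mkcond /=.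
apply: measurable_funM; first exact: measurable_cst.
apply: (@measurable_sum _ _ _ _ _ _ (fun K x => if (K \in elements T) && (e \subset K)
  then grad_trace Om0 K u x 0 i else 0)) => K.
case KTe : ((K \in elements T) && (e \subset K)); last exact: measurable_cst.
have /andP[KT _] := KTe.
exact: (measurable_grad_trace KT measurableT).
Qed.

End traces_measurable.


Lemma face_diam_gt0 e : e \in faces0 T Om0 -> 0 < diam e.
Proof. by move=> /faces0_faces; exact: (diam_face_gt0 tr). Qed.

Definition gradient_energy w : \bar R :=
  (\sum_(K in cells0 T Om0) L2_norm_sq leb (simplex K `&` Om0) (grad Om0 K w))%E.

Definition face_flux w : \bar R :=
  (\sum_(e in faces0 T Om0)
    weighted_sq surf (diam e) (simplex e `&` Om0) (average_grad Om0 e w))%E.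

Definition face_jump w : \bar R :=
  (\sum_(e in faces0 T Om0)
    weighted_sq surf (diam e)^-1 (simplex e `&` Om0) (jump Om0 e w))%E.

Definition interface_flux w : \bar R :=
  (\sum_(K in cells_cut T Om0)
    weighted_sq surf (diam K) (simplex K `&` frontier Om0) (grad_trace Om0 K w))%E.

Definition interface_jump w : \bar R :=
  (\sum_(K in cells_cut T Om0)
    weighted_sq surf (diam K)^-1 (simplex K `&` frontier Om0) (bnd_jump Om0 K w))%E.

Lemma dg_normE w : dg_norm T Om0 w = sqrte (gradient_energy w + face_flux w +
  face_jump w + interface_flux w + interface_jump w)%E.
Proof. by []. Qed.

Lemma cut_diam_gt0 K : K \in cells_cut T Om0 -> 0 < diam K.
Proof. by move=> /cells_cut_elements; exact: (diam_element_gt0 tr). Qed.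

Lemma energies_ge0 w : [/\ (0 <= gradient_energy w)%E, (0 <= face_flux w)%E,
  (0 <= face_jump w)%E, (0 <= interface_flux w)%E & (0 <= interface_jump w)%E].
Proof.
split; apply: sume_ge0 => i; first by move=> _; exact: L2_norm_sq_ge0.
- by move=> /face_diam_gt0/ltW; exact: weighted_sq_ge0.
- by move=> /face_diam_gt0 d0; apply: weighted_sq_ge0; rewrite invr_ge0 ltW.
- by move=> /cut_diam_gt0/ltW; exact: weighted_sq_ge0.
- by move=> /cut_diam_gt0 d0; apply: weighted_sq_ge0; rewrite invr_ge0 ltW.
Qed.

Theorem a_h_continuous (mu : R) u v : 0 <= mu ->
  Vh_plus_H2 Om0 intK m cs u -> Vh_plus_H2 Om0 intK m cs v ->
  (`|a_h T Om0 mu u v|%:E <=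
   (5 + 2 * mu)%:E * (dg_norm T Om0 u * dg_norm T Om0 v))%E.
Proof.
move=> mu0 uV vV.
have mtu K (KT : K \in elements T) := measurable_energy uV KT.
have mtv K (KT : K \in elements T) := measurable_energy vV KT.
have parts w : [/\ (sqrte (gradient_energy w) <= dg_norm T Om0 w)%E,
    (sqrte (face_flux w) <= dg_norm T Om0 w)%E,
    (sqrte (face_jump w) <= dg_norm T Om0 w)%E,
    (sqrte (interface_flux w) <= dg_norm T Om0 w)%E &
    (sqrte (interface_jump w) <= dg_norm T Om0 w)%E].
  have [g1 g2 g3 g4 g5] := energies_ge0 w.
  rewrite dg_normE; move: g1 g2 g3 g4 g5.
  move: (gradient_energy w) (face_flux w) (face_jump w) (interface_flux w)
    (interface_jump w) => a b c e f a0 b0 c0 e0 f0.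
  split; rewrite lee_sqrt ?adde_ge0//.
  - by rewrite -!addeA leeDl// !adde_ge0.
  - by rewrite -addeA -addeA [X in (_ <= X + _)%E]addeC -addeA leeDl// !adde_ge0.
  - by rewrite -addeA [X in (_ <= X + _)%E]addeC -addeA leeDl// !adde_ge0.
  - by rewrite [X in (_ <= X + _)%E]addeC -addeA leeDl// !adde_ge0.
  - by rewrite addeC leeDl// !adde_ge0.
have [u1 u2 u3 u4 u5] := parts u; have [v1 v2 v3 v4 v5] := parts v.
set Nu := dg_norm T Om0 u in u1 u2 u3 u4 u5 *.
set Nv := dg_norm T Om0 v in v1 v2 v3 v4 v5 *.
have N0 : (0 <= Nu * Nv)%E by apply: mule_ge0; exact: sqrte_ge0.
rewrite /a_h; set s1 := (X in X - _ - _); set s2 := (X in _ - X - _); set s3 := (X in _ - X).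
have b1 : (`|s1|%:E <= Nu * Nv)%E.
  apply: (@le_trans _ _ (\sum_(K in cells0 T Om0)
    sqrte (L2_norm_sq leb (simplex K `&` Om0) (grad Om0 K u)) *
    sqrte (L2_norm_sq leb (simplex K `&` Om0) (grad Om0 K v)))%E).
    apply: abs_sum_le => K /cells0_elements KT; have mK := measurable_cell KT.
    have mg w : vmeasurable (simplex K `&` Om0) (grad Om0 K w).
      by move=> i; exact: measurable_weak_gradient.
    apply: le_trans (@abs_Rintegral_le _ _ leb _ _ mK _) _; first exact: measurable_dotr.
    exact: (@integral_abs_dotr_le _ _ leb).
  apply: le_trans (sum_sqrte_le _ _ _) _ => [K _|K _|]; try exact: L2_norm_sq_ge0.
  exact: (lee_pmul (sqrte_ge0 _) (sqrte_ge0 _) u1 v1).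
have face_ok e : e \in faces0 T Om0 -> measurable (simplex e `&` Om0) /\ 0 < diam e.
  by move=> e0; split; [exact: measurable_face0|exact: face_diam_gt0].
have cut_ok K : K \in cells_cut T Om0 ->
    measurable (simplex K `&` frontier Om0) /\ 0 < diam K.
  move=> Kc; split; last exact: cut_diam_gt0.
  exact: measurable_interface (cells_cut_elements Kc).
have fm w : (forall K, K \in elements T -> measurable_fun (simplex K `&` Om0) w) ->
    forall e, e \in faces0 T Om0 -> vmeasurable (simplex e `&` Om0) (average_grad Om0 e w) /\
      vmeasurable (simplex e `&` Om0) (jump Om0 e w).
  move=> mw e /face_ok[mS _].
  by split; [exact: measurable_average_grad|exact: measurable_jump].
have cm w : (forall K, K \in elements T -> measurable_fun (simplex K `&` Om0) w) ->
    forall K, K \in cells_cut T Om0 ->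
      vmeasurable (simplex K `&` frontier Om0) (grad_trace Om0 K w) /\
      vmeasurable (simplex K `&` frontier Om0) (bnd_jump Om0 K w).
  move=> mw K Kc; have KT := cells_cut_elements Kc; have [mS _] := cut_ok K Kc.
  by split; [exact: measurable_grad_trace|exact: measurable_bnd_jump].
have b2 : (`|s2|%:E <= (2 + mu)%:E * (Nu * Nv))%E.
  exact: (@sum_face_form_le _ _ surf _ (fun e => e \in faces0 T Om0)
    (fun e => simplex e `&` Om0) (fun e => average_grad Om0 e u)
    (fun e => average_grad Om0 e v) (fun e => jump Om0 e u) (fun e => jump Om0 e v)
    (@diam _ _ T) mu Nu Nv face_ok (fm u mtu) (fm v mtv) mu0 u2 u3 v2 v3).
have b3 : (`|s3|%:E <= (2 + mu)%:E * (Nu * Nv))%E.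
  exact: (@sum_face_form_le _ _ surf _ (fun K => K \in cells_cut T Om0)
    (fun K => simplex K `&` frontier Om0) (fun K => grad_trace Om0 K u)
    (fun K => grad_trace Om0 K v) (fun K => bnd_jump Om0 K u) (fun K => bnd_jump Om0 K v)
    (@diam _ _ T) mu Nu Nv cut_ok (cm u mtu) (cm v mtv) mu0 u4 u5 v4 v5).
clearbody s1 s2 s3 Nu Nv.
apply: (@le_trans _ _ (`|s1|%:E + `|s2|%:E + `|s3|%:E)%E).
  rewrite -!EFinD lee_fin (le_trans (ler_normB _ _))// lerD2r.
  exact: ler_normB.
apply: le_trans (leeD (leeD b1 b2) b3) _.
have -> : 5 + 2 * mu = 1 + (2 + mu) + (2 + mu) by ring.
by rewrite !EFinD !ge0_muleDl ?adde_ge0 ?lee_fin// ?mul1e.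
Qed.

End mesh_functions.

(** * Young inequality on a face *)

Section young.
Context {R : realType} {n : nat}.
Variable nu : {measure set 'rV[R]_n -> \bar R}.
Implicit Types (S : set 'rV[R]_n) (q a j : 'rV[R]_n -> 'rV[R]_n).

(** Discrete functions have bounded traces and bounded jumps, so all integrals
    in the coercivity estimate are finite. *)
Definition vbounded S q : Prop := exists M : R, forall x, S x -> enorm (q x) <= M.

Lemma integrable_dotr S q r : measurable S -> (nu S < +oo)%E ->
  vmeasurable S q -> vmeasurable S r -> vbounded S q -> vbounded S r ->
  nu.-integrable S (EFin \o (fun x => dotr (q x) (r x))).
Proof.
move=> mS Soo mq mr [M qM] [N rN].
apply: (@integrable_of_bounded _ _ _ _ _ _ (`|M| * `|N|)) => //.
  exact: measurable_dotr.
move=> x Sx; apply: le_trans (ler_abs_dotr _ _) _.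
apply: ler_pM; rewrite ?enorm_ge0//.
- exact: le_trans (qM x Sx) (ler_norm M).
- exact: le_trans (rN x Sx) (ler_norm N).
Qed.

Lemma L2_norm_sq_fin S q : measurable S -> (nu S < +oo)%E ->
  vmeasurable S q -> vbounded S q ->
  L2_norm_sq nu S q = (\int[nu]_(x in S) dotr (q x) (q x))%:E.
Proof.
move=> mS Soo mq bq; rewrite /L2_norm_sq /Rintegral fineK.
  by apply: eq_integral => x _; rewrite sqr_enorm.
exact: integrable_fin_num (integrable_dotr mS Soo mq mq bq bq).
Qed.

Lemma L2_norm_sq_le S q (B : R) : measurable S -> vmeasurable S q -> 0 <= B ->
  (forall x, S x -> enorm (q x) ^+ 2 <= B) -> (L2_norm_sq nu S q <= B%:E * nu S)%E.
Proof.
move=> mS mq B0 qB; rewrite -integral_cst//; apply: ge0_le_integral => //.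
- by move=> x _; rewrite lee_fin sqr_ge0.
- by apply/measurable_EFinP; apply: measurable_funX; exact: measurable_enorm.
Qed.

Lemma integrable_lin S (f g : 'rV[R]_n -> R) (c c' : R) : measurable S ->
  nu.-integrable S (EFin \o f) -> nu.-integrable S (EFin \o g) ->
  nu.-integrable S (EFin \o (fun x => c * f x + c' * g x)).
Proof.
move=> mS fi gi; have ci := integrableZl mS c fi; have c'i := integrableZl mS c' gi.
by apply: eq_integrable (integrableD mS ci c'i) => // x _ /=; rewrite EFinD !EFinM.
Qed.

Lemma Rintegral_lin S (f g : 'rV[R]_n -> R) (c c' : R) : measurable S ->
  nu.-integrable S (EFin \o f) -> nu.-integrable S (EFin \o g) ->
  \int[nu]_(x in S) (c * f x + c' * g x) =
  c * (\int[nu]_(x in S) f x) + c' * (\int[nu]_(x in S) g x).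
Proof.
move=> mS fi gi; have iz (k : 'rV[R]_n -> R) (r : R) : nu.-integrable S (EFin \o k) ->
    nu.-integrable S (EFin \o (fun x => r * k x)).
  by move=> ki; have := integrableZl mS r ki; apply: eq_integrable => // x _ /=; rewrite EFinM.
by rewrite RintegralD ?RintegralZl//; exact: iz.
Qed.

Lemma young_dotr (p : R) (a j : 'rV[R]_n) : 0 < p ->
  2 * dotr a j <= p * dotr a a + p^-1 * dotr j j.
Proof.
move=> p0; have := dotrr_ge0 (p *: a - j).
rewrite dotrBl !dotrBr !dotrZl !dotrZr (dotrC j a).
move: (dotr a a) (dotr a j) (dotr j j) => A X J h.
rewrite -(ler_pM2l p0) mulrDr mulrA mulrA [p * (p^-1 * J)]mulrA mulfV ?gt_eqF//.
by move: h; rewrite mul1r; lra.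
Qed.

(** The parameter [delta] weighs the flux, to be absorbed by the gradient
    energy, against the jump, to be absorbed by the penalty. *)
Lemma face_form_young S a j (h m delta : R) : measurable S -> (nu S < +oo)%E ->
  vmeasurable S a -> vmeasurable S j -> vbounded S a -> vbounded S j ->
  0 < h -> 0 < delta ->
  [/\ weighted_sq nu h S a \is a fin_num, weighted_sq nu h^-1 S j \is a fin_num &
  \int[nu]_(x in S) (dotr (a x) (j x) + dotr (a x) (j x) - m / h * dotr (j x) (j x)) <=
  delta * fine (weighted_sq nu h S a) - (m - delta^-1) * fine (weighted_sq nu h^-1 S j)].
Proof.
move=> mS Soo ma mj ba bj h0 d0.
have iaj := integrable_dotr mS Soo ma mj ba bj.
have iaa := integrable_dotr mS Soo ma ma ba ba.
have ijj := integrable_dotr mS Soo mj mj bj bj.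
rewrite /weighted_sq !L2_norm_sq_fin// -!EFinM; split => //=.
set A := \int[nu]_(x in S) dotr (a x) (a x); set J := \int[nu]_(x in S) dotr (j x) (j x).
have -> : \int[nu]_(x in S) (dotr (a x) (j x) + dotr (a x) (j x) - m / h * dotr (j x) (j x)) =
    \int[nu]_(x in S) (2 * dotr (a x) (j x) + - (m / h) * dotr (j x) (j x)).
  by congr Rintegral; apply/funext => x; ring.
rewrite (_ : _ - _ = \int[nu]_(x in S) (delta * h * dotr (a x) (a x) +
   - ((m - delta^-1) / h) * dotr (j x) (j x))); last first.
  by rewrite Rintegral_lin// -/A -/J; ring.
apply: le_Rintegral => //; [exact: integrable_lin|exact: integrable_lin|].
move=> x _; have := @young_dotr (delta * h) (a x) (j x) (mulr_gt0 d0 h0).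
rewrite invfM; lra.
Qed.

End young.

(** * Inverse estimates for discrete functions *)

Section discrete_gradients.
Context {R : realType} {n : nat} (T : mesh R n.+1).
Implicit Types (V K e : {set 'I_(nnodes T)}) (x y z : 'rV[R]_n.+1).
Variables (Om Om0 : set 'rV[R]_n.+1) (sigma : R).
Variable intK : {set 'I_(nnodes T)} -> {set 'I_(nnodes T)}.
Variables (m : nat) (cs : bool).
Hypotheses (n0 : (0 < n)%N) (oOm0 : open Om0).
Hypothesis adm : admissible_mesh Om0 Om sigma intK.
Variable w : 'rV[R]_n.+1 -> R.
Hypothesis wV : Vh Om0 intK m cs w.
Local Notation leb := (lebesgue_rV n.+1).
Local Notation surf := (@hausdorff R n.+1 n).
Local Notation h := (mesh_size T).
Local Notation src := (source Om0 intK).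
Let tr := admissible_tr adm.
Let qu := admissible_qu adm.

Let mw K (KT : K \in elements T) := measurable_Vh adm wV KT.

(** The weak gradients on [K] and on its source are almost everywhere the
    gradient of a single polynomial. *)
Lemma gradient_poly K : K \in cells0 T Om0 -> exists p' : 'I_n.+1 -> 'rV[R]_n.+1 -> R,
  [/\ forall i, continuous (p' i), forall i, coord_poly m (p' i),
      forall i, {ae leb, forall x, (simplex K `&` Om0) x -> grad Om0 K w x 0 i = p' i x} &
      forall i, {ae leb, forall x, (simplex (src K) `&` Om0) x ->
        grad Om0 (src K) w x 0 i = p' i x}].
Proof.
move=> K0; have [p pm [wK wS]] := Vh_poly adm wV K0.
have [cp [p' pP]] := poly_fun_derive pm.
have cell_open K1 : K1 \in elements T -> open (simplex K1 `&` Om0).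
  move=> KT; apply: openI => //; apply: simplex_open.
    exact: (element_card tr).
  exact: (element_indep tr).
have [ST _] := cells0_intP (source_int adm K0).
exists p'; split => i; try by case: (pP i).
- apply: (weak_gradient_classical _ cp) => //; first exact: cell_open (cells0_elements K0).
  + by move=> j; case: (pP j).
  + by move=> j x; case: (pP j).
  + by move=> x [/wK].
- apply: (weak_gradient_classical _ cp) => //; first exact: cell_open.
  + by move=> j; case: (pP j).
  + by move=> j x; case: (pP j).
  + by move=> x [/wS].
Qed.

Definition cell_energy K : \bar R := L2_norm_sq leb (simplex K `&` Om0) (grad Om0 K w).

Lemma cell_energy_ge0 K : (0 <= cell_energy K)%E.
Proof. exact: L2_norm_sq_ge0. Qed.

Lemma vmeasurable_grad K : vmeasurable (simplex K `&` Om0) (grad Om0 K w).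
Proof. by move=> i; exact: measurable_weak_gradient. Qed.

(** From [coord_poly_sqr_le] with a cube of side [h / cube_ratio], in which the
    distance [2 * h] amounts to [2 * cube_ratio] sides. *)
Definition inverse_const : R :=
  (poly_const m (2 * @cube_ratio R n sigma) * @cube_ratio R n sigma) ^+ n.+1.

Lemma inverse_const_gt0 K : K \in elements T -> 0 < inverse_const.
Proof.
move=> KT; have [c0 _] := inscribed_cube tr qu KT.
by rewrite exprn_gt0// mulr_gt0// poly_const_gt0// mulr_ge0// ltW.
Qed.

Lemma inverse_scale_ge0 K : K \in elements T -> 0 <= inverse_const / h ^+ n.+1.
Proof.
move=> KT; apply: divr_ge0; first exact: ltW (inverse_const_gt0 KT).
by rewrite exprn_ge0// ltW// (mesh_size_gt0 tr KT).
Qed.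

(** The cube is inscribed in the source, which lies in the domain and at
    distance at most [2 * h] from the points of [K]. The part of [K] inside the
    domain does not enter. *)
Lemma gradient_sup K (q : 'rV[R]_n.+1 -> R) i x : K \in cells0 T Om0 ->
  continuous q -> coord_poly m q ->
  {ae leb, forall y, (simplex (src K) `&` Om0) y -> grad Om0 (src K) w y 0 i = q y} ->
  simplex K x -> ((q x ^+ 2)%:E <= (inverse_const / h ^+ n.+1)%:E * cell_energy (src K))%E.
Proof.
move=> K0 cq pq qae xK; have KT := cells0_elements K0.
have [ST SOm] := cells0_intP (source_int adm K0).
have [c0 [a aS]] := inscribed_cube tr qu ST; have h0 := mesh_size_gt0 tr KT.
set c := cube_ratio _ in c0 aS *.
have l0 : 0 < h / c by rewrite divr_gt0.
have mq := continuous_measurable_rV cq.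
have mqS : measurable_fun (simplex (src K) `&` Om0) (fun y => (q y ^+ 2)%:E).
  apply/measurable_EFinP; apply: measurable_funX.
  exact: (measurable_funS measurableT).
have xa j : `|x 0 j - a 0 j| <= 2 * c * (h / c).
  have aS' : simplex (src K) a by apply: aS => k; rewrite lexx lerDl ltW.
  rewrite -mulrA [c * _]mulrC divfK ?gt_eqF//.
  have -> : x 0 j - a 0 j = (x - a) 0 j by rewrite !mxE.
  apply: le_trans (coord_le_enorm _ _) _.
  have [KE|adj] := source_adjacent adm K; last exact: (enorm_le_adjacent KT adj).
  rewrite -KE in aS'; apply: le_trans (enorm_le_diam xK aS') _.
  by have := diam_le_mesh_size KT; lra.
apply: le_trans (coord_poly_sqr_le mq pq l0 _ xa) _.
  by rewrite mulr_ge0// ltW.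
have -> : (poly_const m (2 * c) / (h / c)) ^+ n.+1 = inverse_const / h ^+ n.+1.
  by rewrite /inverse_const -/c invf_div mulrA expr_div_n.
apply: lee_wpmul2l.
  by rewrite lee_fin (inverse_scale_ge0 KT).
have mS := measurable_cell oOm0 adm ST.
apply: le_trans.
  apply: (@ge0_subset_integral _ _ _ leb _ (simplex (src K) `&` Om0)) => //.
  - exact: measurable_cube.
  - by move=> y _; rewrite lee_fin sqr_ge0.
  - by move=> y /aS yS; split => //; exact: SOm.
apply: ae_ge0_le_integral => //.
- by move=> y _; rewrite lee_fin sqr_ge0.
- by move=> y _; rewrite lee_fin sqr_ge0.
- apply/measurable_EFinP; apply: measurable_funX; apply: measurable_enorm.
  exact: vmeasurable_grad.
apply: filterS qae => y qy /[dup] yS /qy <-; rewrite lee_fin -ler_sqrt ?sqr_ge0//.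
by rewrite !sqrtr_sqr [X in _ <= X]ger0_norm ?enorm_ge0// coord_le_enorm.
Qed.

Lemma cell_sub_compact K : exists2 M, 0 < M & simplex K `<=` @ccube R n.+1 M.
Proof.
exists (1 + \sum_(i in K) enorm (node i)).
  by rewrite ltr_pwDl// sumr_ge0// => i _; exact: enorm_ge0.
move=> x xK; apply/ccubeP => i; apply: le_trans (coord_le_enorm _ _) _.
by apply: le_trans (simplex_bounded xK) _; rewrite lerDr.
Qed.

Lemma cell_lty K : K \in elements T -> (leb (simplex K `&` Om0) < +oo)%E.
Proof.
move=> KT; have [M _ KM] := cell_sub_compact K.
apply: le_lt_trans (@ccube_lty R n.+1 M); apply: le_measure; rewrite ?inE.
- exact: (measurable_cell oOm0 adm).
- exact: measurable_cube.
- by move=> x [/KM].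
Qed.

Lemma bounded_on_cell K (q : 'rV[R]_n.+1 -> R) : continuous q ->
  exists2 M, 0 <= M & forall x, simplex K x -> `|q x| <= M.
Proof.
move=> cq; have [M _ KM] := cell_sub_compact K.
have [B qB] := continuous_bounded_on_compact cq (@compact_ccube R n.+1 M).
by exists `|B| => // x /KM/qB/le_trans; apply; exact: ler_norm.
Qed.

Lemma cell_energy_fin K : K \in cells0 T Om0 -> cell_energy K \is a fin_num.
Proof.
move=> K0; have KT := cells0_elements K0.
have [p' [cp' _ pK _]] := gradient_poly K0.
have [B B0 pB] : exists2 B : 'I_n.+1 -> R, (forall i, 0 <= B i) &
    forall i x, simplex K x -> `|p' i x| <= B i.
  have /choice[B BP] : forall i, exists B, 0 <= B /\ forall x, simplex K x -> `|p' i x| <= B.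
    by move=> i; have [M M0 MP] := bounded_on_cell K (cp' i); exists M.
  by exists B => i; case: (BP i).
have mK := measurable_cell oOm0 adm KT.
rewrite ge0_fin_numE ?cell_energy_ge0//.
apply: (@le_lt_trans _ _ (\int[leb]_(x in simplex K `&` Om0) (\sum_i B i ^+ 2)%:E)%E); last first.
  rewrite integral_cst// lte_mul_pinfty// ?lee_fin ?sumr_ge0// => [i _|]; last exact: cell_lty.
  exact: sqr_ge0.
apply: ae_ge0_le_integral => //.
- by move=> x _; rewrite lee_fin sqr_ge0.
- apply/measurable_EFinP; apply: measurable_funX; apply: measurable_enorm.
  exact: vmeasurable_grad.
- by move=> x _; rewrite lee_fin sumr_ge0// => i _; exact: sqr_ge0.
have : {ae leb, forall x, forall i, (simplex K `&` Om0) x -> grad Om0 K w x 0 i = p' i x}.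
  exact: filter_forall.
apply: filterS => x gp xK; rewrite lee_fin sqr_enorm; apply: ler_sum => i _.
rewrite -expr2 gp// -(real_normK (num_real _)) lerXn2r ?nnegrE ?B0//.
by apply: pB; case: xK.
Qed.

Definition trace_const : R := n.+1%:R * inverse_const.

(** The bound holds on the whole element, hence for limits of means over any
    part of it. *)
Lemma grad_trace_le K x : K \in cells0 T Om0 ->
  enorm (grad_trace Om0 K w x) ^+ 2 <= trace_const / h ^+ n.+1 * fine (cell_energy (src K)).
Proof.
move=> K0; have KT := cells0_elements K0.
have [p' [cp' pp' pK pS]] := gradient_poly K0.
have S0 : src K \in cells0 T Om0.
  by have := source_int adm K0; rewrite inE => /andP[].
have h0 := mesh_size_gt0 tr KT.
set E := fine _.
have EE : cell_energy (src K) = E%:E by rewrite fineK ?cell_energy_fin.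
have E0 : 0 <= E by rewrite fine_ge0// cell_energy_ge0.
have B0 : 0 <= inverse_const / h ^+ n.+1 * E.
  by rewrite mulr_ge0// (inverse_scale_ge0 KT).
have tr_le i : `|grad_trace Om0 K w x 0 i| <= Num.sqrt (inverse_const / h ^+ n.+1 * E).
  rewrite mxE; apply: trace_le.
  - exact: (measurable_cell oOm0 adm).
  - exact: cell_lty.
  - exact: measurable_weak_gradient.
  - exact: sqrtr_ge0.
  - apply: filterS (pK i) => y gp yK; rewrite gp//.
    have := gradient_sup K0 (cp' i) (pp' i) (pS i) yK.1.
    by rewrite EE -EFinM lee_fin -sqrtr_sqr ler_sqrt.
rewrite sqr_enorm /trace_const.
apply: (@le_trans _ _ (\sum_(i < n.+1) inverse_const / h ^+ n.+1 * E)).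
  apply: ler_sum => i _; rewrite -expr2 -(real_normK (num_real _)).
  by rewrite -[leRHS]sqr_sqrtr// lerXn2r ?nnegrE ?sqrtr_ge0.
rewrite sumr_const card_ord le_eqVlt; apply/orP; left; apply/eqP.
by rewrite -[LHS]mulr_natl; ring.
Qed.

Lemma cell_trace_bounded K : K \in cells0 T Om0 ->
  exists2 M, 0 <= M & forall x, `|cell_trace Om0 K w x| <= M.
Proof.
move=> K0; have KT := cells0_elements K0.
have [p pm [wp _]] := Vh_poly adm wV K0; have [cp _] := poly_fun_derive pm.
have [M M0 MP] := bounded_on_cell K cp; exists M => // x.
apply: trace_le => //.
- exact: (measurable_cell oOm0 adm).
- exact: cell_lty.
- exact: mw.
- by apply: aeW => y [yK _]; rewrite wp// MP.
Qed.

(** The domain is open and the face lies in the closure of the element. *)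
Lemma face_cells0 e K : e \in faces0 T Om0 -> K \in elements T -> e \subset K ->
  K \in cells0 T Om0.
Proof.
rewrite inE => /andP[_ /asboolP[x [xe xO]]] KT eK; rewrite inE KT /=; apply/asboolP.
have := element_closure tr KT eK xe => /(_ _ (open_nbhs_nbhs (conj oOm0 xO))).
by move=> [y [yK yO]]; exists y.
Qed.

Lemma enorm_sum_le (I : finType) (A : pred I) (F : I -> 'rV[R]_n.+1) (B : R) :
  (forall i, A i -> enorm (F i) <= B) -> enorm (\sum_(i | A i) F i) <= #|A|%:R * B.
Proof.
move=> FB; apply: (@le_trans _ _ (\sum_(i | A i) enorm (F i))).
  elim/big_rec2: _ => [|i x y _ xy]; first by rewrite enorm0.
  by apply: le_trans (ler_enormD _ _) _; rewrite lerD2l.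
apply: (@le_trans _ _ (\sum_(i | A i) B)); first exact: ler_sum.
by rewrite sumr_const mulr_natl.
Qed.

(** Each trace is at most the square root of the bound of its own element, hence
    of the sum over all elements at the face, and there are at most
    [packing_bound] of them. *)
Lemma average_grad_le e x : e \in faces0 T Om0 ->
  enorm (average_grad Om0 e w x) ^+ 2 <= @packing_bound R n sigma ^+ 2 *
    (trace_const / h ^+ n.+1) *
    \sum_(K in elements T | e \subset K) fine (cell_energy (src K)).
Proof.
move=> e0; set B := trace_const / h ^+ n.+1; set E := \sum_(_ | _) _.
have ef := faces0_faces e0; have [K1 [K1T eK1 _]] := faceP ef.
have B0 : 0 <= B.
  by rewrite /B /trace_const -mulrA mulr_ge0// (inverse_scale_ge0 K1T).
have fE0 K : 0 <= fine (cell_energy K) by rewrite fine_ge0// cell_energy_ge0.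
have E0 : 0 <= E by apply: sumr_ge0.
have BE0 : 0 <= B * E by rewrite mulr_ge0.
rewrite -mulrA -[B * E]sqr_sqrtr// -exprMn.
have p0 : 0 <= @packing_bound R n sigma.
  by apply: le_trans (card_elements_at_face tr qu ef); exact: ler0n.
rewrite lerXn2r ?nnegrE ?enorm_ge0 ?mulr_ge0 ?sqrtr_ge0//.
rewrite /average_grad enormZ ger0_norm ?invr_ge0//.
apply: (@le_trans _ _ (enorm (\sum_(K in elements T | e \subset K) grad_trace Om0 K w x))).
  by rewrite ler_piMl ?enorm_ge0// invf_le1// ler1n.
apply: (le_trans (enorm_sum_le (B := Num.sqrt (B * E)) _)).
  move=> K /andP[KT eK]; have K0 := face_cells0 e0 KT eK.
  rewrite -[leLHS]ger0_norm ?enorm_ge0// -sqrtr_sqr ler_sqrt//.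
  apply: le_trans (grad_trace_le x K0) _; apply: ler_wpM2l => //.
  by rewrite /E (bigD1 K) ?KT//= lerDl sumr_ge0.
apply: ler_wpM2r; first exact: sqrtr_ge0.
apply: le_trans (card_elements_at_face tr qu ef); rewrite ler_nat.
by apply/eq_leq/eq_card => K; rewrite !inE.
Qed.

End discrete_gradients.

(** * Fluxes are controlled by the gradient energy *)

Section flux_bounds.
Context {R : realType} {n : nat} (T : mesh R n.+1).
Implicit Types (V K e : {set 'I_(nnodes T)}) (x y z : 'rV[R]_n.+1).
Variables (Om Om0 : set 'rV[R]_n.+1) (sigma : R).
Variable intK : {set 'I_(nnodes T)} -> {set 'I_(nnodes T)}.
Variables (m : nat) (cs : bool).
Hypotheses (n0 : (0 < n)%N) (oOm0 : open Om0).
Hypothesis adm : admissible_mesh Om0 Om sigma intK.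
Variable w : 'rV[R]_n.+1 -> R.
Hypothesis wV : Vh Om0 intK m cs w.
Variable Cs : R.
Hypotheses (Cs0 : 0 < Cs) (sb : surface_bounded (frontier Om0) Cs).
Local Notation leb := (lebesgue_rV n.+1).
Local Notation surf := (@hausdorff R n.+1 n).
Local Notation h := (mesh_size T).
Local Notation src := (source Om0 intK).
Let tr := admissible_tr adm.
Let qu := admissible_qu adm.
Local Notation pb := (@packing_bound R n sigma).
Local Notation tc := (@trace_const R n sigma m).
Local Notation E K := (fine (cell_energy Om0 w K)).

Let mw K (KT : K \in elements T) := measurable_Vh adm wV KT.

Definition face_area : R := unit_ball_volume n * (8 * n%:R) ^+ n.

Lemma face_area_ge0 : 0 <= face_area.
Proof. by rewrite mulr_ge0 ?unit_ball_volume_ge0// exprn_ge0// mulr_ge0. Qed.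

Lemma surf_face_le e : e \in faces0 T Om0 ->
  (surf (simplex e `&` Om0) <= (face_area * h ^+ n)%:E)%E.
Proof.
move=> e0; apply: le_trans (hausdorff_face tr (faces0_faces e0)).
by apply: le_hausdorff => x [].
Qed.

Lemma surf_interface_le K : K \in elements T ->
  (surf (simplex K `&` frontier Om0) <= (Cs * h ^+ n)%:E)%E.
Proof.
move=> KT; have h0 := mesh_size_gt0 tr KT.
have [z zK] : simplex K !=set0.
  by apply: simplex_neq0; rewrite -card_gt0 (element_card tr).
apply: le_trans (sb z (ltW h0)); apply: le_hausdorff => x [xK xF]; split => //.
exact: le_trans (enorm_le_diam xK zK) (diam_le_mesh_size KT).
Qed.

(** The weight [h], the area [h ^+ n] and the pointwise bound [h ^- n.+1]
    multiply to a constant. *)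
Lemma weighted_sq_le (S : set 'rV[R]_n.+1) (q : 'rV[R]_n.+1 -> 'rV[R]_n.+1) (d a c F : R) :
  measurable S -> vmeasurable S q -> 0 <= d <= h -> 0 < h -> 0 <= a -> 0 <= c -> 0 <= F ->
  (surf S <= (a * h ^+ n)%:E)%E ->
  (forall x, S x -> enorm (q x) ^+ 2 <= c / h ^+ n.+1 * F) ->
  (weighted_sq surf d S q <= (a * (c * F))%:E)%E.
Proof.
move=> mS mq /andP[d0 dh] h0 a0 c0 F0 Sa qc.
have B0 : 0 <= c / h ^+ n.+1 * F by rewrite mulr_ge0// divr_ge0// exprn_ge0// ltW.
apply: (@le_trans _ _ (h%:E * ((c / h ^+ n.+1 * F)%:E * (a * h ^+ n)%:E))%E).
  apply: lee_pmul => //; first exact: L2_norm_sq_ge0.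
  apply: le_trans (@L2_norm_sq_le _ _ surf _ _ _ mS mq B0 qc) _.
  by apply: lee_wpmul2l; rewrite ?lee_fin.
rewrite -!EFinM lee_fin le_eqVlt; apply/orP; left; apply/eqP.
by rewrite exprS; field; rewrite expf_neq0 gt_eqF.
Qed.

(** The energy on the source, scaled so that the fluxes through the faces and
    the interface inside [K] are bounded by multiples of it. *)
Definition cell_load K : R := tc * E (src K).

Lemma cell_load_ge0 K : K \in elements T -> 0 <= cell_load K.
Proof.
move=> KT; rewrite mulr_ge0 ?fine_ge0 ?cell_energy_ge0//.
by rewrite mulr_ge0// ltW// (inverse_const_gt0 m adm KT).
Qed.

Lemma face_flux_le e : e \in faces0 T Om0 ->
  (weighted_sq surf (diam e) (simplex e `&` Om0) (average_grad Om0 e w) <=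
   (face_area * (pb ^+ 2 * \sum_(K in elements T | e \subset K) cell_load K))%:E)%E.
Proof.
move=> e0; have ef := faces0_faces e0; have [K [KT _ _]] := faceP ef.
have mS := measurable_face0 oOm0 adm e0.
rewrite /cell_load -mulr_sumr [pb ^+ 2 * _]mulrA.
apply: weighted_sq_le => //.
- exact: (measurable_average_grad oOm0 adm).
- by rewrite (ltW (face_diam_gt0 n0 adm e0)) (diam_face_le tr ef).
- exact: (mesh_size_gt0 tr KT).
- exact: face_area_ge0.
- rewrite mulr_ge0 ?sqr_ge0// mulr_ge0// ltW//.
  exact: (inverse_const_gt0 m adm KT).
- by apply: sumr_ge0 => K' _; rewrite fine_ge0 ?cell_energy_ge0.
- exact: surf_face_le.
- by move=> x _; rewrite -[pb ^+ 2 * _ / _]mulrA; exact: (average_grad_le oOm0 adm wV).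
Qed.

Lemma interface_flux_le K : K \in cells_cut T Om0 ->
  (weighted_sq surf (diam K) (simplex K `&` frontier Om0) (grad_trace Om0 K w) <=
   (Cs * cell_load K)%:E)%E.
Proof.
move=> Kc; have KT := cells_cut_elements Kc; have K0 := cells_cut_cells0 adm Kc.
have mS := measurable_interface adm KT.
apply: weighted_sq_le => //.
- exact: (measurable_grad_trace oOm0 adm).
- by rewrite (ltW (cut_diam_gt0 adm Kc)) (diam_le_mesh_size KT).
- exact: (mesh_size_gt0 tr KT).
- exact: ltW.
- by rewrite mulr_ge0// ltW// (inverse_const_gt0 m adm KT).
- by rewrite fine_ge0 ?cell_energy_ge0.
- exact: surf_interface_le.
- by move=> x _; exact: (grad_trace_le oOm0 adm wV).
Qed.

(** An element has fewer than [2 ^ n.+2] faces, since these are subsets of its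
    [n.+2] vertices. *)
Lemma sum_face_load_le :
  \sum_(e in faces0 T Om0) \sum_(K in elements T | e \subset K) cell_load K <=
  (2 ^ n.+2)%:R * \sum_(K in cells0 T Om0) cell_load K.
Proof.
rewrite (exchange_big_dep (fun K => K \in cells0 T Om0)) /=; last first.
  by move=> e K e0 /andP[KT eK]; exact: (face_cells0 oOm0 adm e0).
rewrite mulr_sumr; apply: ler_sum => K K0; have KT := cells0_elements K0.
rewrite sumr_const -[leLHS]mulr_natl; apply: ler_wpM2r; first exact: cell_load_ge0.
rewrite ler_nat -(element_card tr KT) -card_powerset.
by apply: subset_leq_card; apply/fintype.subsetP => e; rewrite !inE => /and3P[_ _].
Qed.

(** Elements with the same source are adjacent to it, so at most [packing_bound]
    of them share it. *)
Lemma sum_load_le : \sum_(K in cells0 T Om0) cell_load K <=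
  pb * (tc * \sum_(K in cells0 T Om0) E K).
Proof.
rewrite (partition_big src (fun K => K \in cells0 T Om0)) /=; last first.
  by move=> K K0; have := source_int adm K0; rewrite inE => /andP[].
rewrite !mulr_sumr; apply: ler_sum => K' K'0; have K'T := cells0_elements K'0.
rewrite (eq_bigr (fun=> tc * E K')) => [|K /andP[_ /eqP KK']]; last by rewrite /cell_load KK'.
rewrite sumr_const -[leLHS]mulr_natl; apply: ler_wpM2r.
  rewrite mulr_ge0 ?fine_ge0 ?cell_energy_ge0//.
  by rewrite mulr_ge0// ltW// (inverse_const_gt0 m adm K'T).
rewrite -cardsE; apply: (card_adjacent tr qu K'T) => K; rewrite inE => /andP[K0 /eqP <-].
by split; [exact: cells0_elements K0|exact: (source_adjacent adm)].
Qed.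

Definition flux_const : R :=
  (face_area * pb ^+ 2 * (2 ^ n.+2)%:R + Cs) * (pb * tc).

Lemma flux_le : (face_flux T Om0 w + interface_flux T Om0 w <=
  (flux_const * fine (gradient_energy T Om0 w))%:E)%E.
Proof.
set L := \sum_(K in cells0 T Om0) cell_load K.
have L0 : 0 <= L by apply: sumr_ge0 => K /cells0_elements; exact: cell_load_ge0.
have b1 : (face_flux T Om0 w <= (face_area * pb ^+ 2 * (2 ^ n.+2)%:R * L)%:E)%E.
  apply: (@le_trans _ _ (\sum_(e in faces0 T Om0) (face_area *
      (pb ^+ 2 * \sum_(K in elements T | e \subset K) cell_load K))%:E)%E).
    by apply: lee_sum => e; exact: face_flux_le.
  rewrite sumEFin lee_fin -!mulr_sumr mulrA -[leRHS]mulrA.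
  apply: ler_wpM2l sum_face_load_le.
  by apply: mulr_ge0; [exact: face_area_ge0|exact: sqr_ge0].
have b2 : (interface_flux T Om0 w <= (Cs * L)%:E)%E.
  apply: (@le_trans _ _ (\sum_(K in cells_cut T Om0) (Cs * cell_load K)%:E)%E).
    by apply: lee_sum => K; exact: interface_flux_le.
  rewrite sumEFin lee_fin -mulr_sumr ler_wpM2l ?(ltW Cs0)//.
  rewrite big_mkcond [leRHS]big_mkcond /=; apply: ler_sum => K _.
  case: ifPn => Kc; first by rewrite (cells_cut_cells0 adm Kc).
  by case: ifP => // /cells0_elements; exact: cell_load_ge0.
apply: le_trans (leeD b1 b2) _; rewrite -EFinD lee_fin -mulrDl /flux_const -[leRHS]mulrA.
apply: ler_wpM2l.
  apply: addr_ge0 (ltW Cs0); apply: mulr_ge0 => //.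
  by apply: mulr_ge0; [exact: face_area_ge0|exact: sqr_ge0].
apply: le_trans sum_load_le _; rewrite mulrA /gradient_energy -sum_fine// => K K0.
exact: (cell_energy_fin oOm0 adm wV).
Qed.

End flux_bounds.

(** * Coercivity *)

Section vector_bounds.
Context {R : realType} {n : nat}.
Implicit Types (S : set 'rV[R]_n).

Lemma vbounded_sum S (I : Type) (r : seq I) (P : pred I) (q : I -> 'rV[R]_n -> 'rV[R]_n) :
  (forall i, P i -> vbounded S (q i)) -> vbounded S (fun x => \sum_(i <- r | P i) q i x).
Proof.
move=> bq; elim: r => [|i r [M IH]].
  by exists 0 => x _; rewrite big_nil enorm0.
have [Pi|Pi] := boolP (P i); last by exists M => x Sx; rewrite big_cons (negbTE Pi) IH.
have [N qN] := bq i Pi; exists (N + M) => x Sx; rewrite big_cons Pi.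
by apply: le_trans (ler_enormD _ _) _; rewrite lerD ?qN ?IH.
Qed.

Lemma vbounded_scale S (f : 'rV[R]_n -> R) (q : 'rV[R]_n -> 'rV[R]_n) (M : R) :
  (forall x, S x -> `|f x| <= M) -> vbounded S q -> vbounded S (fun x => f x *: q x).
Proof.
move=> fM [N qN]; exists (M * N) => x Sx; rewrite enormZ.
by apply: ler_pM; rewrite ?enorm_ge0 ?fM ?qN.
Qed.

Lemma enorm_outward_normal_le (D : set 'rV[R]_n) x : enorm (outward_normal D x) <= 1.
Proof.
by rewrite /outward_normal; case: xgetP => [_ _ [-> _]|_] //; rewrite enorm0.
Qed.

End vector_bounds.

Section coercivity.
Context {R : realType} {n : nat} (T : mesh R n.+1).
Implicit Types (V K e : {set 'I_(nnodes T)}) (x y z : 'rV[R]_n.+1).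
Variables (Om Om0 : set 'rV[R]_n.+1) (sigma : R).
Variable intK : {set 'I_(nnodes T)} -> {set 'I_(nnodes T)}.
Variables (m : nat) (cs : bool).
Hypotheses (n0 : (0 < n)%N) (oOm0 : open Om0).
Hypothesis adm : admissible_mesh Om0 Om sigma intK.
Variable w : 'rV[R]_n.+1 -> R.
Hypothesis wV : Vh Om0 intK m cs w.
Variable Cs : R.
Hypotheses (Cs0 : 0 < Cs) (sb : surface_bounded (frontier Om0) Cs).
Local Notation leb := (lebesgue_rV n.+1).
Local Notation surf := (@hausdorff R n.+1 n).
Local Notation src := (source Om0 intK).
Let tr := admissible_tr adm.

Let mw K (KT : K \in elements T) := measurable_Vh adm wV KT.

Let flux_bound : R := `|@flux_const R n sigma m Cs| + 1.

Lemma vbounded_of_sqr (S : set 'rV[R]_n.+1) (q : 'rV[R]_n.+1 -> 'rV[R]_n.+1) (B : R) :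
  (forall x, S x -> enorm (q x) ^+ 2 <= B) -> vbounded S q.
Proof.
move=> qB; exists (Num.sqrt B) => x Sx.
by rewrite -[leLHS]ger0_norm ?enorm_ge0// -sqrtr_sqr; apply: ler_wsqrtr; exact: qB.
Qed.

Lemma face_term_le (mu delta : R) e : e \in faces0 T Om0 -> 0 < delta ->
  let A := weighted_sq surf (diam e) (simplex e `&` Om0) (average_grad Om0 e w) in
  let J := weighted_sq surf (diam e)^-1 (simplex e `&` Om0) (jump Om0 e w) in
  [/\ A \is a fin_num, J \is a fin_num &
  \int[surf]_(x in simplex e `&` Om0)
      (dotr (average_grad Om0 e w x) (jump Om0 e w x)
       + dotr (average_grad Om0 e w x) (jump Om0 e w x)
       - mu / diam e * dotr (jump Om0 e w x) (jump Om0 e w x)) <=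
  delta * fine A - (mu - delta^-1) * fine J].
Proof.
move=> e0 d0 A J; have mS := measurable_face0 oOm0 adm e0.
apply: face_form_young => //.
- exact: le_lt_trans (surf_face_le adm e0) (ltry _).
- exact: (measurable_average_grad oOm0 adm).
- exact: (measurable_jump oOm0 adm).
- by apply: vbounded_of_sqr => x _; exact: (average_grad_le oOm0 adm wV x e0).
- apply: vbounded_sum => K /andP[KT eK].
  have [M _ MP] := cell_trace_bounded oOm0 adm wV (face_cells0 oOm0 adm e0 KT eK).
  by apply: (vbounded_scale (M := M)) => //; exists (enorm (face_normal K e)).
- exact: (face_diam_gt0 n0 adm).
Qed.

Lemma interface_term_le (mu delta : R) K : K \in cells_cut T Om0 -> 0 < delta ->
  let A := weighted_sq surf (diam K) (simplex K `&` frontier Om0) (grad_trace Om0 K w) in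
  let J := weighted_sq surf (diam K)^-1 (simplex K `&` frontier Om0) (bnd_jump Om0 K w) in
  [/\ A \is a fin_num, J \is a fin_num &
  \int[surf]_(x in simplex K `&` frontier Om0)
      (dotr (grad_trace Om0 K w x) (bnd_jump Om0 K w x)
       + dotr (grad_trace Om0 K w x) (bnd_jump Om0 K w x)
       - mu / diam K * dotr (bnd_jump Om0 K w x) (bnd_jump Om0 K w x)) <=
  delta * fine A - (mu - delta^-1) * fine J].
Proof.
move=> Kc d0 A J; have KT := cells_cut_elements Kc; have K0 := cells_cut_cells0 adm Kc.
have mS := measurable_interface adm KT.
apply: face_form_young => //.
- exact: le_lt_trans (surf_interface_le adm sb KT) (ltry _).
- exact: (measurable_grad_trace oOm0 adm).
- exact: (measurable_bnd_jump oOm0 adm).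
- by apply: vbounded_of_sqr => x _; exact: (grad_trace_le oOm0 adm wV x K0).
- have [M _ MP] := cell_trace_bounded oOm0 adm wV K0.
  apply: (vbounded_scale (M := M)) => //; exists 1 => x _.
  exact: enorm_outward_normal_le.
- exact: (cut_diam_gt0 adm).
Qed.

Lemma integral_sqr_grad K : K \in cells0 T Om0 ->
  \int[leb]_(x in simplex K `&` Om0) dotr (grad Om0 K w x) (grad Om0 K w x) =
  fine (cell_energy Om0 w K).
Proof.
move=> K0; rewrite /Rintegral /cell_energy /L2_norm_sq; congr fine.
by apply: eq_integral => x _; rewrite sqr_enorm.
Qed.

(** With [delta = 1 / (2 * flux_bound)] the fluxes use up at most half of the
    gradient energy, and the penalty exceeds [1 / delta] by 1, so the jumps keep
    weight 1. The norm adds to these terms only fluxes, at most [flux_bound]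
    times the gradient energy. *)
Theorem a_h_coercive (mu : R) : 2 * flux_bound + 1 <= mu ->
  ((2 * (1 + flux_bound))^-1%:E * dg_norm T Om0 w ^+ 2 <= (a_h T Om0 mu w w)%:E)%E.
Proof.
move=> hmu; have c0 : 0 < flux_bound by rewrite ltr_wpDl.
have d0 : 0 < (2 * flux_bound)^-1 by rewrite invr_gt0 mulr_gt0.
have [g0 f0 j0 i0 b0] := energies_ge0 n0 adm w.
have Gfin : gradient_energy T Om0 w \is a fin_num.
  by apply/sum_fin_numP => K _ K0; exact: (cell_energy_fin oOm0 adm wV).
have [Ffin Jfin] : face_flux T Om0 w \is a fin_num /\ face_jump T Om0 w \is a fin_num.
  by split; apply/sum_fin_numP => e _ e0; have [] := face_term_le 0 e0 d0.
have [Ifin Bfin] : interface_flux T Om0 w \is a fin_num /\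
    interface_jump T Om0 w \is a fin_num.
  by split; apply/sum_fin_numP => K _ Kc; have [] := interface_term_le 0 Kc d0.
have fl := flux_le n0 oOm0 adm wV Cs0 sb.
have aG : \sum_(K in cells0 T Om0)
    \int[leb]_(x in simplex K `&` Om0) dotr (grad Om0 K w x) (grad Om0 K w x) =
    fine (gradient_energy T Om0 w).
  rewrite /gradient_energy -sum_fine => [|K K0]; last exact: (cell_energy_fin oOm0 adm wV).
  by apply: eq_bigr => K K0; exact: integral_sqr_grad.
have aF : \sum_(e in faces0 T Om0) \int[surf]_(x in simplex e `&` Om0)
      (dotr (average_grad Om0 e w x) (jump Om0 e w x)
       + dotr (average_grad Om0 e w x) (jump Om0 e w x)
       - mu / diam e * dotr (jump Om0 e w x) (jump Om0 e w x)) <=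
    (2 * flux_bound)^-1 * fine (face_flux T Om0 w) -
    (mu - (2 * flux_bound)^-1^-1) * fine (face_jump T Om0 w).
  rewrite /face_flux /face_jump -!sum_fine; try by move=> e e0; have [] := face_term_le 0 e0 d0.
  by rewrite !mulr_sumr -sumrB; apply: ler_sum => e e0; have [] := face_term_le mu e0 d0.
have aB : \sum_(K in cells_cut T Om0) \int[surf]_(x in simplex K `&` frontier Om0)
      (dotr (grad_trace Om0 K w x) (bnd_jump Om0 K w x)
       + dotr (grad_trace Om0 K w x) (bnd_jump Om0 K w x)
       - mu / diam K * dotr (bnd_jump Om0 K w x) (bnd_jump Om0 K w x)) <=
    (2 * flux_bound)^-1 * fine (interface_flux T Om0 w) -
    (mu - (2 * flux_bound)^-1^-1) * fine (interface_jump T Om0 w).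
  rewrite /interface_flux /interface_jump -!sum_fine;
    try by move=> K Kc; have [] := interface_term_le 0 Kc d0.
  by rewrite !mulr_sumr -sumrB; apply: ler_sum => K Kc; have [] := interface_term_le mu Kc d0.
rewrite dg_normE sqr_sqrte ?adde_ge0//.
rewrite /a_h aG; move: aF aB; set s2 := (X in X <= _) => aF; set s3 := (X in X <= _) => aB.
rewrite -[X in (_ <= (_ - X - _)%:E)%E]/s2 -[X in (_ <= (_ - _ - X)%:E)%E]/s3.
clearbody s2 s3; clear aG.
move: g0 f0 j0 i0 b0 Gfin Ffin Jfin Ifin Bfin fl aF aB.
move: (gradient_energy T Om0 w) (face_flux T Om0 w) (face_jump T Om0 w)
  (interface_flux T Om0 w) (interface_jump T Om0 w) => [g| |] [f| |] [j| |] [i| |] [b| |] //=.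
rewrite !lee_fin invrK => g0 f0 j0 i0 b0 _ _ _ _ _ fl aF aB.
have fl' : f + i <= flux_bound * g.
  apply: le_trans fl _; apply: ler_wpM2r => //.
  by rewrite /flux_bound (le_trans (ler_norm _))// lerDl.
have e1 : (2 * flux_bound)^-1 * (f + i) <= 2^-1 * g.
  by rewrite invfM -mulrA ler_wpM2l// ler_pdivrMl.
have e2 : (mu - 2 * flux_bound) * (j + b) >= j + b.
  by rewrite ler_peMl ?addr_ge0//; lra.
rewrite mulrC ler_pdivrMr; last by rewrite mulr_gt0// addr_gt0.
have e3 : 2^-1 * g + (j + b) <= g - s2 - s3 by lra.
have e4 : (2^-1 * g + (j + b)) * (2 * (1 + flux_bound)) <= (g - s2 - s3) * (2 * (1 + flux_bound)).
  by apply: ler_wpM2r => //; rewrite mulr_ge0// addr_ge0// ltW.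
apply: le_trans e4; have e5 : 0 <= flux_bound * (j + b) by rewrite mulr_ge0 ?addr_ge0// ltW.
by move: fl' e5 c0; move: flux_bound => c; lra.
Qed.

End coercivity.

Theorem lemma3 (R : realType) (d : nat) (hd : d = 2%N \/ d = 3%N)
    (Om Om0 : set 'rV[R]_d)
    (hOm : convex_polytope Om)
    (hOm0 : [/\ Om0 !=set0, open Om0 & connected Om0])
    (hcompact : compact (closure Om0)) (hsub : closure Om0 `<=` Om)
    (hGamma : C2_boundary Om0 \/ convex_polytope Om0)
    (sigma : R) (m : nat) (hm : (1 <= m)%N) (continuous_space : bool) :
  (forall mu : R, 0 < mu -> exists2 C : R, 0 < C &
    forall (T : mesh R d) (intK : {set 'I_(nnodes T)} -> {set 'I_(nnodes T)}),
      admissible_mesh Om0 Om sigma intK ->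
      forall u v : 'rV[R]_d -> R,
        Vh_plus_H2 Om0 intK m continuous_space u ->
        Vh_plus_H2 Om0 intK m continuous_space v ->
        (`|a_h T Om0 mu u v|%:E <= C%:E * (dg_norm T Om0 u * dg_norm T Om0 v))%E)
  /\
  (exists2 mu0 : R, 0 < mu0 &
    forall mu : R, mu0 <= mu -> exists2 C : R, 0 < C &
    forall (T : mesh R d) (intK : {set 'I_(nnodes T)} -> {set 'I_(nnodes T)}),
      admissible_mesh Om0 Om sigma intK ->
      forall v : 'rV[R]_d -> R,
        Vh Om0 intK m continuous_space v ->
        (C%:E * dg_norm T Om0 v ^+ 2 <= (a_h T Om0 mu v v)%:E)%E).
Proof.
have [n n0 dE] : exists2 n, (0 < n)%N & d = n.+1.
  by case: hd => ->; [exists 1%N|exists 2%N].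
move: Om Om0 hOm hOm0 hcompact hsub hGamma; rewrite {}dE => Om Om0 _ [_ oOm0 _] hc _ hG.
split=> [mu mu0|].
  exists (5 + 2 * mu); first by rewrite addr_gt0// mulr_gt0.
  by move=> T intK adm u v uV vV; exact: (a_h_continuous n0 oOm0 adm (ltW mu0) uV vV).
have [Cs Cs0 sb] := surface_bounded_frontier oOm0 hc hG.
pose c : R := `|@flux_const R n sigma m Cs| + 1.
have c0 : 0 < c by rewrite ltr_wpDl.
exists (2 * c + 1); first by rewrite addr_gt0// mulr_gt0.
move=> mu hmu; exists (2 * (1 + c))^-1.
  by rewrite invr_gt0 mulr_gt0// addr_gt0.
by move=> T intK adm v vV; exact: (a_h_coercive n0 oOm0 adm vV Cs0 sb).
Qed.
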